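(* For an integer $\gamma\ge2$ and $n\in\mathbb{N}$ let $B_{n,\gamma}(x)=\sum_{k=0}^n\binom nk^\gamma x^k$. For every integer $\gamma\geq 2$, the sequence of probability measures $[\![B_{n,\gamma}]\!]_n$ converges weakly, as $n\to\infty$, to a probability measure $\mu_{B,\gamma}$ on the interval $(-\infty,0)$ which has the following properties. Cauchy transform: $$\int_{(-\infty,0)}\frac{\mu_{B,\gamma}(\mathrm{d}z)}{t-z}=\frac{1}{t(t^{-1/\gamma}+1)},\qquad t\in\mathbb{C}\setminus(-\infty,0].$$ Lebesgue density: $$p_{B,\gamma}(x)=\frac{\sin(\pi/\gamma)}{\pi|x|\left(|x|^{-1/\gamma}+2\cos(\pi/\gamma)+|x|^{1/\gamma}\right)},\qquad x\in(-\infty,0).$$ Logarithmic potential: $$\int_{(-\infty,0)}\log|t-z|\,\mu_{B,\gamma}(\mathrm{d}z)=\gamma\log\left|1+t^{1/\gamma}\right|,\qquad t\in\mathbb{C}\setminus(-\infty,0].$$ Here $t\mapsto t^{1/\gamma}$ is the branch on $\mathbb{C}\setminus(-\infty,0]$ which attains real values on the positive half-line. Moreover, for the Narayana polynomials $N_n(x)=\sum_{k=1}^nN_{n,k-1}x^k$ with $N_{n,k}=\frac1{k+1}\binom nk\binom{n-1}k$, $k\in\{0,\ldots,n-1\}$, the sequence of probability measures $[\![N_n]\!]_n$ converges weakly to $\mu_{B,2}$.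
   Context: For a polynomial $P\not\equiv0$ of degree at most $n$, $[\![P]\!]_n:=\frac1n\sum_{z\in\mathbb{C}:P(z)=0}\delta_z+\frac{n-\deg P}{n}\delta_\infty$ (zeros counted with multiplicity) is the empirical distribution of zeros. The polynomials $B_{n,\gamma}$ ($\gamma\geq 2$ an integer) and $N_n$ have only real nonpositive zeros. The branch of $t^{1/\gamma}$ is positive for $t>0$, i.e. it is the principal branch, and $t^{-1/\gamma}=1/t^{1/\gamma}$. *)

(* Defs.v *)
From HB Require Import structures.
From mathcomp Require Import all_boot all_order all_algebra complex.
From mathcomp Require Import all_classical all_reals all_analysis.
From mathcomp Require Import measurable_realfun ring.

Set Implicit Arguments.
Unset Strict Implicit.
Unset Printing Implicit Defensive.

Import Order.TTheory GRing.Theory Num.Theory.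
Import numFieldNormedType.Exports.
Import ComplexField.Normc.

Local Open Scope classical_set_scope.
Local Open Scope complex_scope.
Local Open Scope ring_scope.

Definition borel (T : ptopologicalType) : measurableType (@open T).-sigma :=
  g_sigma_algebraType (@open T).

Definition weak_cvg (R : realType) (T : ptopologicalType)
    (nu : nat -> {measure set (borel T) -> \bar R})
    (mu : {measure set (borel T) -> \bar R}) : Prop :=
  forall f : T -> R, continuous f -> (exists M : R, forall x, `|f x| <= M) ->
    (fun n => \int[nu n]_x f x) @ \oo --> \int[mu]_x f x.

(* The Riemann sphere; [None] is the point at infinity. The alias [R[i]^o]
   carries the topology of the complex modulus. *)
Definition sphere (R : realType) : ptopologicalType :=
  one_point_compactification R[i]^o.

Definition real_to_sphere (R : realType) (x : measurableTypeR R) :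
  borel (sphere R) := Some (x%:C : R[i]^o).

Lemma continuous_real_complex (R : realType) :
  continuous (fun x : R => x%:C : R[i]^o).
Proof.
move=> x; apply/cvgrPdist_lt => -[e i]; rewrite ltcE /= => /andP[/eqP -> e0].
near=> y; rewrite -rmorphB /= normc_def /= expr0n addr0 sqrtr_sqr ltcR.
near: y; exact: (@cvgr_dist_lt _ _ _ (nbhs x) _ id x).
Unshelve. all: by end_near. Qed.

Lemma measurable_real_to_sphere (R : realType) :
  measurable_fun setT (@real_to_sphere R).
Proof.
apply: (@measurability _ _ _ (borel (sphere R)) _ _ (@open (sphere R))) => //.
move=> _ [U oU <-]; rewrite setTI.
apply: open_measurable.
apply: (@open_comp _ (sphere R) (fun x : R => Some (x%:C : R[i]^o))) => // x _.
by move=> V /continuous_real_complex.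
Qed.

HB.instance Definition _ (R : realType) :=
  @isMeasurableFun.Build _ _ _ _ (@real_to_sphere R)
    (@measurable_real_to_sphere R).

(* Each zero is listed as often as its multiplicity, see [zerosE]. *)
Definition zeros (R : realType) (P : {poly R[i]}) : seq R[i] :=
  sval (closed_field_poly_normal P).

Lemma zerosE (R : realType) (P : {poly R[i]}) :
  P = lead_coef P *: \prod_(z <- zeros P) ('X - z%:P).
Proof. exact: (svalP (closed_field_poly_normal P)). Qed.

(* Meant for [P != 0] of degree [(size P).-1 <= n]; [empirical 0 P] is the
   null measure since [0^-1 = 0]. *)
Definition empirical (R : realType) (n : nat) (P : {poly R[i]}) :
    {measure set (borel (sphere R)) -> \bar R} :=
  measure_add
    (mscale (n%:R^-1)%:nng
       (msum (fun i => \d_(Some ((zeros P)`_i) : borel (sphere R)))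
             (size (zeros P))))
    (mscale ((n - (size P).-1)%:R / n%:R)%:nng
       (\d_(None : borel (sphere R)))).

Lemma empirical_setT (R : realType) (n : nat) (P : {poly R[i]}) :
  (0 < n)%N -> P != 0 -> (size P <= n.+1)%N -> empirical n P setT = 1%E.
Proof.
move=> n0 P0 sP.
have sz : size (zeros P) = (size P).-1.
  rewrite {2}(zerosE P) size_scale ?lead_coef_eq0// size_prod_XsubC//.
have dT (z : borel (sphere R)) : \d_z setT = 1%E :> \bar R by exact: diracT.
rewrite /empirical /= /measure_add /msum 2!big_ord_recl big_ord0 /= /mscale /=.
rewrite /msum adde0 dT mule1 (eq_bigr (fun=> 1%E)) => [|i _]; last exact: dT.
rewrite sumEFin sumr_const card_ord sz -EFinM -EFinD; congr (_%:E).
rewrite mulrC -mulrDl -natrD subnKC ?divff ?pnatr_eq0 -?lt0n//.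
by case: (size P) sP.
Qed.

Definition cintegrable d (T : measurableType d) (R : realType)
    (mu : {measure set T -> \bar R}) (D : set T) (f : T -> R[i]) : Prop :=
  mu.-integrable D (fun x => (complex.Re (f x))%:E) /\
  mu.-integrable D (fun x => (complex.Im (f x))%:E).

Definition cintegral d (T : measurableType d) (R : realType)
    (mu : {measure set T -> \bar R}) (D : set T) (f : T -> R[i]) : R[i] :=
  (\int[mu]_(x in D) complex.Re (f x)) +i* (\int[mu]_(x in D) complex.Im (f x)).

Definition slit_plane (R : realType) : set R[i] :=
  ~` [set x%:C | x in `]-oo, (0 : R)]].

(* Principal argument, with values in ]-pi, pi] for [z != 0]. *)
Definition carg (R : realType) (z : R[i]) : R :=
  let theta := acos (complex.Re z / normc z) in
  if 0 <= complex.Im z then theta else - theta.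

(* On [slit_plane], the branch of the [gamma]-th root that is positive on the
   positive half-line; [gamma.-root z] is another branch. *)
Definition principal_root (R : realType) (gamma : nat) (z : R[i]) : R[i] :=
  (normc z `^ gamma%:R^-1)%:C *
  (cos (carg z / gamma%:R) +i* sin (carg z / gamma%:R)).

Lemma carg_polar (R : realType) (z : R[i]) :
  z = (normc z)%:C * (cos (carg z) +i* sin (carg z)).
Proof.
have [->|z0] := eqVneq z 0; first by rewrite normc0 mul0r.
have r0 : 0 < normc z.
  rewrite lt_neqAle eq_sym; apply/andP; split.
    by apply: contra z0 => /eqP/eq0_normc ->.
  by case: (z) => a b; exact: sqrtr_ge0.
have rE : normc z ^+ 2 = complex.Re z ^+ 2 + complex.Im z ^+ 2.
  by case: (z) => a b /=; rewrite sqr_sqrtr// addr_ge0 ?sqr_ge0.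
have cB : -1 <= complex.Re z / normc z <= 1.
  rewrite -ler_norml normf_div (gtr0_norm r0) ler_pdivrMr// mul1r.
  rewrite -(@ler_pXn2r _ 2) ?nnegrE ?(ltW r0)//.
  by rewrite real_normK ?num_real// rE lerDl sqr_ge0.
have sE : sin (acos (complex.Re z / normc z)) = `|complex.Im z| / normc z.
  rewrite sin_acos//.
  have -> : 1 - (complex.Re z / normc z) ^+ 2 = (complex.Im z / normc z) ^+ 2.
    by rewrite !expr_div_n -[1](@divff _ (normc z ^+ 2)) ?sqrf_eq0 ?gt_eqF//
      -mulrBl rE addrAC subrr add0r.
  by rewrite sqrtr_sqr normf_div (gtr0_norm r0).
apply/eqP; rewrite eq_complex /= !mul0r subr0 addr0 /carg; apply/andP.
have rK x : normc z * (x / normc z) = x by rewrite mulrC divfK// gt_eqF.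
case: ifPn => [i0|]; last rewrite -ltNge => i0.
  by rewrite acosK// sE rK ger0_norm// rK !eqxx.
by rewrite cosN sinN acosK// sE ltr0_norm// mulNr opprK !rK !eqxx.
Qed.

Lemma principal_rootX (R : realType) (gamma : nat) (z : R[i]) :
  (0 < gamma)%N -> principal_root gamma z ^+ gamma = z.
Proof.
move=> g0; have gR : gamma%:R != 0 :> R by rewrite pnatr_eq0 -lt0n.
have cisX (a : R) k : (cos a +i* sin a) ^+ k = cos (k%:R * a) +i* sin (k%:R * a).
  elim: k => [|k IH]; first by rewrite mul0r cos0 sin0.
  rewrite exprS IH -natr1 mulrDl mul1r cosD sinD.
  by apply/eqP; rewrite eq_complex /=; apply/andP; split; apply/eqP; ring.
have r0 : 0 <= normc z by case: (z) => a b; exact: sqrtr_ge0.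
rewrite /principal_root exprMn cisX mulrCA divff// mulr1 -rmorphXn /=.
by rewrite -powR_mulrn ?powR_ge0// -powRrM mulVf// powRr1// -carg_polar.
Qed.

Lemma principal_root_pos (R : realType) (gamma : nat) (x : R) :
  0 < x -> principal_root gamma x%:C = (x `^ gamma%:R^-1)%:C.
Proof.
move=> x0; rewrite /principal_root /carg /= expr0n addr0 sqrtr_sqr gtr0_norm//.
by rewrite lexx divff ?gt_eqF// acos1 mul0r cos0 sin0 mulr1.
Qed.

Definition Bpoly (R : realType) (n gamma : nat) : {poly R[i]} :=
  \sum_(0 <= k < n.+1) ('C(n, k) ^ gamma)%:R *: 'X^k.

Definition narayana (R : realType) (n k : nat) : R[i] :=
  k.+1%:R^-1 * 'C(n, k)%:R * 'C(n.-1, k)%:R.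

Definition narayana_poly (R : realType) (n : nat) : {poly R[i]} :=
  \sum_(1 <= k < n.+1) narayana R n k.-1 *: 'X^k.

Definition density_B (R : realType) (gamma : nat) (x : R) : R :=
  sin (pi / gamma%:R) /
  (pi * `|x| * (`|x| `^ (- gamma%:R^-1) + 2 * cos (pi / gamma%:R)
                + `|x| `^ gamma%:R^-1)).

(* Main.v *)
Require Import Defs.
From HB Require Import structures.
From mathcomp Require Import all_boot all_order all_algebra complex.
From mathcomp Require Import all_classical all_reals all_analysis.
From mathcomp Require Import measurable_realfun ring lra zify.

(** The zeros of both families are real and nonpositive, so that the weak limit
    of their distributions is decided by the Stieltjes means, the averages of
    [t / (t - z)] over the zeros [z], for positive [t].

    Real zeros. If [f] and [g] have only real zeros, then so has f(D) g, where D
    is the differentiation ([real_rooted_hermite_poulain], due to Hermite and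
    Poulain): the operator splits into factors D - r, and off the real axis the
    logarithmic derivative of a polynomial with real zeros is not real. Two
    applications of f |-> f(D) x^n multiply the coefficient of x^k by
    n! binomial(n, k) ([real_rooted_binomial]). Started from powers of 1 + x,
    this produces the first family, and from x (1 + x)^n the second.

    Stieltjes means. For a polynomial q of degree n, t q'(t) / (n q(t)) is both a
    Stieltjes mean of the zeros and the mean of k / n under the weights q_k t^k.
    At k = x n the ratio of consecutive weights is close to t ((1 - x) / x)^gamma,
    which is 1 at x = w / (1 + w) with w = t^(1/gamma); a discrete integration by
    parts shows that the weights concentrate there ([recurrence_concentration]).
    The second family follows the same recurrence with gamma = 2 up to errors of
    order 1 / n. Hence the means converge to w / (1 + w).

    Weak convergence. Difference quotients in t lead from [(t + x)^-1] to its
    powers, and Bernstein polynomials from the powers of [(1 + x)^-1] to all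
    continuous functions of it, that is to all continuous functions on the closed
    negative half-line together with the point at infinity
    ([weak_cvg_stieltjes]).

    The limit. In the variable v = |x|^(1/gamma) the density is a rational
    function with two poles, and the Cauchy kernel brings the gamma-th roots of
    - t as further poles. The primitive given by partial fractions is a
    combination of logarithms whose value at v = 0 telescopes
    ([partial_fractions], [cauchy_primitive0]); it vanishes at infinity. This
    gives the Cauchy transform; at positive t, t times it is the limit w / (1 + w)
    found above, which identifies the weak limit.

    The potential. The Cauchy transform at t / u^gamma, whose root is w / u, shows
    that the u-derivative of ln |t - u^gamma x| integrates to Re (gamma / (u + w)).
    Integration over u from 0 to 1 and Fubini's theorem give the increment of
    gamma ln |u + w|, and ln |t| = gamma ln |w| ([log_potential]). *)

Set Implicit Arguments.
Unset Strict Implicit.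
Unset Printing Implicit Defensive.

Import Order.TTheory GRing.Theory Num.Theory.
Import numFieldNormedType.Exports.
Import ComplexField.Normc.

Local Open Scope classical_set_scope.
Local Open Scope complex_scope.
Local Open Scope ring_scope.

(** * Polynomials with only real zeros *)

Lemma prod_XsubC_logderiv (F : fieldType) (s : seq F) (z : F) : z \notin s ->
  (\prod_(x <- s) ('X - x%:P))^`().[z] =
  (\prod_(x <- s) ('X - x%:P)).[z] * \sum_(x <- s) (z - x)^-1.
Proof.
elim: s => [|x s IH]; first by rewrite !big_nil derivC horner0 mulr0.
rewrite inE negb_or => /andP[zx zs].
rewrite !big_cons derivM derivXsubC mul1r hornerD !hornerM IH// hornerXsubC.
by rewrite mulrDr [X in _ = X + _]mulrAC divff ?mul1r ?subr_eq0// mulrA.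
Qed.

Section real_rooted.
Variable R : realType.
Implicit Types (p f g : {poly R[i]}) (z : R[i]).

(** The zero polynomial is admitted so that differentiation never has to
    distinguish constants. *)
Definition real_rooted p := forall z, root p z -> p = 0 \/ complex.Im z = 0.

Lemma ImV z :
  complex.Im z^-1 = - complex.Im z * (complex.Re z ^+ 2 + complex.Im z ^+ 2)^-1.
Proof. by case: z => a b; rewrite /= mulNr. Qed.

Lemma Im_sum_inv_subr z (s : seq R[i]) :
  (forall x, x \in s -> complex.Im x = 0) ->
  complex.Im (\sum_(x <- s) (z - x)^-1) =
  - complex.Im z * \sum_(x <- s) (complex.Re (z - x) ^+ 2 + complex.Im z ^+ 2)^-1.
Proof.
move=> s0; rewrite raddf_sum/= mulr_sumr; apply: eq_big_seq => x xs.
have Im_zx : complex.Im (z - x) = complex.Im z.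
  by have := s0 x xs; case: (z) (x) => a b [c d] /= ->; rewrite subr0.
by rewrite ImV Im_zx.
Qed.

(** Off the real axis the logarithmic derivative of a product of real linear
    factors has nonzero imaginary part, so it cannot take the real value [r]. *)
Lemma real_rooted_derivB p (r : R) :
  real_rooted p -> real_rooted (p^`() - r%:C *: p).
Proof.
move=> rp z; have [->|p0] := eqVneq p 0.
  by rewrite deriv0 scaler0 subrr; left.
have [z0|z0] := eqVneq (complex.Im z) 0; first by right.
have pz : ~~ root p z.
  by apply/negP => /rp[]; [exact/eqP|exact/eqP].
have [s] := closed_field_poly_normal p.
have : lead_coef p != 0 by rewrite lead_coef_eq0.
move: (lead_coef p) => c c0 ps.
have srt x : (x \in s) = root p x by rewrite ps rootZ// root_prod_XsubC.
have zs : z \notin s by rewrite srt.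
have sI x : x \in s -> complex.Im x = 0.
  by rewrite srt => /rp[] // /eqP; rewrite (negbTE p0).
rewrite rootE hornerD hornerN hornerZ subr_eq0 => /eqP.
have -> : p^`().[z] = (\sum_(x <- s) (z - x)^-1) * p.[z].
  by rewrite ps derivZ !hornerZ prod_XsubC_logderiv// mulrA mulrC.
move=> /(mulIf pz) /[dup] /(congr1 (@complex.Im R)).
rewrite Im_sum_inv_subr//= => /eqP.
rewrite mulf_eq0 oppr_eq0 (negbTE z0)/=.
case: s ps {srt zs sI} => [|x s] ps.
  by move=> _; rewrite big_nil => <-; left; rewrite ps big_nil derivZ derivC scaler0 scale0r subrr.
rewrite big_cons paddr_eq0; last 2 first.
- by rewrite invr_ge0 addr_ge0 ?sqr_ge0.
- by apply: sumr_ge0 => y _; rewrite invr_ge0 addr_ge0 ?sqr_ge0.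
by rewrite invr_eq0 paddr_eq0 ?sqr_ge0// !sqrf_eq0 (negbTE z0) andbF.
Qed.

Lemma real_rootedZ (c : R[i]) p : c != 0 -> real_rooted p -> real_rooted (c *: p).
Proof.
by move=> c0 rp z; rewrite rootZ// => /rp[->|]; [rewrite scaler0; left|right].
Qed.

Lemma real_rooted_scale c p : c != 0 -> real_rooted (c *: p) -> real_rooted p.
Proof.
move=> c0 rp; rewrite -[p](scalerK c0).
by apply: real_rootedZ => //; rewrite invr_eq0.
Qed.

(** [hermite_poulain f g] is f(D) g, with D the differentiation. *)
Definition hermite_poulain f g := \sum_(i < size f) f`_i *: g^`(i).

Lemma hermite_poulain_widen m f g : (size f <= m)%N ->
  hermite_poulain f g = \sum_(i < m) f`_i *: g^`(i).
Proof.
move=> fm; rewrite /hermite_poulain (big_ord_widen _ (fun i => f`_i *: g^`(i)) fm) big_mkcond/=.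
apply: eq_bigr => i _; case: ltnP => // /(nth_default 0) ->.
by rewrite scale0r.
Qed.

Lemma hermite_poulainZ c f g : hermite_poulain (c *: f) g = c *: hermite_poulain f g.
Proof.
rewrite (hermite_poulain_widen _ (size_scale_leq c f)) scaler_sumr.
by apply: eq_bigr => i _; rewrite coefZ scalerA.
Qed.

Lemma hermite_poulain_mulXsubC x f g :
  hermite_poulain (('X - x%:P) * f) g =
  (hermite_poulain f g)^`() - x *: hermite_poulain f g.
Proof.
have sz : (size (('X - x%:P) * f)%R <= (size f).+1)%N.
  by rewrite (leq_trans (size_polyMleq _ _))// size_XsubC.
rewrite (hermite_poulain_widen _ sz).
under eq_bigr do rewrite mulrBl coefB coefXM coefCM scalerBl.
rewrite sumrB; congr (_ - _).
  rewrite big_ord_recl/= scale0r add0r raddf_sum/=.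
  by apply: eq_bigr => i _; rewrite derivZ.
rewrite (hermite_poulain_widen _ (leqnSn _)) scaler_sumr.
by apply: eq_bigr => i _; rewrite scalerA.
Qed.

(** f(D) factors into the operators [D - x], [x] running over the real zeros
    of [f]. *)
Lemma real_rooted_hermite_poulain f g :
  real_rooted f -> real_rooted g -> real_rooted (hermite_poulain f g).
Proof.
move=> rf rg; have [->|f0] := eqVneq f 0.
  by rewrite /hermite_poulain size_poly0 big_ord0 => z; left.
have [s] := closed_field_poly_normal f.
have : lead_coef f != 0 by rewrite lead_coef_eq0.
move: (lead_coef f) => c c0 fE.
have {rf} : forall x, x \in s -> complex.Im x = 0.
  move=> x xs; have [|/eqP|//] := rf x; last by rewrite (negbTE f0).
  by rewrite fE rootZ// root_prod_XsubC.
rewrite fE hermite_poulainZ => {f f0 fE} sI; apply: real_rootedZ => //.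
elim: s sI => [|x s IH] sI.
  by rewrite big_nil /hermite_poulain size_poly1 big_ord1 coef1 scale1r.
rewrite big_cons hermite_poulain_mulXsubC.
have -> : x = (complex.Re x)%:C.
  by have := sI x (mem_head _ _); case: (x) => a b /= ->.
by apply: real_rooted_derivB; apply: IH => y ys; apply: sI; rewrite inE ys orbT.
Qed.

Lemma coef_hermite_poulainXn f n j : (hermite_poulain f 'X^n)`_j =
  if (j <= n)%N then f`_(n - j) *+ n ^_ (n - j) else 0.
Proof.
rewrite (hermite_poulain_widen _ (leq_maxl (size f) n.+1)) coef_sum.
under eq_bigr do rewrite derivnXn coefZ coefMn coefXn.
case: leqP => jn; last first.
  by apply: big1 => i _; rewrite (_ : j == _ = false) ?mul0rn ?mulr0//; lia.
have nj : (n - j < maxn (size f) n.+1)%N by lia.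
rewrite (bigD1 (Ordinal nj))//= big1 ?addr0.
  by rewrite subKn// eqxx mulrnAr mulr1.
move=> i /eqP ij; have [ni|ni] := ltnP n i.
  by rewrite ffact_small// mulr0n mulr0.
rewrite (_ : j == _ = false) ?mul0rn ?mulr0//.
apply/eqP => jE; apply: ij; apply/val_inj => /=; lia.
Qed.

(** Two applications of f |-> f(D) x^n multiply the coefficient of x^k by
    n! binomial(n, k). *)
Lemma real_rooted_binomial n f : real_rooted f ->
  real_rooted (\sum_(0 <= k < n.+1) (f`_k *+ 'C(n, k)) *: 'X^k).
Proof.
move=> rf; have rX : real_rooted 'X^n.
  by move=> z; rewrite rootE hornerXn expf_eq0 => /andP[_ /eqP ->]; right.
have := real_rooted_hermite_poulain (real_rooted_hermite_poulain rf rX) rX.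
set q := hermite_poulain _ _; set p := \sum_(_ <= _ < _) _.
suff -> : q = n`!%:R *: p.
  by apply: real_rooted_scale; rewrite pnatr_eq0 -lt0n fact_gt0.
apply/polyP => k; rewrite coefZ coef_hermite_poulainXn.
have -> : p`_k = if (k <= n)%N then f`_k *+ 'C(n, k) else 0.
  rewrite /p big_mkord -(poly_def n.+1 (fun k => f`_k *+ 'C(n, k))).
  by rewrite coef_poly ltnS.
case: leqP => kn; last by rewrite mulr0.
rewrite coef_hermite_poulainXn leq_subr subKn// -mulrnA mulr_natl -mulrnA.
congr (_ *+ _).
have kn' : (n - k <= n)%N by rewrite leq_subr.
have := ffact_fact kn; have := ffact_fact kn'; rewrite subKn// => h1 h2.
have := bin_fact kn => h3.
apply/eqP; rewrite -(@eqn_pmul2r (k`! * (n - k)`!)) ?muln_gt0 ?fact_gt0//.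
by apply/eqP; rewrite [RHS]mulnAC h3 [X in (_ * X = _)%N]mulnC mulnACA h2 h1.
Qed.

Lemma real_rooted_XsubC_exp (x : R) n : real_rooted (('X - x%:C%:P) ^+ n).
Proof.
move=> z; rewrite rootE horner_exp hornerXsubC expf_eq0 subr_eq0.
by move=> /andP[_ /eqP ->]; right.
Qed.

Lemma exp_XsubN1 n : ('X - (-1)%:C%:P) ^+ n =
  \sum_(0 <= k < n.+1) ('C(n, k))%:R *: 'X^k :> {poly R[i]}.
Proof.
have -> : 'X - (-1)%:C%:P = 1 + 'X :> {poly R[i]}.
  by rewrite rmorphN rmorph1 polyCN opprK addrC.
rewrite exprDn big_mkord; apply: eq_bigr => k _.
by rewrite expr1n mul1r scaler_nat.
Qed.

Lemma coef_sumXn (a : nat -> R[i]) n k :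
  (\sum_(0 <= j < n.+1) a j *: 'X^j)`_k = if (k <= n)%N then a k else 0.
Proof. by rewrite big_mkord -(poly_def n.+1 a) coef_poly ltnS. Qed.

Lemma real_rooted_Bpoly n gamma : (0 < gamma)%N -> real_rooted (Bpoly R n gamma).
Proof.
case: gamma => // g _; elim: g => [|g IH].
  have -> : Bpoly R n 1 = ('X - (-1)%:C%:P) ^+ n.
    by rewrite exp_XsubN1; apply: eq_bigr => k _; rewrite expn1.
  exact: real_rooted_XsubC_exp.
have := @real_rooted_binomial n _ IH; congr real_rooted; apply: eq_big_nat => k kn.
by rewrite coef_sumXn -ltnS (andP kn).2 -mulrnA -expnSr.
Qed.

Lemma narayanaE n k :
  narayana R n.+1 k = n.+1%:R^-1 * ('C(n.+1, k.+1) * 'C(n.+1, k))%:R.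
Proof.
rewrite /narayana /=.
have := mul_bin_diag n.+1 k => /(congr1 (fun m => m%:R : R[i])).
rewrite /= !natrM => h.
have n0 : n.+1%:R != 0 :> R[i] by rewrite pnatr_eq0.
have k0 : k.+1%:R != 0 :> R[i] by rewrite pnatr_eq0.
apply: (mulfI n0); apply: (mulfI k0); rewrite mulVKf// mulrCA -[k.+1%:R^-1 * _ * _]mulrA mulVKf//.
by rewrite mulrCA h mulrCA; congr (_ * _); rewrite mulrC.
Qed.

Lemma real_rooted_narayana n : real_rooted (narayana_poly R n).
Proof.
case: n => [|n]; first by rewrite /narayana_poly big_geq// => z; left.
have rf : real_rooted ('X * ('X - (-1)%:C%:P) ^+ n.+1).
  move=> z; rewrite rootM => /orP[|/real_rooted_XsubC_exp//].
    by rewrite rootE hornerX => /eqP ->; right.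
  by case; [move=> ->; rewrite mulr0; left|right].
have := @real_rooted_binomial n.+1 _ rf.
have n0 : n.+1%:R^-1 != 0 :> R[i] by rewrite invr_eq0 pnatr_eq0.
move=> /(real_rootedZ n0); congr real_rooted.
rewrite big_nat_recl//= coefXM/= mul0rn scale0r add0r scaler_sumr.
rewrite /narayana_poly big_add1/=; apply: eq_big_nat => k kn.
rewrite coefXM/= exp_XsubN1 coef_sumXn ltnW// scalerA; congr (_ *: _).
by rewrite narayanaE natrM mulr_natl.
Qed.
End real_rooted.

(** * The zeros of a polynomial with nonnegative coefficients *)

Section nonneg_coefficients.
Variable R : realType.
Implicit Types (q : {poly R}) (P : {poly R[i]}).

Lemma horner_gt0 q x : (forall k, 0 <= q`_k) -> q != 0 -> 0 < x -> 0 < q.[x].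
Proof.
move=> q0 qN0 x0; rewrite horner_coef.
have sq : (0 < size q)%N by rewrite lt0n size_poly_eq0.
have l : ((size q).-1 < size q)%N by rewrite prednK.
rewrite (bigD1 (Ordinal l))//= ltr_pwDl//.
  by rewrite mulr_gt0 ?exprn_gt0// lt0r -lead_coefE lead_coef_eq0 qN0/= lead_coefE.
by apply: sumr_ge0 => i _; rewrite mulr_ge0// exprn_ge0// ltW.
Qed.

Lemma real_rooted_zeros q : (forall k, 0 <= q`_k) -> q != 0 ->
  real_rooted (map_poly (real_complex R) q) ->
  exists2 s : seq R, zeros (map_poly (real_complex R) q) = [seq (- x)%:C | x <- s] &
    (forall x, x \in s -> 0 <= x) /\
    forall t, 0 < t -> q^`().[t] = q.[t] * \sum_(x <- s) (t + x)^-1.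
Proof.
set P := map_poly _ q => q0 qN0 rP.
have P0 : P != 0 by rewrite map_poly_eq0.
have zr z : (z \in zeros P) = root P z.
  rewrite [P in RHS]zerosE rootZ ?lead_coef_eq0//.
  by rewrite root_prod_XsubC.
have zI z : z \in zeros P -> z = (complex.Re z)%:C.
  rewrite zr => /rP[/eqP|]; first by rewrite (negbTE P0).
  by case: z => a b /= ->.
exists [seq - complex.Re z | z <- zeros P].
  rewrite -map_comp; rewrite -[LHS]map_id; apply/eq_in_map => z /zI zE /=.
  by rewrite opprK.
split.
  move=> x /mapP[z zP ->]; rewrite oppr_ge0 leNgt; apply/negP => z0.
  have := horner_gt0 q0 qN0 z0; rewrite lt0r => /andP[+ _].
  move: zP (zI _ zP); rewrite zr rootE => /[swap] zE; rewrite zE.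
  by rewrite horner_map/= fmorph_eq0 => /eqP ->; rewrite eqxx.
move=> t t0.
have tz : t%:C \notin zeros P.
  by rewrite zr rootE horner_map/= fmorph_eq0 gt_eqF// horner_gt0.
have := prod_XsubC_logderiv tz.
move=> /(congr1 (fun y => lead_coef P * y)).
rewrite mulrA -!hornerZ -derivZ -zerosE /P deriv_map !horner_map/= big_map.
have -> : \sum_(x <- zeros P) (t%:C - x)^-1 =
    (\sum_(x <- zeros P) (t + - complex.Re x)^-1)%:C.
  rewrite rmorph_sum/=; apply: eq_big_seq => z /zI ->.
  by rewrite fmorphV/= rmorphB.
by rewrite -rmorphM/= => /complexI.
Qed.

End nonneg_coefficients.

(** * Concentration of the exponent *)

Section concentration.
Variable R : realType.

Lemma weighted_cauchy_schwarz (I : finType) (W y : I -> R) :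
  (forall i, 0 <= W i) ->
  (\sum_i W i * y i) ^+ 2 <= (\sum_i W i) * \sum_i W i * y i ^+ 2.
Proof.
move=> W0; set S := \sum_i W i; set M := \sum_i W i * y i.
have S0 : 0 <= S by apply: sumr_ge0.
have [S00|S00] := eqVneq S 0.
  suff -> : M = 0 by rewrite expr0n mulr_ge0// sumr_ge0// => i _; rewrite mulr_ge0 ?sqr_ge0.
  apply: big1 => i _; have /eqP : S == 0 by rewrite S00.
  by move=> /eqP; rewrite psumr_eq0// => /allP /(_ i (mem_index_enum _)) /eqP ->; rewrite mul0r.
have Sp : 0 < S by rewrite lt0r S00.
have : 0 <= S * \sum_i W i * (S * y i - M) ^+ 2.
  by rewrite mulr_ge0// sumr_ge0// => i _; rewrite mulr_ge0 ?sqr_ge0.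
suff -> : \sum_i W i * (S * y i - M) ^+ 2 =
    S * (S * (\sum_i W i * y i ^+ 2) - M ^+ 2).
  by rewrite pmulr_rge0// pmulr_rge0// subr_ge0.
have -> : \sum_i W i * (S * y i - M) ^+ 2 = \sum_i (S ^+ 2 * (W i * y i ^+ 2)
   - (2 * S * M) * (W i * y i) + M ^+ 2 * W i).
  by apply: eq_bigr => i _; ring.
rewrite big_split/= sumrB -!mulr_sumr -/S -/M; ring.
Qed.

(** By the choice of [a] the first factor on the right vanishes at [x = a]; it
    contains [x - a], with a cofactor of at least [a ^+ g]. *)
Lemma expr_diff_monotone (x a t : R) g : 0 <= x <= 1 -> 0 <= a <= 1 -> 0 <= t ->
  a ^+ g.+1 = t * (1 - a) ^+ g.+1 ->
  a ^+ g * (x - a) ^+ 2 <= (x ^+ g.+1 - t * (1 - x) ^+ g.+1) * (x - a).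
Proof.
move=> /andP[x0 x1] /andP[a0 a1] t0 aE.
have -> : x ^+ g.+1 - t * (1 - x) ^+ g.+1 =
    (x ^+ g.+1 - a ^+ g.+1) + t * ((1 - a) ^+ g.+1 - (1 - x) ^+ g.+1).
  by rewrite mulrBr -aE; ring.
rewrite !subrXX.
set A := \sum_(i < g.+1) _; set B := \sum_(i < g.+1) _.
have -> : 1 - a - (1 - x) = x - a by ring.
have -> : ((x - a) * A + t * ((x - a) * B)) * (x - a) =
  (A + t * B) * (x - a) ^+ 2 by ring.
apply: ler_wpM2r; first exact: sqr_ge0.
have AE : a ^+ g <= A.
  rewrite /A big_ord_recr/= subnn expr0 mul1r lerDr sumr_ge0// => i _.
  by rewrite mulr_ge0// exprn_ge0.
by rewrite (le_trans AE)// lerDl mulr_ge0// sumr_ge0// => i _;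
  rewrite mulr_ge0// exprn_ge0// subr_ge0.
Qed.

(** Summation by parts against the recurrence turns the drift
    [x ^+ g.+1 - t * (1 - x) ^+ g.+1], which vanishes at [a] and is monotone,
    into an error of order [1 / n]; this bounds the variance of [k / n] around
    [a] under the weights [W]. *)
Lemma recurrence_concentration (n g : nat) (t a C : R) (W P Q : nat -> R) :
  (0 < n)%N -> 0 < t -> 0 < a <= 1 -> a ^+ g.+1 = t * (1 - a) ^+ g.+1 ->
  (forall k, 0 <= W k) ->
  W 0%N * P 0%N = 0 -> W n * Q n = 0 ->
  (forall k, (k < n)%N -> W k.+1 * P k.+1 = t * (W k * Q k)) ->
  (forall k, (k <= n)%N -> `|P k - (k%:R / n%:R) ^+ g.+1| <= C / n%:R) ->
  (forall k, (k <= n)%N -> `|Q k - (1 - k%:R / n%:R) ^+ g.+1| <= C / n%:R) ->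
  (forall k, (k <= n)%N -> Q k <= C) ->
  (\sum_(k < n.+1) W k * (k%:R / n%:R - a)) ^+ 2 <=
  (\sum_(k < n.+1) W k) ^+ 2 * ((C * (1 + t + t) / a ^+ g) / n%:R).
Proof.
move=> n0 t0 /andP[a0 a1] aE W0 WP WQ rec hP hQ hC.
have nr : 0 < n%:R :> R by rewrite ltr0n.
set S := \sum_(k < n.+1) W k.
have S0 : 0 <= S by apply: sumr_ge0.
have ag : 0 < a ^+ g by rewrite exprn_gt0.
apply: (le_trans (weighted_cauchy_schwarz (fun k : 'I_n.+1 => k%:R / n%:R - a) _)) => //.
rewrite -/S expr2 -mulrA; apply: ler_wpM2l => //.
set V := \sum_(k < n.+1) _.
suff : a ^+ g * V <= S * (C * (1 + t + t) / n%:R).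
  rewrite mulrC -ler_pdivlMr// => /le_trans; apply.
  rewrite le_eqVlt; apply/orP; left; apply/eqP; rewrite -!mulrA.
  by congr (_ * (_ * (_ * _))); rewrite mulrC.
have parts : \sum_(k < n.+1) W k * ((P k - t * Q k) * (k%:R / n%:R - a)) =
    t / n%:R * \sum_(k < n.+1) W k * Q k.
  have -> : \sum_(k < n.+1) W k * ((P k - t * Q k) * (k%:R / n%:R - a)) =
     \sum_(k < n.+1) W k * P k * (k%:R / n%:R - a)
      - \sum_(k < n.+1) t * (W k * Q k) * (k%:R / n%:R - a).
    by rewrite -sumrB; apply: eq_bigr => k _; ring.
  rewrite big_ord_recl/= WP mul0r add0r.
  rewrite (eq_bigr (fun k : 'I_n => t * (W k * Q k) * (k.+1%:R / n%:R - a))); last first.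
    by move=> k _; rewrite /bump/= add1n rec.
  rewrite !big_ord_recr/= WQ mulr0 mul0r !addr0 -sumrB mulr_sumr.
  by apply: eq_bigr => k _; rewrite -natr1; field; rewrite gt_eqF.
apply: (@le_trans _ _ (\sum_(k < n.+1) (W k * ((P k - t * Q k) * (k%:R / n%:R - a))
    + W k * (C * (1 + t) / n%:R)))).
  rewrite /V mulr_sumr; apply: ler_sum => k _.
  rewrite mulrCA -mulrDr; apply: ler_wpM2l => //.
  have kn : (k <= n)%N by rewrite -ltnS.
  have x01 : 0 <= (k%:R / n%:R : R) <= 1.
    by rewrite divr_ge0//= ler_pdivrMr// mul1r ler_nat.
  have a01 : 0 <= a <= 1 by rewrite ltW.
  apply: (le_trans (expr_diff_monotone x01 a01 (ltW t0) aE)).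
  move: (hP _ kn) (hQ _ kn); set x := k%:R / n%:R in x01 *.
  set D := C / n%:R => hp hq.
  have -> : C * (1 + t) / n%:R = D * (1 + t) by rewrite /D; ring.
  have xa : `|x - a| <= 1.
    by rewrite ler_norml; move/andP: x01 => [? ?]; apply/andP; split; lra.
  rewrite -lerBlDl -mulrBl.
  have -> : x ^+ g.+1 - t * (1 - x) ^+ g.+1 - (P k - t * Q k) =
    - (P k - x ^+ g.+1) + t * (Q k - (1 - x) ^+ g.+1) by ring.
  apply: (le_trans (ler_norm _)); rewrite normrM.
  have D0 : 0 <= D by apply: le_trans hp.
  rewrite -[leRHS]mulr1; apply: ler_pM => //.
  apply: (le_trans (ler_normD _ _)); rewrite normrN normrM (gtr0_norm t0).
  by rewrite mulrDr mulr1 lerD// mulrC ler_wpM2r// ltW.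
rewrite big_split/= parts -mulr_suml -/S.
have -> : S * (C * (1 + t + t) / n%:R) = t / n%:R * (S * C) + S * (C * (1 + t) / n%:R).
  by ring.
rewrite lerD2r; apply: ler_wpM2l; first by rewrite divr_ge0// ltW.
by rewrite mulr_suml; apply: ler_sum => k _; apply: ler_wpM2l => //; apply: hC; rewrite -ltnS.
Qed.

Lemma cvg_sqr_bound (u : nat -> R) (l K : R) : 0 <= K ->
  (forall n, (0 < n)%N -> (u n - l) ^+ 2 <= K / n%:R) -> u @ \oo --> l.
Proof.
move=> K0 uK; apply/cvgrPdist_le => e e0.
near=> n; rewrite distrC -ler_sqr ?nnegrE ?(ltW e0)// real_normK ?num_real//.
have n0 : (0 < n)%N by near: n; exact: nbhs_infty_gt.
apply: (le_trans (uK _ n0)); rewrite ler_pdivrMr ?ltr0n// mulrC -ler_pdivrMr ?exprn_gt0//.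
by near: n; exact: nbhs_infty_ger.
Unshelve. all: by end_near. Qed.

Definition mean (n : nat) (s : seq R) (h : R -> R) : R := (\sum_(x <- s) h x) / n%:R.

(** [t * q' / q] is at once the sum of [t / (t + x)] over the zeros [- x] and the
    mean of [k] under the weights [q`_k * t ^+ k]. *)
Lemma mean_stieltjes (n : nat) (q : {poly R}) (s : seq R) (t a K : R) : (0 < n)%N ->
  0 < t -> (size q <= n.+1)%N -> (forall k, 0 <= q`_k) -> q != 0 ->
  q^`().[t] = q.[t] * \sum_(x <- s) (t + x)^-1 ->
  (\sum_(k < n.+1) q`_k * t ^+ k * (k%:R / n%:R - a)) ^+ 2 <=
    (\sum_(k < n.+1) q`_k * t ^+ k) ^+ 2 * (K / n%:R) ->
  (mean n s (fun x => t / (t + x)) - a) ^+ 2 <= K / n%:R.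
Proof.
move=> n0 t0 sq q0 qN0 qs.
have nr : n%:R != 0 :> R by rewrite pnatr_eq0 -lt0n.
have qt := horner_gt0 q0 qN0 t0.
have <- : q.[t] = \sum_(k < n.+1) q`_k * t ^+ k by rewrite (horner_coef_wide _ sq).
suff -> : \sum_(k < n.+1) q`_k * t ^+ k * (k%:R / n%:R - a) =
    q.[t] * (mean n s (fun x => t / (t + x)) - a).
  by rewrite exprMn ler_pM2l// exprn_gt0.
under eq_bigr do rewrite mulrBr.
rewrite sumrB -mulr_suml -(horner_coef_wide _ sq) mulrBr; congr (_ - _).
rewrite /mean -mulr_sumr mulrA mulrA [_ * t]mulrC -[in RHS](mulrA t) -qs.
have sq' : (size q^`() <= n)%N.
  by rewrite (leq_trans (size_poly _ _))//; case: (size q) sq.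
rewrite (horner_coef_wide _ sq') big_ord_recl/= !mul0r mulr0 add0r.
rewrite mulr_sumr mulr_suml; apply: eq_bigr => k _.
by rewrite coef_deriv /bump/= add1n -mulr_natr exprS; ring.
Qed.

(** Up to the factor [t], the means are Cauchy transforms of the zero
    distributions; their limits at positive [t] determine the weak limit. *)
Definition stieltjes_cvg (P : nat -> {poly R[i]}) (F : R -> R) : Prop :=
  exists s : nat -> seq R,
    (forall n, (0 < n)%N -> [/\ zeros (P n) = [seq (- x)%:C | x <- s n],
       (size (P n)).-1 = n & forall x, x \in s n -> 0 <= x]) /\
    forall t, 0 < t -> mean n (s n) (fun x => t / (t + x)) @[n --> \oo] --> F t.

Lemma powR_inv_exp (g : nat) (t : R) : 0 <= t -> (t `^ g.+1%:R^-1) ^+ g.+1 = t.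
Proof.
by move=> t0; rewrite -powR_mulrn ?powR_ge0// -powRrM mulVf ?pnatr_eq0// powRr1.
Qed.

(** Coefficients whose consecutive ratios are [((1 - x) / x) ^+ g.+1] at
    [x = k / n], up to [O(1 / n)]: the weights [c n k * t ^+ k] then concentrate
    where this ratio is [1 / t], that is at [x = w / (1 + w)] with [w ^+ g.+1 = t]. *)
Lemma stieltjes_cvg_recurrence (g : nat) (C : R) (c : nat -> nat -> R)
    (P Q : nat -> nat -> R) :
  0 <= C ->
  (forall n, (0 < n)%N ->
    [/\ (forall k, 0 <= c n k), c n n != 0,
        c n 0%N * P n 0%N = 0 & c n n * Q n n = 0]) ->
  (forall n k, (0 < n)%N -> (k < n)%N -> c n k.+1 * P n k.+1 = c n k * Q n k) ->
  (forall n k, (0 < n)%N -> (k <= n)%N ->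
    [/\ `|P n k - (k%:R / n%:R) ^+ g.+1| <= C / n%:R,
        `|Q n k - (1 - k%:R / n%:R) ^+ g.+1| <= C / n%:R & Q n k <= C]) ->
  (forall n, real_rooted (\poly_(k < n.+1) (c n k)%:C)) ->
  stieltjes_cvg (fun n => \poly_(k < n.+1) (c n k)%:C)
    (fun t => t `^ g.+1%:R^-1 / (1 + t `^ g.+1%:R^-1)).
Proof.
move=> C0 hc rec err rr.
pose q n := \poly_(k < n.+1) (c n k).
have qE n : \poly_(k < n.+1) (c n k)%:C = map_poly (real_complex R) (q n).
  apply/polyP => k; rewrite coef_map/= !coef_poly.
  by case: ifP => // _; rewrite rmorph0.
have q0 n k : (0 < n)%N -> 0 <= (q n)`_k.
  by move=> n0; rewrite coef_poly; case: ifP => // _; have [] := hc n n0.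
have qN0 n : (0 < n)%N -> q n != 0.
  move=> n0; have [_ + _ _] := hc n n0; apply: contra => /eqP/polyP/(_ n).
  by rewrite coef_poly ltnSn coef0 => ->.
have ex n : exists s : seq R, (0 < n)%N ->
    [/\ zeros (map_poly (real_complex R) (q n)) = [seq (- x)%:C | x <- s],
       (forall x, x \in s -> 0 <= x) &
       forall t, 0 < t -> (q n)^`().[t] = (q n).[t] * \sum_(x <- s) (t + x)^-1].
  have [->|n0] := posnP n; first by exists [::].
  have rq : real_rooted (map_poly (real_complex R) (q n)) by rewrite -qE.
  have [s s1 [s2 s3]] := real_rooted_zeros (fun k => q0 n k n0) (qN0 n n0) rq.
  by exists s.
have [s hs] := choice ex; exists s; split.
  move=> n n0; have [h1 h2 h3] := hs n n0; split => //; first by rewrite qE.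
  by rewrite size_poly_eq//; have [_ + _ _] := hc n n0; rewrite /= fmorph_eq0.
move=> t t0; set w := _ `^ _; set a := w / (1 + w).
have w0 : 0 < w by rewrite powR_gt0.
have wt : w ^+ g.+1 = t by rewrite powR_inv_exp// ltW.
have w1 : 0 < 1 + w by lra.
have a01 : 0 < a <= 1.
  by rewrite divr_gt0//= ler_pdivrMr// mul1r lerDr.
have aE : a ^+ g.+1 = t * (1 - a) ^+ g.+1.
  have -> : 1 - a = (1 + w)^-1 by rewrite /a; field; rewrite gt_eqF.
  by rewrite /a exprMn wt.
apply: (@cvg_sqr_bound _ _ (C * (1 + t + t) / a ^+ g)).
  by rewrite divr_ge0 ?mulr_ge0//; [lra|rewrite exprn_ge0// ltW//; case/andP: a01].
move=> n n0; have [h1 h2 h3] := hs n n0; have [hc1 hc2 hc3 hc4] := hc n n0.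
apply: (mean_stieltjes n0 t0 (size_poly _ _) (fun k => q0 n k n0) (qN0 n n0) (h3 t t0)).
rewrite -/(q n).
have eW k : (k <= n)%N -> (q n)`_k = c n k by move=> kn; rewrite coef_poly ltnS kn.
apply: (@recurrence_concentration n g t a C (fun k => (q n)`_k * t ^+ k) (P n) (Q n)) => //.
- by move=> k; rewrite mulr_ge0 ?q0// exprn_ge0// ltW.
- by rewrite eW// mulrAC hc3 mul0r.
- by rewrite eW// mulrAC hc4 mul0r.
- move=> k kn; rewrite !eW//; last exact: ltnW.
  by rewrite mulrAC rec// exprS; ring.
- by move=> k kn; have [] := err n k n0 kn.
- by move=> k kn; have [] := err n k n0 kn.
- by move=> k kn; have [] := err n k n0 kn.
Qed.

Lemma stieltjes_cvg_Bpoly (g : nat) :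
  stieltjes_cvg (fun n => Bpoly R n g.+1)
    (fun t => t `^ g.+1%:R^-1 / (1 + t `^ g.+1%:R^-1)).
Proof.
have E n : Bpoly R n g.+1 = \poly_(k < n.+1) (('C(n, k) ^ g.+1)%:R : R)%:C.
  rewrite /Bpoly big_mkord poly_def; apply: eq_bigr => k _.
  by rewrite rmorph_nat.
rewrite (_ : (fun n => _) = (fun n => \poly_(k < n.+1) (('C(n, k) ^ g.+1)%:R : R)%:C));
  last exact/funext.
apply: (@stieltjes_cvg_recurrence g 1 _ (fun n k => (k%:R / n%:R) ^+ g.+1)
  (fun n k => (1 - k%:R / n%:R) ^+ g.+1)) => //.
- move=> n n0; split=> //.
  + by rewrite binn exp1n oner_eq0.
  + by rewrite mul0r expr0n/= mulr0.
  + by rewrite divff ?pnatr_eq0 -?lt0n// subrr expr0n/= mulr0.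
- move=> n k n0 kn; rewrite !natrX -!exprMn; congr (_ ^+ _).
  have nr : n%:R != 0 :> R by rewrite pnatr_eq0 -lt0n.
  rewrite mulrA -natrM mulnC mul_bin_left natrM natrB ?(ltnW kn)//.
  by field.
- move=> n k n0 kn; rewrite !subrr normr0 divr_ge0//; split => //.
  have nr : 0 < n%:R :> R by rewrite ltr0n.
  have kn1 : k%:R / n%:R <= 1 :> R by rewrite ler_pdivrMr// mul1r ler_nat.
  have k0 : 0 <= k%:R / n%:R :> R by rewrite divr_ge0.
  by rewrite exprn_ile1//; lra.
- by move=> n; rewrite -E; exact: real_rooted_Bpoly.
Qed.

(** Consecutive coefficients have as ratio a product of two factors, each of
    which is [(1 - x) / x] at [x = k / n] up to [O(1 / n)]. *)
Lemma stieltjes_cvg_narayana :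
  stieltjes_cvg (narayana_poly R) (fun t => t `^ 2%:R^-1 / (1 + t `^ 2%:R^-1)).
Proof.
pose c (n k : nat) : R :=
  if k is j.+1 then n%:R^-1 * ('C(n, j.+1) * 'C(n, j))%:R else 0.
have E n : narayana_poly R n = \poly_(k < n.+1) (c n k)%:C.
  rewrite poly_def -(big_mkord predT (fun k => (c n k)%:C *: 'X^k)).
  rewrite big_nat_recl//= scale0r add0r /narayana_poly big_add1/=.
  apply: eq_big_nat => k kn; congr (_ *: _).
  case: n kn => // n _.
  by rewrite narayanaE (rmorphM (real_complex R)) (fmorphV (real_complex R)) !rmorph_nat.
rewrite (_ : narayana_poly R = (fun n => \poly_(k < n.+1) (c n k)%:C)); last exact/funext.
apply: (@stieltjes_cvg_recurrence 1 2 _ (fun n k => (k%:R * (k%:R - 1)) / n%:R ^+ 2)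
  (fun n k => ((n%:R - k%:R) * (n%:R - k%:R + 1)) / n%:R ^+ 2)) => //.
- move=> n n0; split => //.
  + by case=> [|k]//=; rewrite mulr_ge0// invr_ge0.
  + case: n n0 => // n _ /=; rewrite mulf_neq0 ?invr_eq0 ?pnatr_eq0//.
    by rewrite binn mul1n -lt0n bin_gt0.
  + by rewrite /= mul0r.
  + by rewrite subrr !mul0r mulr0.
- move=> n [|k] n0 kn.
    by rewrite subrr mulr0 mul0r mulr0 /= mul0r.
  have nr : n%:R != 0 :> R by rewrite pnatr_eq0 -lt0n.
  have e1 := mul_bin_left n k.+1; have e2 := mul_bin_left n k.
  move: e1 e2 => /(congr1 (fun m => m%:R : R)) + /(congr1 (fun m => m%:R : R)).
  rewrite /c !natrM !natrB ?(ltnW kn) ?(ltnW (ltnW kn))// => e1 e2.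
  have -> : n%:R^-1 * ('C(n, k.+2)%:R * 'C(n, k.+1)%:R) *
     (k.+2%:R * (k.+2%:R - 1) / n%:R ^+ 2) =
     n%:R^-1 / n%:R ^+ 2 * (k.+2%:R * 'C(n, k.+2)%:R) * (k.+1%:R * 'C(n, k.+1)%:R) :> R.
    by rewrite -(natr1 k.+1); field.
  by rewrite e1 {1}e2 -(natr1 k); field.
- move=> n k n0 kn.
  have nr : 0 < n%:R :> R by rewrite ltr0n.
  have nk : k%:R <= n%:R :> R by rewrite ler_nat.
  have k0 : 0 <= k%:R :> R by [].
  have n1 : 1 <= n%:R :> R by rewrite ler1n.
  split.
  + have -> : k%:R * (k%:R - 1) / n%:R ^+ 2 - (k%:R / n%:R) ^+ 2 = - (k%:R / n%:R ^+ 2) :> R.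
      by field; rewrite gt_eqF.
    rewrite normrN ger0_norm ?divr_ge0 ?exprn_ge0//.
    by rewrite expr2 invfM mulrA ler_pM2r ?invr_gt0// ler_pdivrMr//; nra.
  + have -> : (n%:R - k%:R) * (n%:R - k%:R + 1) / n%:R ^+ 2 - (1 - k%:R / n%:R) ^+ 2 =
       (n%:R - k%:R) / n%:R ^+ 2 :> R.
      by field; rewrite gt_eqF.
    rewrite ger0_norm ?divr_ge0 ?exprn_ge0 ?subr_ge0//.
    by rewrite expr2 invfM mulrA ler_pM2r ?invr_gt0// ler_pdivrMr//; nra.
  + by rewrite ler_pdivrMr ?exprn_gt0//; nra.
- by move=> n; rewrite -E; exact: real_rooted_narayana.
Qed.

End concentration.

(** * The logarithm along horizontal half-lines *)

Section logarithm.
Variable R : realType.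
Implicit Types (b z : R[i]) (v x y rho eta : R).

Definition cis (a : R) : R[i] := cos a +i* sin a.

Lemma cisD a c : cis (a + c) = cis a * cis c.
Proof.
rewrite /cis cosD sinD; apply/eqP; rewrite eq_complex /=; apply/andP.
by split; apply/eqP; ring.
Qed.

Lemma cis0 : cis 0 = 1.
Proof. by rewrite /cis cos0 sin0. Qed.

Lemma cisX a k : cis a ^+ k = cis (k%:R * a).
Proof.
elim: k => [|k IH]; first by rewrite mul0r cis0.
by rewrite exprS IH -cisD -natr1 mulrDl mul1r addrC.
Qed.

Lemma cis_neq0 a : cis a != 0.
Proof.
apply/eqP => /(congr1 (fun z => cis (- a) * z)).
by rewrite -cisD addNr cis0 mulr0; apply/eqP/oner_neq0.
Qed.

Lemma cisN a : cis (- a) = (cis a)^-1.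
Proof. by apply: (mulfI (cis_neq0 a)); rewrite -cisD subrr cis0 divff ?cis_neq0. Qed.

Lemma cispi : cis pi = -1.
Proof. by rewrite /cis cospi sinpi; apply/eqP; rewrite eq_complex/= oppr0 !eqxx. Qed.

Lemma cis2pi k : cis (k%:R * (pi *+ 2)) = 1.
Proof. by rewrite -cisX /cis cos2pi sin2pi expr1n. Qed.

(** The complement of the closed negative half-line, in the form that the
    half-angle formula for the argument needs. *)
Definition slit z := 0 < normc z + complex.Re z.

Lemma slitE x y : slit (x +i* y) = (y != 0) || (0 < x).
Proof.
rewrite /slit /=; have [->|y0] := eqVneq y 0; rewrite /=.
  rewrite expr0n addr0 sqrtr_sqr; have [x0|x0] := ltP 0 x.
    by rewrite gtr0_norm// addr_gt0.
  by rewrite ler0_norm// addNr ltxx.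
rewrite -ltrBlDr sub0r; apply: (le_lt_trans (ler_norm _)); rewrite normrN.
rewrite -sqrtr_sqr ltr_sqrt ?ltrDl; first by rewrite exprn_even_gt0.
by rewrite ltr_wpDl ?sqr_ge0// exprn_even_gt0.
Qed.

Lemma slit_planeP z : slit_plane z -> slit z.
Proof.
case: z => x y; rewrite slitE => zs.
have [y0|//] := eqVneq y 0; rewrite /= ltNge; apply/negP => x0.
by apply: zs; exists x; rewrite ?y0//= in_itv.
Qed.

Lemma slit_addl b v : slit b -> 0 <= v -> slit (v%:C + b).
Proof.
case: b => x y; rewrite slitE [_ + _]/= slitE add0r => /orP[->//|x0] v0.
by rewrite ltr_wpDl ?orbT.
Qed.

Lemma slit_neq0 b : slit b -> b != 0.
Proof. by apply: contraTneq => ->; rewrite /slit normc0 addr0 ltxx. Qed.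

Lemma slit_polar rho eta : 0 < rho -> - pi < eta < pi -> slit (rho%:C * cis eta).
Proof.
move=> r0 /andP[e1 e2].
have -> : rho%:C * cis eta = (rho * cos eta) +i* (rho * sin eta).
  by apply/eqP; rewrite eq_complex /= !mul0r subr0 addr0 !eqxx.
rewrite slitE mulf_eq0 gt_eqF//= pmulr_rgt0//.
have [->|ne] := eqVneq eta 0; first by rewrite cos0 ltr01 orbT.
suff -> : sin eta != 0 by [].
have [e0|e0] := ltP 0 eta; first by rewrite gt_eqF// sin_gt0_pi// e0.
rewrite -oppr_eq0 -sinN gt_eqF// sin_gt0_pi// oppr_gt0 ltrNl e1 andbT.
by rewrite lt_neqAle ne.
Qed.

(** A primitive of [v |-> (v + b)^-1], whose imaginary part is the argument of
    [v + b] by the half-angle formula. *)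
Definition clog b v : R[i] :=
  (ln ((v + complex.Re b) ^+ 2 + complex.Im b ^+ 2) / 2) +i*
  (2 * atan (complex.Im b / (normc (v%:C + b) + complex.Re (v%:C + b)))).

Definition is_cderive (f : R -> R[i]) v (d : R[i]) :=
  is_derive v 1 (fun u => complex.Re (f u)) (complex.Re d) /\
  is_derive v 1 (fun u => complex.Im (f u)) (complex.Im d).

Lemma is_cderive_clog b v : slit b -> 0 <= v -> is_cderive (clog b) v (v%:C + b)^-1.
Proof.
move=> sb v0; have := slit_addl sb v0; have := slit_neq0 (slit_addl sb v0).
case: b sb => x y sb; rewrite eq_complex /slit /= add0r => xy0.
set q := (v + x) ^+ 2 + y ^+ 2.
have q0 : 0 < q.
  rewrite lt0r addr_ge0 ?sqr_ge0// andbT paddr_eq0 ?sqr_ge0//.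
  by rewrite !sqrf_eq0.
set r := Num.sqrt q => rx0.
have r0 : 0 < r by rewrite sqrtr_gt0.
have rr : r ^+ 2 = (v + x) ^+ 2 + y ^+ 2 by rewrite sqr_sqrtr// ltW.
pose Q u := (u + x) ^+ 2 + y ^+ 2.
have dq : is_derive v 1 Q (2 * (v + x)).
  rewrite /Q; apply: is_derive_eq.
  by rewrite /GRing.scale/=; ring.
split => /=; rewrite /clog /=.
  have dl : is_derive v 1 (fun u => ln ((u + x) ^+ 2 + y ^+ 2)) (q^-1 * (2 * (v + x))).
    exact: (@is_derive1_comp _ (@ln R) Q v _ _ (is_derive1_ln q0) dq).
  apply: (@is_derive_eq _ _ _ _ _ _ _ _ (is_deriveM dl (is_derive_cst (2^-1 : R) v 1))).
  by rewrite /GRing.scale/= add0r -/q; field; rewrite gt_eqF.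
have ds : is_derive v 1 (fun u => Num.sqrt (Q u)) ((2 * r)^-1 * (2 * (v + x))).
  exact: (@is_derive1_comp _ (@Num.sqrt R) Q v _ _ (is_derive1_sqrt q0) dq).
pose D u := Num.sqrt (Q u) + (u + x).
have dD : is_derive v 1 D
    ((2 * r)^-1 * (2 * (v + x)) + 1).
  by rewrite /D; apply: is_derive_eq; rewrite /GRing.scale/=; ring.
have rx : r + (v + x) != 0 by rewrite gt_eqF.
have dV := @is_deriveV _ D v _ 1 rx dD.
have dY := is_deriveZ y dV.
have dA := @is_derive1_comp _ (@atan R) (y \*: (fun u => (D u)^-1)) v _ _ (is_derive1_atan _) dY.
have dA2 := is_deriveZ (2 : R) dA.
rewrite [X in is_derive _ _ X _](_ : _ = 2 \*: (@atan R \o y \*: (fun u : R => (D u)^-1))); last first.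
  by apply/funext => u; rewrite /= !add0r.
apply: (@is_derive_eq _ _ _ _ _ _ _ _ dA2) => /=.
rewrite /D /Q /GRing.scale/= !add0r -/q -/r -[q]sqr_sqrtr ?(ltW q0)// -/r.
have yE : y ^+ 2 = r ^+ 2 - (v + x) ^+ 2 by rewrite rr; ring.
have E : (r + (v + x)) ^+ 2 + y ^+ 2 = 2 * r * (r + (v + x)) by rewrite yE; ring.
have -> : 1 + (y / (r + (v + x))) ^+ 2 = 2 * r / (r + (v + x)).
  transitivity (((r + (v + x)) ^+ 2 + y ^+ 2) / (r + (v + x)) ^+ 2); first by field.
  by rewrite E; field.
by field; rewrite rx gt_eqF.
Qed.

Lemma clog0 rho eta : 0 < rho -> - pi < eta < pi ->
  clog (rho%:C * cis eta) 0 = ln rho +i* eta.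
Proof.
move=> r0 eb; have := slit_polar r0 eb.
have -> : rho%:C * cis eta = (rho * cos eta) +i* (rho * sin eta).
  by apply/eqP; rewrite eq_complex /= !mul0r subr0 addr0 !eqxx.
rewrite /slit /clog /= !add0r.
have -> : (rho * cos eta) ^+ 2 + (rho * sin eta) ^+ 2 = rho ^+ 2.
  by rewrite !exprMn -mulrDr cos2Dsin2 mulr1.
rewrite sqrtr_sqr gtr0_norm// lnXn// mulr2n -mulr2n -[ln rho *+ 2]mulr_natr mulfK ?pnatr_eq0//.
rewrite -[X in X + _]mulr1 -mulrDr pmulr_rgt0// => c1.
congr (_ +i* _).
rewrite invfM mulrACA divff ?gt_eqF// mul1r.
have -> : sin eta / (1 + cos eta) = tan (eta / 2).
  have e2 : eta = (eta / 2) *+ 2 by rewrite -mulr_natr divfK ?pnatr_eq0.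
  rewrite /tan {1 2}e2 sin_mulr2n cos_mulr2n addrC subrK.
  move: c1; rewrite {1}e2 cos_mulr2n addrC subrK => c1.
  have c0 : cos (eta / 2) != 0.
    by apply: contraTneq c1 => ->; rewrite expr0n mul0rn ltxx.
  by field.
rewrite tanK; first by field.
by rewrite in_itv/=; move/andP: eb => [e1 e2]; apply/andP; split; lra.
Qed.

Lemma cvg_inv_nat : n.+2%:R^-1 @[n --> \oo] --> (0 : R).
Proof.
apply/cvgrPdist_le => e e0; near=> n.
rewrite sub0r normrN ger0_norm ?invr_ge0// -[e]invrK lef_pV2 ?posrE ?invr_gt0//.
apply: (@le_trans _ _ n%:R); last by rewrite ler_nat; lia.
by near: n; exact: nbhs_infty_ger.
Unshelve. all: by end_near. Qed.

Lemma clog_infty_Re b : slit b ->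
  complex.Re (clog b n.+2%:R) - ln (n.+2%:R) @[n --> \oo] --> (0 : R).
Proof.
case: b => x y sb.
have h : ln ((1 + x * n.+2%:R^-1) * (1 + x * n.+2%:R^-1) +
    (y * n.+2%:R^-1) * (y * n.+2%:R^-1)) / 2 @[n --> \oo] --> (0 : R).
  rewrite [X in _ --> X](_ : 0 = ln 1 / 2); last by rewrite ln1 mul0r.
  apply: cvgM; last exact: cvg_cst.
  apply: (@continuous_cvg _ _ _ _ _ _ (@ln R)); first exact: continuous_ln.
  rewrite [X in _ --> X](_ : 1 = (1 + x * 0) * (1 + x * 0) + (y * 0) * (y * 0)); last by ring.
  have c1 (z : R) : z * n.+2%:R^-1 @[n --> \oo] --> z * 0.
    by apply: cvgM; [exact: cvg_cst|exact: cvg_inv_nat].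
  have c2 : 1 + x * n.+2%:R^-1 @[n --> \oo] --> 1 + x * 0.
    by apply: cvgD => //; exact: cvg_cst.
  by apply: cvgD; apply: cvgM.
apply: cvg_trans h; apply: near_eq_cvg; apply: nearW => n /=.
have n0 : 0 < n.+2%:R :> R by [].
have q0 : 0 < (n.+2%:R + x) ^+ 2 + y ^+ 2.
  have := slit_neq0 (slit_addl sb (ltW n0)); rewrite eq_complex /= add0r => ne.
  rewrite lt0r addr_ge0 ?sqr_ge0// andbT paddr_eq0 ?sqr_ge0//.
  by rewrite !sqrf_eq0.
rewrite -!expr2; have -> : (1 + x / n.+2%:R) ^+ 2 + (y / n.+2%:R) ^+ 2 =
    ((n.+2%:R + x) ^+ 2 + y ^+ 2) / n.+2%:R ^+ 2.
  by field; rewrite gt_eqF.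
rewrite ln_div ?posrE ?exprn_gt0// lnXn// mulrBl; congr (_ - _).
by field.
Qed.

Lemma clog_infty_Im b : slit b ->
  complex.Im (clog b n.+2%:R) @[n --> \oo] --> (0 : R).
Proof.
case: b => x y sb /=.
rewrite [X in _ --> X](_ : 0 = 2 * atan 0); last by rewrite atan0 mulr0.
apply: cvgM; first exact: cvg_cst.
apply: (@continuous_cvg _ _ _ _ _ _ (@atan R)); first exact: continuous_atan.
apply/cvgrPdist_le => e e0; near=> n.
rewrite sub0r normrN !add0r; set d := _ + _.
have d1 : n.+2%:R + x <= d.
  by rewrite /d lerDr sqrtr_ge0.
have d0 : 0 < n.+2%:R + x.
  rewrite -ltrBlDr sub0r; apply: (@lt_le_trans _ _ n%:R); last by rewrite ler_nat; lia.
  by near: n; exact: nbhs_infty_gtr.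
have d2 := lt_le_trans d0 d1.
rewrite normrM normfV (gtr0_norm d2) ler_pdivrMr// -ler_pdivrMl//.
apply: le_trans d1; rewrite -lerBlDr.
apply: (@le_trans _ _ n%:R); last by rewrite ler_nat; lia.
by near: n; exact: nbhs_infty_ger.
Unshelve. all: by end_near. Qed.

End logarithm.

(** * Measures with a density, and improper integrals *)

Section density_measure.
Variable R : realType.
Local Notation lambda := (@lebesgue_measure R).

Lemma density_probability (D : set (measurableTypeR R)) (p : R -> R) :
  measurable D -> measurable_fun D p -> (forall x, D x -> 0 <= p x) ->
  (\int[lambda]_(x in D) (p x)%:E = 1)%E ->
  exists P : probability (measurableTypeR R) R, forall A, measurable A ->
    P A = (\int[lambda]_(x in A `&` D) (p x)%:E)%E.
Proof.
move=> mD mp p0 p1.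
pose nu (A : set (measurableTypeR R)) := (\int[lambda]_(x in A `&` D) (p x)%:E)%E.
have ip : lambda.-integrable D (EFin \o p).
  apply/integrableP; split; first exact/measurable_EFinP.
  rewrite (_ : (\int[lambda]_(x in D) _ = 1)%E) ?ltry// -[RHS]p1.
  by apply: eq_integral => x; rewrite inE => Dx; rewrite /= ger0_norm// p0.
have nu0 : nu set0 = 0%E by rewrite /nu set0I integral_set0.
have nuge0 A : (0 <= nu A)%E.
  by apply: integral_ge0 => x [_ Dx]; rewrite lee_fin p0.
have nusa : semi_sigma_additive nu.
  move=> F mF tF mUF; rewrite /nu setI_bigcupl integral_bigcup//=.
  - apply: is_cvg_ereal_nneg_natsum_cond => n _ _; exact: nuge0.
  - apply/trivIsetP => i j _ _ ij; rewrite setIACA setIid.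
    by move/trivIsetP: tF => /(_ i j I I ij) ->; rewrite set0I.
  - by move=> i; exact: measurableI.
  - apply: (integrableS mD) => //; first by apply: bigcup_measurable => k _; exact: measurableI.
    by move=> x [k _ []].
have nuT : nu setT = 1%E by rewrite /nu setTI.
pose m : {measure set (measurableTypeR R) -> \bar R} :=
  HB.pack nu (isMeasure.Build _ _ _ nu nu0 nuge0 nusa).
pose P : probability (measurableTypeR R) R :=
  HB.pack nu (isMeasure.Build _ _ _ nu nu0 nuge0 nusa) (Measure_isProbability.Build _ _ R m nuT).
by exists P.
Qed.

(** The Radon-Nikodym derivative of [P] is almost everywhere equal to [p] on
    [D]. *)
Lemma integral_density (D : set (measurableTypeR R)) (p f : R -> R)
    (P : probability (measurableTypeR R) R) :
  measurable D -> measurable_fun D p -> (forall x, D x -> 0 <= p x) ->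
  lambda.-integrable D (EFin \o p) ->
  (forall A, measurable A -> P A = (\int[lambda]_(x in A `&` D) (p x)%:E)%E) ->
  P.-integrable D (EFin \o f) ->
  (\int[P]_(x in D) (f x)%:E = \int[lambda]_(x in D) (f x * p x)%:E)%E.
Proof.
move=> mD mp p0 ip PE intf.
have dom : P `<< lambda.
  apply/null_content_dominatesP => A mA lA; rewrite PE//.
  apply: null_set_integral => //.
  - exact: measurableI.
  - by apply/measurable_EFinP; apply: measurable_funS mp.
  - by apply: subset_measure0 lA => //; exact: measurableI.
rewrite -(Radon_Nikodym_change_of_variables dom)//=.
have mf := measurable_int _ intf.
have iRN : lambda.-integrable D (Radon_Nikodym (charge_of_finite_measure P) lambda).
  by apply: (integrableS _ _ (@subsetT _ _)) => //=; apply: Radon_Nikodym_integrable.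
under [in RHS]eq_integral do rewrite EFinM.
apply: ae_eq_integral => //.
- by apply: emeasurable_funM => //; exact: (measurable_int lambda).
- by apply: emeasurable_funM => //; exact/measurable_EFinP.
- apply: ae_eqe_mul2l => /=.
  rewrite Radon_NikodymE//=.
  case: cid => /= h [h1 h2 h3].
  apply: integral_ae_eq => //=.
  + exact: integrableS h2.
  + exact/measurable_EFinP.
  + move=> E ED mE; rewrite -h3//= PE//.
    by congr (integral _ _ _); apply/setIidPl.
Qed.

(** Monotone convergence along an exhaustion of [D] by compact intervals leaves
    only the limits of the primitive at the two ends. *)
Lemma ge0_FTC2_bigcup (f F : R -> R) (a b : nat -> R) (D : set R) (l r : R) :
  (forall n, a n < b n) -> nonincreasing_seq a -> nondecreasing_seq b ->
  D = \bigcup_n `[a n, b n]%classic ->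
  (forall x, D x -> 0 <= f x) -> (forall x, D x -> {for x, continuous f}) ->
  (forall x, D x -> is_derive x 1 F (f x)) ->
  F (a n) @[n --> \oo] --> l -> F (b n) @[n --> \oo] --> r ->
  (\int[lambda]_(x in D) (f x)%:E = (r - l)%:E)%E.
Proof.
move=> ab na nb DE f0 cf dF Fl Fr.
have sD n : `[a n, b n] `<=` D by rewrite DE => x ?; exists n.
have wf n : {within `[a n, b n], continuous f}.
  by apply: continuous_in_subspaceT => x; rewrite inE => /sD; exact: cf.
have cF x : D x -> {for x, continuous F}.
  by move=> /dF h; apply/differentiable_continuous/derivable1_diffP; case: h.
have h : (\int[lambda]_(x in `[a n, b n]) (f x)%:E @[n --> \oo] -->
    \int[lambda]_(x in D) (f x)%:E)%E.
  rewrite DE; apply: ge0_nondecreasing_set_cvg_integral => //.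
  - move=> m n mn; rewrite subsetEset => x /=; rewrite !in_itv/=.
    move=> /andP[ax xb]; rewrite (le_trans (na _ _ mn) ax)/=.
    exact: le_trans xb (nb _ _ mn).
  - move=> n; apply/measurable_EFinP; apply: subspace_continuous_measurable_fun => //.
  - by move=> n x /sD /f0; rewrite lee_fin.
apply: (cvg_unique _ h) => //.
rewrite (_ : (fun n => _) = (fun n => (F (b n) - F (a n))%:E)).
  by apply: cvg_EFin; [exact: nearW|apply: cvgB].
apply/funext => n; rewrite (continuous_FTC2 (ab n) (wf n) (F := F))//.
- split.
  + move=> x xab; have h' : `[a n, b n]%classic x by apply: subset_itv_oo_cc xab.
    by case: (dF x (sD n _ h')).
  + by apply: cvg_at_right_filter; apply: cF; apply: (sD n); rewrite /= in_itv/= lexx ltW.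
  + by apply: cvg_at_left_filter; apply: cF; apply: (sD n); rewrite /= in_itv/= lexx ltW.
- move=> x xab; have h' : `[a n, b n]%classic x by apply: subset_itv_oo_cc xab.
  by rewrite derive1E; case: (dF x (sD n _ h')).
Qed.

(** Extending the kernel by [0] off the rectangle reduces the statement to
    integrals over the whole product space. *)
Lemma fubini_bounded (P : probability (measurableTypeR R) R)
    (k : measurableTypeR R * measurableTypeR R -> R)
    (A B : set (measurableTypeR R)) (M : R) :
  measurable A -> measurable B -> measurable_fun setT k -> (lambda A < +oo)%E ->
  0 <= M -> (forall u : R, A u -> (\int[P]_(x in B) `|k (x, u)|%:E <= M%:E)%E) ->
  P.-integrable B (fun x : R => \int[lambda]_(u in A) (k (x, u))%:E)%E /\
  (\int[P]_(x in B) \int[lambda]_(u in A) (k (x, u))%:E =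
   \int[lambda]_(u in A) \int[P]_(x in B) (k (x, u))%:E)%E.
Proof.
move=> mA mB mk lA M0 kM.
pose f := (EFin \o k) \_ (B `*` A).
have mBA : measurable (B `*` A) by exact: measurableX.
have mf : measurable_fun setT f.
  apply/(measurable_restrictT _ mBA)/measurable_EFinP.
  exact: measurable_funS measurableT (@subsetT _ _) mk.
have fE (u x : R) : f (x, u) = if (x \in B) && (u \in A) then (k (x, u))%:E else 0%E.
  by rewrite /f patchE in_setX.
have fA (u : R) (g : \bar R -> \bar R) : g 0%E = 0%E ->
    (\int[P]_x g (f (x, u)) = if u \in A then \int[P]_(x in B) g (k (x, u))%:E else 0)%E.
  move=> g0; case: ifPn => uA; last first.
    by rewrite integral0_eq// => x _; rewrite fE (negbTE uA) andbF.
  rewrite [RHS]integral_mkcond; apply: eq_integral => x _.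
  by rewrite fE uA patchE andbT; case: ifP.
have fB (x : R) :
    (\int[lambda]_u f (x, u) = if x \in B then \int[lambda]_(u in A) (k (x, u))%:E else 0)%E.
  case: ifPn => xB; last first.
    by rewrite integral0_eq// => u _; rewrite fE (negbTE xB).
  rewrite [RHS]integral_mkcond; apply: eq_integral => u _.
  by rewrite fE xB patchE.
have intf : (P \x lambda)%E.-integrable setT f.
  apply/(integrable21ltyP P lambda mf).
  apply: (@le_lt_trans _ _ (\int[lambda]_(u in A) (cst M%:E u))%E).
    rewrite [leRHS]integral_mkcond; apply: ge0_le_integral => //.
    - by move=> u _; exact: integral_ge0.
    - apply: (measurable_fun_fubini_tonelli_G (m1 := P) (abse \o f)).
      + by apply: measurableT_comp.
      + by move=> x /=.
    - by apply/(measurable_restrictT _ mA).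
    - move=> u _; rewrite (fA u abse) ?abse0// patchE; case: ifPn => // /set_mem uA.
      exact: kM.
  by rewrite integral_cst// lte_mul_pinfty// ?lee_fin.
have iF := integrable_fubini_F intf; have := Fubini intf.
rewrite (eq_integral (fun x => if x \in B then \int[lambda]_(u in A) (k (x, u))%:E else 0)%E); last first.
  by move=> x _; rewrite fB.
rewrite [RHS](eq_integral (fun u => if u \in A then \int[P]_(x in B) (k (x, u))%:E else 0)%E); last first.
  by move=> u _; rewrite (fA u id).
move=> E; split.
  apply/(integrable_mkcond _ mB); apply: eq_integrable iF => // x _.
  by rewrite /fubini_F fB patchE.
by rewrite [LHS]integral_mkcond [RHS]integral_mkcond /patch.
Qed.

End density_measure.

Ltac nz := repeat (apply/andP; split); first [done | by rewrite gt_eqF | by rewrite lt_eqF].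
(** * The density in the variable [v = |x| ^ (1 / gamma)] *)

Section root_density.
Variables (R : realType) (gamma : nat).
Hypothesis gamma_gt1 : (1 < gamma)%N.
Local Notation lambda := (@lebesgue_measure R).
Local Notation D := (`]-oo, (0 : R)[%classic).
Local Notation theta := (pi / gamma%:R : R).

Let gamma_gt0 : 0 < gamma%:R :> R.
Proof. by rewrite ltr0n ltnW. Qed.

Let gamma_neq0 : gamma%:R != 0 :> R.
Proof. by rewrite gt_eqF. Qed.

Lemma theta_bounds : 0 < theta < pi.
Proof.
rewrite divr_gt0 ?pi_gt0//= ltr_pdivrMr// -[ltLHS]mulr1 ltr_pM2l ?pi_gt0//.
by rewrite ltr1n.
Qed.

Lemma sin_theta_gt0 : 0 < sin theta.
Proof. exact: sin_gt0_pi theta_bounds. Qed.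

Definition opp_root (x : R) : R := (- x) `^ gamma%:R^-1.

Lemma opp_root_gt0 x : x < 0 -> 0 < opp_root x.
Proof. by move=> x0; rewrite powR_gt0// oppr_gt0. Qed.

Lemma opp_rootX x : x < 0 -> opp_root x ^+ gamma = - x.
Proof.
move=> x0; have mx0 : 0 <= - x by rewrite oppr_ge0 ltW.
by rewrite /opp_root -powR_mulrn ?powR_ge0// -powRrM mulVf// powRr1.
Qed.

Lemma opp_rootNX v : 0 <= v -> opp_root (- v ^+ gamma) = v.
Proof.
by move=> v0; rewrite /opp_root opprK -powR_mulrn// -powRrM divff// powRr1.
Qed.

Lemma is_derive_opp_root (x : R) : x < 0 -> is_derive x 1 opp_root (- (opp_root x / (gamma%:R * - x))).
Proof.
move=> x0; have mx0 : 0 < - x by rewrite oppr_gt0.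
have dN : is_derive x 1 (-%R : R -> R) (- 1) by exact: is_deriveNid.
have := @is_derive1_comp _ (fun y => y `^ gamma%:R^-1) (-%R : R -> R) x _ _
  (is_derive1_powR gamma%:R^-1 mx0) dN.
move=> h; apply: (@is_derive_eq _ _ _ _ _ _ _ _ h).
rewrite powRB ?powRr1 ?(ltW mx0) ?(gt_eqF mx0) ?implybT// /opp_root.
by field; nz.
Qed.

Lemma continuous_opp_root x : x < 0 -> {for x, continuous opp_root}.
Proof.
move=> /is_derive_opp_root h; apply/differentiable_continuous/derivable1_diffP.
by case: h.
Qed.

(** The change of variables [x = - v ^+ gamma], performed on primitives. *)
Lemma ge0_integral_root (h Psi : R -> R) (l0 loo : R) :
  (forall v : R, 0 < v -> 0 <= h v) -> (forall v : R, 0 < v -> {for v, continuous h}) ->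
  (forall v : R, 0 < v -> is_derive v 1 Psi (h v)) ->
  Psi n.+2%:R @[n --> \oo] --> loo -> Psi n.+2%:R^-1 @[n --> \oo] --> l0 ->
  (\int[lambda]_(x in D) (h (opp_root x) * (opp_root x / (gamma%:R * - x)))%:E = (loo - l0)%:E)%E.
Proof.
move=> h0 ch dPsi Poo P0.
pose a (n : nat) : R := - n.+2%:R ^+ gamma.
pose b (n : nat) : R := - n.+2%:R^-1 ^+ gamma.
have n2 n : 0 < n.+2%:R :> R by [].
have sX (x y : R) : 0 <= x -> x <= y -> - y ^+ gamma <= - x ^+ gamma.
  by move=> x0 xy; rewrite lerN2 lerXn2r// nnegrE (le_trans x0).
have -> : loo - l0 = - l0 - (- loo) by rewrite opprK addrC.
apply: (@ge0_FTC2_bigcup _ _ (fun x => - Psi (opp_root x)) a b).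
- move=> n; rewrite /a /b ltrN2 ltrXn2r ?nnegrE ?invr_ge0 -?lt0n ?(ltnW gamma_gt1)//.
  by apply: (@lt_trans _ _ 1); rewrite ?invf_lt1// ltr1n.
- by move=> m n mn; apply: sX => //; rewrite ler_nat.
- by move=> m n mn; apply: sX; rewrite ?invr_ge0// lef_pV2 ?posrE// ler_nat.
- apply/seteqP; split => x /=.
    rewrite in_itv/= => x0; have r0 := opp_root_gt0 x0.
    have xE : x = - opp_root x ^+ gamma by rewrite opp_rootX// opprK.
    pose n := maxn (Num.bound (opp_root x)) (Num.bound (opp_root x)^-1).
    exists n => //=; rewrite in_itv/=.
    have l1 : opp_root x <= n.+2%:R.
      apply: (@le_trans _ _ (Num.bound (opp_root x))%:R).
        by apply: ltW; apply: archi_boundP; exact: ltW.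
      by rewrite ler_nat /n; lia.
    have l2 : (opp_root x)^-1 <= n.+2%:R.
      apply: (@le_trans _ _ (Num.bound (opp_root x)^-1)%:R).
        by apply: ltW; apply: archi_boundP; rewrite invr_ge0 ltW.
      by rewrite ler_nat /n; lia.
    rewrite xE; apply/andP; split; apply: sX; rewrite ?invr_ge0//; first exact: ltW.
    by rewrite -[leRHS]invrK lef_pV2 ?posrE ?invr_gt0.
  move=> [n _ /=]; rewrite !in_itv/= => /andP[_ /le_lt_trans]; apply.
  by rewrite oppr_lt0 exprn_gt0// invr_gt0.
- move=> x /=; rewrite in_itv/= => x0; have r0 := opp_root_gt0 x0.
  by rewrite mulr_ge0 ?h0// divr_ge0 ?ltW// mulr_gt0// oppr_gt0.
- move=> x /=; rewrite in_itv/= => x0; have r0 := opp_root_gt0 x0.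
  have cr := continuous_opp_root x0.
  apply: (@continuousM _ _ (h \o opp_root)); first by apply: continuous_comp => //; exact: ch.
  apply: continuousM => //; apply: continuousV.
    by rewrite mulf_neq0// oppr_eq0 lt_eqF.
  apply: continuousM; first exact: cst_continuous.
  by apply: cvgN; exact: cvg_id.
- move=> x /=; rewrite in_itv/= => x0; have r0 := opp_root_gt0 x0.
  have d1 := @is_derive1_comp _ Psi opp_root x _ _ (dPsi _ r0) (is_derive_opp_root x0).
  have d2 := is_deriveN d1.
  by apply: (@is_derive_eq _ _ _ _ _ _ _ _ d2); rewrite mulrN opprK.
- apply: cvgN; rewrite (_ : (fun n => _) = (fun n => Psi n.+2%:R))//.
  by apply/funext => n; rewrite opp_rootNX.
- apply: cvgN; rewrite (_ : (fun n => _) = (fun n => Psi n.+2%:R^-1))//.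
  by apply/funext => n; rewrite opp_rootNX// invr_ge0.
Qed.

(** The density after the change of variables [x = - v ^+ gamma], Jacobian
    included: a rational function of [v]. *)
Definition kern (v : R) : R :=
  gamma%:R * sin theta / (pi * (1 + 2 * v * cos theta + v ^+ 2)).

Lemma kern_denom v : 1 + 2 * v * cos theta + v ^+ 2 = (v + cos theta) ^+ 2 + sin theta ^+ 2.
Proof. by rewrite sin2cos2; ring. Qed.

Lemma kern_denom_gt0 v : 0 < 1 + 2 * v * cos theta + v ^+ 2.
Proof. by rewrite kern_denom ltr_wpDl ?sqr_ge0// exprn_gt0 ?sin_theta_gt0. Qed.

Lemma kern_ge0 v : 0 <= kern v.
Proof.
rewrite divr_ge0 ?mulr_ge0 ?(ltW sin_theta_gt0) ?(ltW gamma_gt0) ?pi_ge0//.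
exact/ltW/kern_denom_gt0.
Qed.

Lemma continuous_kern : continuous kern.
Proof.
move=> v; rewrite /kern; apply: cvgM; first exact: cvg_cst.
apply: cvgV; first by rewrite mulf_neq0 ?gt_eqF ?pi_gt0 ?kern_denom_gt0.
apply: cvgM; first exact: cvg_cst.
apply: cvgD; last exact: exprn_continuous.
apply: cvgD; first exact: cvg_cst.
apply: cvgM; last exact: cvg_cst.
by apply: cvgM; [exact: cvg_cst|exact: cvg_id].
Qed.

Lemma density_BE x : x < 0 ->
  density_B gamma x = kern (opp_root x) * (opp_root x / (gamma%:R * - x)).
Proof.
move=> x0; have r0 := opp_root_gt0 x0.
have p0 := pi_gt0 R.
have d0 := kern_denom_gt0 (opp_root x).
have d1 : 0 < (opp_root x)^-1 + 2 * cos theta + opp_root x.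
  suff -> : (opp_root x)^-1 + 2 * cos theta + opp_root x =
     (1 + 2 * opp_root x * cos theta + opp_root x ^+ 2) / opp_root x by rewrite divr_gt0.
  by field; rewrite gt_eqF.
rewrite /density_B ltr0_norm// powRN -/(opp_root x) /kern.
move: (cos theta) (sin theta) d0 d1 => c s d0 d1; move: (@pi R) p0 => p p0.
suff -> : 1 + 2 * opp_root x * c + opp_root x ^+ 2 = opp_root x * ((opp_root x)^-1 + 2 * c + opp_root x).
  move: (_^-1 + 2 * c + _) d1 => e e0; move: (opp_root x) r0 {d0} => r r0.
  by field; nz.
by field; rewrite gt_eqF.
Qed.

Lemma cvg_is_cderive0 (f : R -> R[i]) (d : R[i]) : is_cderive f 0 d ->
  complex.Re (f n.+2%:R^-1) @[n --> \oo] --> complex.Re (f 0) /\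
  complex.Im (f n.+2%:R^-1) @[n --> \oo] --> complex.Im (f 0).
Proof.
move=> [[dr _] [di _]]; split.
  apply: (@continuous_cvg _ _ _ _ _ _ (fun u => complex.Re (f u))); last exact: cvg_inv_nat.
  exact/differentiable_continuous/derivable1_diffP.
apply: (@continuous_cvg _ _ _ _ _ _ (fun u => complex.Im (f u))); last exact: cvg_inv_nat.
exact/differentiable_continuous/derivable1_diffP.
Qed.

(** A primitive of [kern], by the decomposition of the latter over its poles
    [- cis theta] and [- cis (- theta)]. *)
Definition kern_primitive (v : R) : R := - (gamma%:R / pi) * complex.Im (clog (cis theta) v).

Lemma slit_cis_theta : slit (cis theta).
Proof.
have := @slit_polar R 1 theta ltr01; rewrite mul1r; apply.
by case/andP: theta_bounds => t0 ->; rewrite (lt_trans _ t0)// oppr_lt0 pi_gt0.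
Qed.

Lemma is_derive_kern_primitive (v : R) : 0 <= v -> is_derive v 1 kern_primitive (kern v).
Proof.
move=> v0; have [_ di] := is_cderive_clog slit_cis_theta v0.
have dZ := is_deriveZ (- (gamma%:R / pi)) di.
apply: (@is_derive_eq _ _ _ _ _ _ _ _ dZ).
rewrite /= add0r -kern_denom /kern /GRing.scale/=.
have := pi_gt0 R; have := kern_denom_gt0 v.
move: (cos theta) (sin theta) => c s; move: (@pi R) => p d0 p0.
by field; nz.
Qed.

Lemma cvg_kern_primitive_infty : kern_primitive n.+2%:R @[n --> \oo] --> (0 : R).
Proof.
rewrite -[X in _ --> X](mulr0 (- (gamma%:R / pi))).
by apply: cvgM; [exact: cvg_cst|exact: clog_infty_Im slit_cis_theta].
Qed.

Lemma cvg_kern_primitive0 : kern_primitive n.+2%:R^-1 @[n --> \oo] --> (-1 : R).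
Proof.
have [_ ci] := cvg_is_cderive0 (is_cderive_clog slit_cis_theta (lexx 0)).
have -> : -1 = - (gamma%:R / pi) * complex.Im (clog (cis theta) 0) :> R.
  have tb : - pi < theta < pi.
    by case/andP: theta_bounds => t0 ->; rewrite (lt_trans _ t0)// oppr_lt0 pi_gt0.
  have := clog0 ltr01 tb; rewrite rmorph1 mul1r => -> /=.
  by have := pi_gt0 R; move: (@pi R) => p p0; field; nz.
by apply: cvgM; [exact: cvg_cst|exact: ci].
Qed.

Lemma density_B_ge0 (x : R) : x < 0 -> 0 <= density_B gamma x.
Proof.
move=> x0; rewrite density_BE// mulr_ge0 ?kern_ge0//.
by rewrite divr_ge0 ?(ltW (opp_root_gt0 x0))// mulr_ge0// oppr_ge0 ltW.
Qed.

Lemma integral_density_B : (\int[lambda]_(x in D) (density_B gamma x)%:E = 1)%E.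
Proof.
rewrite (_ : 1%E = (0 - (-1))%:E); last by rewrite opprK add0r.
transitivity (\int[lambda]_(x in D) (kern (opp_root x) * (opp_root x / (gamma%:R * - x)))%:E)%E.
  by apply: eq_integral => x; rewrite inE/= in_itv/= => x0; rewrite density_BE.
apply: (@ge0_integral_root kern kern_primitive (-1) 0).
- by move=> v _; exact: kern_ge0.
- by move=> v _; exact: continuous_kern.
- by move=> v v0; exact/is_derive_kern_primitive/ltW.
- exact: cvg_kern_primitive_infty.
- exact: cvg_kern_primitive0.
Qed.

Lemma measurable_density_B : measurable_fun (D : set (measurableTypeR R)) (density_B gamma).
Proof.
apply: (@eq_measurable_fun _ _ _ _ _ (fun y => kern (opp_root y) * (opp_root y / (gamma%:R * - y)))).
  by move=> x; rewrite inE/= in_itv/= => x0; rewrite density_BE.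
apply: open_continuous_measurable_fun => // x; rewrite inE/= in_itv/= => x0.
have cr := continuous_opp_root x0.
apply: cvgM.
  by apply: (@continuous_cvg _ _ _ _ _ _ kern) => //; exact: continuous_kern.
apply: cvgM => //; apply: cvgV; first by rewrite mulf_neq0// oppr_eq0 lt_eqF.
by apply: cvgM; [exact: cvg_cst|apply: cvgN; exact: cvg_id].
Qed.

(** Integrals of bounded functions against the density are increments of
    primitives in the variable [v]. *)
Lemma integral_root_probability (P : probability (measurableTypeR R) R)
    (f Psi : R -> R) (C l0 loo : R) :
  (forall A, measurable A -> P A = (\int[lambda]_(x in A `&` D) (density_B gamma x)%:E)%E) ->
  (forall x : R, x < 0 -> `|f x| <= C) -> (forall x : R, x < 0 -> {for x, continuous f}) ->
  (forall v : R, 0 < v -> is_derive v 1 Psi (kern v * f (- v ^+ gamma))) ->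
  Psi n.+2%:R @[n --> \oo] --> loo -> Psi n.+2%:R^-1 @[n --> \oo] --> l0 ->
  P.-integrable D (EFin \o f) /\ \int[P]_(x in D) f x = loo - l0.
Proof.
move=> PE fC cf dPsi Poo P0.
have mD : measurable (D : set (measurableTypeR R)) by exact: measurable_itv.
have mf : measurable_fun (D : set (measurableTypeR R)) f.
  by apply: open_continuous_measurable_fun => // x; rewrite inE/= in_itv/=; exact: cf.
have intf (g : R -> R) (c : R) : measurable_fun (D : set (measurableTypeR R)) g ->
    (forall x : R, x < 0 -> `|g x| <= c) -> P.-integrable D (EFin \o g).
  move=> mg gc; apply: measurable_bounded_integrable => //.
    exact: (le_lt_trans (probability_le1 P mD) (ltry 1)).
  exists c; split; rewrite ?num_real// => M cM x /=; rewrite in_itv/= => x0.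
  by rewrite (le_trans (gc _ x0))// ltW.
have PD : P D = 1%E by rewrite PE// setIid integral_density_B.
have ip : lambda.-integrable D (EFin \o density_B gamma).
  apply/integrableP; split; first by apply/measurable_EFinP; exact: measurable_density_B.
  rewrite (_ : (\int[lambda]_(x in D) _ = 1)%E) ?ltry// -[RHS]integral_density_B.
  apply: eq_integral => x; rewrite inE/= in_itv/= => x0.
  by rewrite ger0_norm// density_B_ge0.
have if1 := intf f C mf fC; split => //.
(* monotone convergence requires a nonnegative integrand *)
pose g x := f x + C.
have mg : measurable_fun (D : set (measurableTypeR R)) g by apply: measurable_funD.
have ig : P.-integrable D (EFin \o g).
  apply: (intf g (C + C)) => // x x0.
  have C0 : 0 <= C by rewrite (le_trans _ (fC _ x0)).
  by rewrite (le_trans (ler_normD _ _))// (ger0_norm C0) lerD2r fC.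
have Ig : (\int[P]_(x in D) (g x)%:E = ((loo + C * 0) - (l0 + C * -1))%:E)%E.
  rewrite (integral_density mD measurable_density_B _ ip PE ig); last first.
    by move=> x /=; rewrite in_itv/= => x0; exact: density_B_ge0.
  pose h v := kern v * (f (- v ^+ gamma) + C).
  transitivity (\int[lambda]_(x in D) (h (opp_root x) * (opp_root x / (gamma%:R * - x)))%:E)%E.
    apply: eq_integral => x; rewrite inE/= in_itv/= => x0.
    by rewrite density_BE// /h opp_rootX// opprK /g mulrA [_ * kern _]mulrC.
  apply: (@ge0_integral_root h (fun v => Psi v + C * kern_primitive v)).
  - move=> v v0; rewrite mulr_ge0 ?kern_ge0// -lerBlDr sub0r.
    have := fC (- v ^+ gamma); rewrite oppr_lt0 exprn_gt0// => /(_ isT).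
    by rewrite ler_norml => /andP[].
  - move=> v v0; apply: cvgM; first exact: continuous_kern.
    apply: cvgD; last exact: cvg_cst.
    apply: (@continuous_cvg _ _ _ _ _ _ f).
      by apply: cf; rewrite oppr_lt0 exprn_gt0.
    by apply: cvgN; exact: exprn_continuous.
  - move=> v v0.
    have d1 := dPsi v v0; have d2 := is_deriveZ C (is_derive_kern_primitive (ltW v0)).
    have d3 := is_deriveD d1 d2.
    by apply: (@is_derive_eq _ _ _ _ _ _ _ _ d3); rewrite /h mulrDr /GRing.scale/= [C * _]mulrC.
  - by apply: cvgD => //; apply: cvgM; [exact: cvg_cst|exact: cvg_kern_primitive_infty].
  - by apply: cvgD => //; apply: cvgM; [exact: cvg_cst|exact: cvg_kern_primitive0].
have : \int[P]_(x in D) g x = \int[P]_(x in D) f x + C.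
  rewrite /g RintegralD//; last by apply: (intf (cst C) `|C|) => // x _.
  by congr (_ + _); transitivity (C * fine (P D)); [exact: Rintegral_cst|rewrite PD mulr1].
rewrite /Rintegral Ig /= => h.
by apply: (addIr C); rewrite -h; ring.
Qed.

End root_density.

(** * Partial fractions *)

Section partial_fractions.
Variables (R : realType) (gamma : nat).
Hypothesis gamma_gt1 : (1 < gamma)%N.
Local Notation theta := (pi / gamma%:R : R).
Local Notation kern := (@kern R gamma).

Let gamma_gt0 : 0 < gamma%:R :> R.
Proof. by rewrite ltr0n ltnW. Qed.

Let gamma_neq0 : gamma%:R != 0 :> R.
Proof. by rewrite gt_eqF. Qed.

Lemma gamma_theta : gamma%:R * theta = pi.
Proof. by rewrite mulrCA divff// mulr1. Qed.

Lemma cis_even_theta_eq1 (m : nat) : (0 < m < gamma)%N -> cis (m.*2%:R * theta) != 1.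
Proof.
move=> /andP[m0 mg].
have -> : m.*2%:R * theta = (m%:R * theta) *+ 2.
  by move: theta => th; rewrite -muln2 natrM; ring.
rewrite /cis eq_complex/= negb_and cos_mulr2n cos2sin2.
suff s0 : 0 < sin (m%:R * theta).
  apply/orP; left; rewrite -subr_eq0 (_ : _ - _ = - (2 * sin (m%:R * theta) ^+ 2)); last by ring.
  by rewrite oppr_eq0 mulf_neq0 ?pnatr_eq0// expf_neq0// gt_eqF.
have /andP[t0 _] := theta_bounds R gamma_gt1.
apply: sin_gt0_pi; rewrite mulr_gt0 ?ltr0n//=.
by rewrite -[ltRHS]gamma_theta ltr_pM2r// ltr_nat.
Qed.

(** The [gamma]-th roots of [- w ^+ gamma]. *)
Definition neg_root (w : R[i]) (j : nat) : R[i] := w * cis (j.*2.+1%:R * theta).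

Lemma neg_rootX w j : neg_root w j ^+ gamma = - w ^+ gamma.
Proof.
rewrite /neg_root exprMn cisX mulrCA gamma_theta -addn1 natrD mulrDl mul1r.
by rewrite cisD -muln2 natrM -mulrA [2 * pi]mulr_natl cis2pi mul1r cispi mulrN1.
Qed.

Lemma neg_root_inj w i j : w != 0 -> (i < gamma)%N -> (j < gamma)%N ->
  neg_root w i = neg_root w j -> i = j.
Proof.
move=> w0; wlog ij : i j / (i <= j)%N => [hw|] ig jg e.
  have [ij|/ltnW ji] := leqP i j; first exact: hw.
  by apply/esym; apply: hw.
apply/eqP; rewrite eqn_leq ij/= leqNgt; apply/negP => ij'.
move/(mulfI w0): e => e.
have /negP : cis ((j - i).*2%:R * theta) != 1 by apply: cis_even_theta_eq1; lia.
apply; have -> : (j - i).*2%:R * theta = j.*2.+1%:R * theta - i.*2.+1%:R * theta.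
  rewrite -mulrBl -natrB; last lia.
  by congr (_%:R * _); lia.
by rewrite cisD cisN -e divff// cis_neq0.
Qed.

Lemma prod_neg_root (w : R[i]) : w != 0 ->
  \prod_(x <- [seq neg_root w j | j <- iota 0 gamma]) ('X - x%:P) =
  'X^gamma + (w ^+ gamma)%:P.
Proof.
move=> w0; set rs := map _ _; set p := _ + _%:P.
have sp : size p = gamma.+1 by rewrite size_XnaddC// ltnW.
have lc : lead_coef p = 1 by apply/eqP; rewrite -monicE monicXnaddC// ltnW.
have := @all_roots_prod_XsubC _ p rs; rewrite sp size_map size_iota lc scale1r => -> //.
  by apply/allP => x /mapP[j _ ->]; rewrite rootE !hornerE neg_rootX addNr.
rewrite uniq_rootsE map_inj_in_uniq ?iota_uniq// => i j.
by rewrite !mem_iota !add0n => /andP[_ ig] /andP[_ jg]; exact: neg_root_inj.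
Qed.

(** Logarithmic derivative of [v ^+ gamma + w ^+ gamma]. *)
Lemma sum_neg_root (w v : R[i]) : w != 0 -> v ^+ gamma + w ^+ gamma != 0 ->
  (forall j, (j < gamma)%N -> v != neg_root w j) ->
  \sum_(0 <= j < gamma) neg_root w j / (neg_root w j - v) =
  gamma%:R * w ^+ gamma / (w ^+ gamma + v ^+ gamma).
Proof.
move=> w0 vw0 vN; have := @prod_XsubC_logderiv _ [seq neg_root w j | j <- iota 0 gamma] v.
rewrite prod_neg_root// derivD derivC addr0 derivXn !hornerE big_map.
have vs : v \notin [seq neg_root w j | j <- iota 0 gamma].
  apply/negP => /mapP[j]; rewrite mem_iota add0n => /andP[_ jg] /eqP.
  by rewrite (negbTE (vN _ jg)).
move=> /(_ vs) h.
have g1 : v * v ^+ gamma.-1 = v ^+ gamma by rewrite -exprS prednK// ltnW.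
transitivity (\sum_(0 <= j < gamma) (1 - v * (v - neg_root w j)^-1)).
  apply: eq_big_nat => j /andP[_ /vN vj].
  have vj' : neg_root w j - v != 0 by rewrite subr_eq0 eq_sym.
  by have vj2 : v - neg_root w j != 0; [rewrite subr_eq0|field; rewrite vj' vj2].
rewrite sumrB -mulr_sumr sumr_const_nat subn0.
have -> : \sum_(0 <= i < gamma) (v - neg_root w i)^-1 =
    v ^+ gamma.-1 *+ gamma / (v ^+ gamma + w ^+ gamma).
  by rewrite hornerMn hornerXn in h; rewrite h mulrAC divff// mul1r /index_iota subn0.
rewrite -[v ^+ gamma.-1 *+ gamma]mulr_natr mulrA mulrA g1 [w ^+ _ + _]addrC.
by field.
Qed.

(** The quotients by which the residues of the Cauchy integrand at
    [neg_root w j] and at the poles of [kern] are expressed: for each [j] two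
    consecutive terms of this sequence occur. *)
Definition cis_frac (w : R[i]) (n : nat) : R[i] := w / (w + cis (- (n.*2%:R * theta))).

Lemma cis_frac_neg_rootS (w : R[i]) j : w + cis (- (j.+1.*2%:R * theta)) != 0 ->
  neg_root w j + cis (- theta) != 0 /\
  cis_frac w j.+1 = neg_root w j / (neg_root w j + cis (- theta)).
Proof.
have E : neg_root w j + cis (- theta) =
    (w + cis (- (j.+1.*2%:R * theta))) * cis (j.*2.+1%:R * theta).
  rewrite [RHS]mulrDl -[X in _ = _ + X]cisD; congr (_ + cis _).
  by rewrite doubleS -(natr1 j.*2.+1); move: theta => th; ring.
move=> h; rewrite E mulf_neq0 ?cis_neq0//; split => //.
by rewrite /cis_frac /neg_root -mulf_div divff ?mulr1// cis_neq0.
Qed.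

Lemma cis_frac_neg_root (w : R[i]) j : w + cis (- (j.*2%:R * theta)) != 0 ->
  neg_root w j + cis theta != 0 /\
  cis_frac w j = neg_root w j / (neg_root w j + cis theta).
Proof.
have E : neg_root w j + cis theta =
    (w + cis (- (j.*2%:R * theta))) * cis (j.*2.+1%:R * theta).
  rewrite [RHS]mulrDl -[X in _ = _ + X]cisD; congr (_ + cis _).
  by rewrite -(natr1 j.*2); move: theta => th; ring.
move=> h; rewrite E mulf_neq0 ?cis_neq0//; split => //.
by rewrite /cis_frac /neg_root -mulf_div divff ?mulr1// cis_neq0.
Qed.

Lemma cis_kern (v : R) :
  (v%:C + cis theta) * (v%:C + cis (- theta)) = (1 + 2 * v * cos theta + v ^+ 2)%:C.
Proof.
rewrite /cis cosN sinN; apply/eqP; rewrite eq_complex/=; apply/andP; split; apply/eqP; last by ring.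
by rewrite -[X in X + _ + _](cos2Dsin2 theta); move: (cos theta) (sin theta) => c s; ring.
Qed.

Lemma cis_subN : cis theta - cis (- theta) = 2 * 'i * (sin theta)%:C.
Proof.
rewrite /cis cosN sinN; apply/eqP; rewrite eq_complex/=; apply/andP; split; apply/eqP; ring.
Qed.

(** The integrand of the Cauchy transform, decomposed over the poles of the
    density and of [t + v ^+ gamma]; the terms are grouped so that their
    primitives at [v = 0] telescope. *)
Lemma partial_fractions (w : R[i]) (v : R) : w != 0 ->
  v%:C ^+ gamma + w ^+ gamma != 0 ->
  (forall j, (j < gamma)%N -> v%:C != neg_root w j) ->
  (forall n, w + cis (- (n.*2%:R * theta)) != 0) ->
  (2 * pi%:C * 'i)^-1 * \sum_(0 <= j < gamma)
    (cis_frac w j.+1 * ((v%:C + cis (- theta))^-1 - (v%:C - neg_root w j)^-1) -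
     cis_frac w j * ((v%:C + cis theta)^-1 - (v%:C - neg_root w j)^-1)) =
  (kern v)%:C * (w ^+ gamma / (w ^+ gamma + v%:C ^+ gamma)).
Proof.
move=> w0 vw0 vN wN.
have d0 := kern_denom_gt0 gamma_gt1 v.
have dC : (v%:C + cis theta) * (v%:C + cis (- theta)) != 0.
  by rewrite cis_kern fmorph_eq0 gt_eqF.
have [e1 e2] : v%:C + cis theta != 0 /\ v%:C + cis (- theta) != 0.
  by move: dC; rewrite mulf_eq0 negb_or => /andP[].
have p0 : (pi%:C : R[i]) != 0 by rewrite fmorph_eq0 gt_eqF// pi_gt0.
transitivity ((2 * pi%:C * 'i)^-1 * \sum_(0 <= j < gamma)
    (neg_root w j / (neg_root w j - v%:C) *
     (2 * 'i * (sin theta)%:C / (1 + 2 * v * cos theta + v ^+ 2)%:C))).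
  congr (_ * _); apply: eq_big_nat => j /andP[_ jg].
  have [h1 ->] := cis_frac_neg_rootS (wN j.+1); have [h2 ->] := cis_frac_neg_root (wN j).
  have h3 : v%:C - neg_root w j != 0 by rewrite subr_eq0 vN.
  have h4 : neg_root w j - v%:C != 0 by rewrite subr_eq0 eq_sym vN.
  rewrite -cis_kern -cis_subN.
  move: (neg_root w j) (cis theta) (cis (- theta)) (v%:C) h1 h2 h3 h4 e1 e2.
  move=> a e f u h1 h2 h3 h4 e1 e2; field; nz.
rewrite -mulr_suml sum_neg_root// /kern.
rewrite !(rmorphM, fmorphV, rmorph_nat)/=.
have i0 : 'i != 0 :> R[i] by rewrite neq0Ci.
have d1 : ((1 + 2 * v * cos theta + v ^+ 2)%:C : R[i]) != 0 by rewrite fmorph_eq0 gt_eqF.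
have vw1 : w ^+ gamma + v%:C ^+ gamma != 0 by rewrite addrC.
move: ((_ + _ + _)%:C) d1 (pi%:C) p0 (sin _)%:C (w ^+ gamma) (v%:C ^+ gamma) vw1.
move=> d d1 p p0' s W V vw1; move: 'i i0 => I i0.
by field; nz.
Qed.

End partial_fractions.

(** * Componentwise calculus of complex-valued functions *)

Section componentwise.
Variable R : realType.
Implicit Types (f g : R -> R[i]) (v : R) (u : nat -> R[i]) (c d l : R[i]).

Lemma complex_ReM c d : complex.Re (c * d) =
  complex.Re c * complex.Re d - complex.Im c * complex.Im d.
Proof. by case: c d => a b []. Qed.

Lemma complex_ImM c d : complex.Im (c * d) =
  complex.Re c * complex.Im d + complex.Im c * complex.Re d.
Proof. by case: c d => a b [] x y /=; rewrite [b * x]mulrC. Qed.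

Lemma is_cderiveMl c f v d : is_cderive f v d -> is_cderive (fun x => c * f x) v (c * d).
Proof.
move=> [dr di]; split; rewrite ?complex_ReM ?complex_ImM.
  have h := is_deriveB (is_deriveZ (complex.Re c) dr) (is_deriveZ (complex.Im c) di).
  rewrite [X in is_derive _ _ X _](_ : _ = (complex.Re c \*: (fun x => complex.Re (f x))) -
    (complex.Im c \*: (fun x => complex.Im (f x)))) //.
  by apply/funext => x; rewrite complex_ReM.
have h := is_deriveD (is_deriveZ (complex.Re c) di) (is_deriveZ (complex.Im c) dr).
rewrite [X in is_derive _ _ X _](_ : _ = (complex.Re c \*: (fun x => complex.Im (f x))) +
  (complex.Im c \*: (fun x => complex.Re (f x)))) //.
by apply/funext => x; rewrite complex_ImM.
Qed.

Lemma is_cderiveB f g v c d : is_cderive f v c -> is_cderive g v d ->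
  is_cderive (fun x => f x - g x) v (c - d).
Proof.
move=> [fr fi] [gr gi]; split; rewrite raddfB/=.
  have h := is_deriveB fr gr.
  rewrite [X in is_derive _ _ X _](_ : _ = (fun x => complex.Re (f x)) -
    (fun x => complex.Re (g x))) //.
  by apply/funext => x; rewrite raddfB.
have h := is_deriveB fi gi.
rewrite [X in is_derive _ _ X _](_ : _ = (fun x => complex.Im (f x)) -
  (fun x => complex.Im (g x))) //.
by apply/funext => x; rewrite raddfB.
Qed.

Lemma is_cderiveD f g v c d : is_cderive f v c -> is_cderive g v d ->
  is_cderive (fun x => f x + g x) v (c + d).
Proof.
move=> hf /(is_cderiveMl (-1)) hg; have := is_cderiveB hf hg.
rewrite mulN1r opprK (_ : (fun x => _) = (fun x => f x + g x))//.
by apply/funext => x; rewrite mulN1r opprK.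
Qed.

Lemma is_cderive_cst c v : is_cderive (fun=> c) v 0.
Proof. by split; exact: is_derive_cst. Qed.

Lemma is_cderive_sum n (f : nat -> R -> R[i]) (d : nat -> R[i]) v :
  (forall j, (j < n)%N -> is_cderive (f j) v (d j)) ->
  is_cderive (fun x => \sum_(0 <= j < n) f j x) v (\sum_(0 <= j < n) d j).
Proof.
elim: n => [_|n IH h].
  rewrite big_nil (_ : (fun x => _) = fun=> 0); first exact: is_cderive_cst.
  by apply/funext => x; rewrite big_nil.
rewrite big_nat_recr//= (_ : (fun x => _) = fun x => \sum_(0 <= j < n) f j x + f n x).
  by apply: is_cderiveD; [apply: IH => j jn; apply: h; exact: ltnW|exact: h].
by apply/funext => x; rewrite big_nat_recr.
Qed.

Definition ccvg u l :=
  complex.Re (u n) @[n --> \oo] --> complex.Re l /\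
  complex.Im (u n) @[n --> \oo] --> complex.Im l.

Lemma ccvgMl c u l : ccvg u l -> ccvg (fun n => c * u n) (c * l).
Proof.
move=> [ur ui]; split; rewrite ?complex_ReM ?complex_ImM.
  rewrite (_ : (fun n => _) = (fun n => complex.Re c * complex.Re (u n) - complex.Im c * complex.Im (u n))).
    by apply: cvgB; apply: cvgM => //; exact: cvg_cst.
  by apply/funext => x; rewrite complex_ReM.
rewrite (_ : (fun n => _) = (fun n => complex.Re c * complex.Im (u n) + complex.Im c * complex.Re (u n))).
  by apply: cvgD; apply: cvgM => //; exact: cvg_cst.
by apply/funext => x; rewrite complex_ImM.
Qed.

Lemma ccvgB u1 u2 l1 l2 : ccvg u1 l1 -> ccvg u2 l2 ->
  ccvg (fun n => u1 n - u2 n) (l1 - l2).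
Proof.
move=> [ur ui] [vr vi]; split; rewrite raddfB/=.
  rewrite (_ : (fun n => _) = (fun n => complex.Re (u1 n) - complex.Re (u2 n))); first exact: cvgB.
  by apply/funext => x; rewrite raddfB.
rewrite (_ : (fun n => _) = (fun n => complex.Im (u1 n) - complex.Im (u2 n))); first exact: cvgB.
by apply/funext => x; rewrite raddfB.
Qed.

Lemma ccvg_sum0 m (u : nat -> nat -> R[i]) :
  (forall j, (j < m)%N -> ccvg (u j) 0) -> ccvg (fun n => \sum_(0 <= j < m) u j n) 0.
Proof.
elim: m => [_|m IH h].
  rewrite (_ : (fun x => _) = fun=> 0); first by split; exact: cvg_cst.
  by apply/funext => x; rewrite big_nil.
rewrite (_ : (fun x => _) = fun x => \sum_(0 <= j < m) u j x - -1 * u m x); last first.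
  by apply/funext => x; rewrite big_nat_recr//= mulN1r opprK.
rewrite -[X in ccvg _ X](_ : 0 - -1 * 0 = 0); last by rewrite mulr0 subrr.
apply: ccvgB; first by apply: IH => j jm; apply: h; exact: ltnW.
by apply: ccvgMl; exact: h.
Qed.

Lemma ccvg_clogB b1 b2 : slit b1 -> slit b2 ->
  ccvg (fun n => clog b1 n.+2%:R - clog b2 n.+2%:R) 0.
Proof.
move=> s1 s2; split; rewrite raddf0.
  rewrite (_ : (fun n => _) = (fun n => (complex.Re (clog b1 n.+2%:R) - ln n.+2%:R) -
     (complex.Re (clog b2 n.+2%:R) - ln n.+2%:R))).
    by rewrite -[X in _ --> X](subrr 0); apply: cvgB; exact: clog_infty_Re.
  by apply/funext => n; rewrite raddfB opprB addrA subrK.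
rewrite (_ : (fun n => _) = (fun n => complex.Im (clog b1 n.+2%:R) - complex.Im (clog b2 n.+2%:R))).
  by rewrite -[X in _ --> X](subrr 0); apply: cvgB; exact: clog_infty_Im.
by apply/funext => n; rewrite raddfB.
Qed.

End componentwise.

(** * Moduli and the distance to the cut *)

Section modulus.
Variable R : realType.

Lemma normc_ge0 (z : R[i]) : 0 <= normc z.
Proof. by case: z => a b; exact: sqrtr_ge0. Qed.

Lemma normc_gt0 (z : R[i]) : z != 0 -> 0 < normc z.
Proof.
move=> z0; rewrite lt0r normc_ge0 andbT.
by apply: contra z0 => /eqP/eq0_normc ->.
Qed.

Lemma normc_sqr (z : R[i]) : normc z ^+ 2 = complex.Re z ^+ 2 + complex.Im z ^+ 2.
Proof. by case: z => a b /=; rewrite sqr_sqrtr// addr_ge0 ?sqr_ge0. Qed.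

Lemma normr_Re_le (z : R[i]) : `|complex.Re z| <= normc z.
Proof.
rewrite -ler_sqr ?nnegrE ?normc_ge0// real_normK ?num_real// normc_sqr.
by rewrite lerDl sqr_ge0.
Qed.

Lemma normr_Im_le (z : R[i]) : `|complex.Im z| <= normc z.
Proof.
rewrite -ler_sqr ?nnegrE ?normc_ge0// real_normK ?num_real// normc_sqr.
by rewrite lerDr sqr_ge0.
Qed.

Lemma carg_bounds (t : R[i]) : slit t -> - pi < carg t < pi.
Proof.
move=> st; have t0 := slit_neq0 st; have r0 := normc_gt0 t0.
have b1 : complex.Re t / normc t <= 1.
  by rewrite ler_pdivrMr// mul1r (le_trans (ler_norm _))// normr_Re_le.
have b2 : -1 < complex.Re t / normc t.
  by rewrite ltr_pdivlMr// mulN1r -subr_gt0 opprK addrC.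
have a1 := acos_ltpi (introT andP (conj b2 b1)).
have a0 : 0 <= acos (complex.Re t / normc t) by rewrite acos_ge0// ltW.
rewrite /carg; case: ifP => _.
  by rewrite a1 andbT (lt_le_trans _ a0)// oppr_lt0 pi_gt0.
by rewrite ltrN2 a1/= (le_lt_trans _ (pi_gt0 R))// oppr_le0.
Qed.

(** For bounded [y] the distance to the cut is bounded below, and for large [y]
    the triangle inequality gives linear growth. *)
Lemma slit_dist (t : R[i]) : slit t ->
  exists2 c : R, 0 < c & forall y, 0 <= y -> c * (1 + y) <= normc (t + y%:C).
Proof.
move=> st; have [d d0 hd] : exists2 d : R, 0 < d & forall y, 0 <= y -> d <= normc (t + y%:C).
  case: t st => a b; rewrite slitE; have [-> /=|b0 _] := eqVneq b 0.
    move=> a0; exists a => // y y0; apply: le_trans (normr_Re_le ((a + y) +i* (0 + 0))).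
    by rewrite /= ger0_norm ?addr_ge0 ?(ltW a0)// lerDl.
  exists `|b|; first by rewrite normr_gt0.
  by move=> y y0; apply: le_trans (normr_Im_le _); rewrite /= addr0.
have n0 := normc_ge0 t.
have A0 : 0 < 1 + (1 + normc t) / d.
  by rewrite addr_gt0// divr_gt0// ltr_pwDl.
exists (1 + (1 + normc t) / d)^-1; first by rewrite invr_gt0.
move=> y y0; rewrite mulrC ler_pdivrMr// mulrDr mulr1.
have h1 : y - normc t <= normc (t + y%:C).
  apply: le_trans (normr_Re_le _); apply: le_trans (ler_norm _).
  have := le_trans (ler_norm _) (normr_Re_le (- t)).
  by rewrite !raddfD !raddfN/= normcN => h; rewrite -lerBlDr; lra.
have h2 : 1 + normc t <= normc (t + y%:C) * ((1 + normc t) / d).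
  rewrite mulrCA -[leLHS]mulr1 ler_wpM2l ?addr_ge0// ler_pdivlMr// mul1r.
  exact: hd.
by apply: le_trans (lerD h1 h2); rewrite addrCA subrK addrC.
Qed.

Lemma normc_real (r : R) : normc r%:C = `|r|.
Proof. by rewrite /= expr0n addr0 sqrtr_sqr. Qed.

Lemma slit_scale (t : R[i]) (r : R) : 0 < r -> slit t -> slit (r%:C * t).
Proof.
move=> r0; rewrite /slit normcM normc_real complex_ReM/= mul0r subr0 gtr0_norm//.
by rewrite -mulrDr; exact: mulr_gt0.
Qed.

Lemma Re_inv (z : R[i]) : complex.Re z^-1 = complex.Re z / normc z ^+ 2.
Proof. by rewrite normc_sqr; case: z => a b. Qed.

Lemma Im_inv (z : R[i]) : complex.Im z^-1 = - complex.Im z / normc z ^+ 2.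
Proof. by rewrite normc_sqr; case: z => a b /=; rewrite mulNr. Qed.

Lemma Re_inv_le (z : R[i]) : `|complex.Re z^-1| <= (normc z)^-1.
Proof.
have [->|z0] := eqVneq z 0; first by rewrite invr0 normc0 invr0 normr0.
have n0 := normc_gt0 z0.
rewrite Re_inv normrM normfV [`|_ ^+ 2|]ger0_norm ?sqr_ge0// ler_pdivrMr ?exprn_gt0//.
by rewrite expr2 mulKf ?gt_eqF// normr_Re_le.
Qed.

Lemma Im_inv_le (z : R[i]) : `|complex.Im z^-1| <= (normc z)^-1.
Proof.
have [->|z0] := eqVneq z 0; first by rewrite invr0 normc0 invr0 normr0.
have n0 := normc_gt0 z0.
rewrite Im_inv normrM normrN normfV [`|_ ^+ 2|]ger0_norm ?sqr_ge0// ler_pdivrMr ?exprn_gt0//.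
by rewrite expr2 mulKf ?gt_eqF// normr_Im_le.
Qed.

Lemma slit_subl (t : R[i]) (x : R) : slit t -> x <= 0 -> slit (t - x%:C).
Proof. by move=> st x0; rewrite addrC -rmorphN; apply: slit_addl => //; rewrite oppr_ge0. Qed.

Lemma normc_sub_sqr (t : R[i]) (x : R) :
  normc (t - x%:C) ^+ 2 = (complex.Re t - x) ^+ 2 + complex.Im t ^+ 2.
Proof. by rewrite normc_sqr; case: t => a b /=; rewrite subr0. Qed.

Lemma slit_real (t : R) : 0 < t -> slit t%:C.
Proof. by move=> t0; rewrite slitE t0 orbT. Qed.

Lemma slit_normc_sqr_gt0 (t : R[i]) (y : R) : slit t -> 0 <= y ->
  0 < (complex.Re t + y) ^+ 2 + complex.Im t ^+ 2.
Proof.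
move=> st y0; have := slit_neq0 (slit_addl st y0).
rewrite addrC => /normc_gt0 h; have := exprn_gt0 2 h.
by rewrite normc_sqr !raddfD/= addr0.
Qed.

End modulus.

(** * The Cauchy transform *)

Section cauchy_transform.
Variables (R : realType) (gamma : nat).
Hypothesis gamma_gt1 : (1 < gamma)%N.
Local Notation theta := (pi / gamma%:R : R).
Local Notation kern := (@kern R gamma).
Local Notation lambda := (@lebesgue_measure R).
Local Notation D := (`]-oo, (0 : R)[%classic).

Let gamma_gt0 : 0 < gamma%:R :> R.
Proof. by rewrite ltr0n ltnW. Qed.

Let gamma_neq0 : gamma%:R != 0 :> R.
Proof. by rewrite gt_eqF. Qed.

Section fixed_t.
Variable t : R[i].
Hypothesis st : slit t.

Local Notation w := (principal_root gamma t).
Let rho := normc t `^ gamma%:R^-1.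
Let psi := carg t / gamma%:R.

Let rho_gt0 : 0 < rho.
Proof. by rewrite powR_gt0// normc_gt0// slit_neq0. Qed.

Let wE : w = rho%:C * cis psi.
Proof. by []. Qed.

Let psi_bounds : - theta < psi < theta.
Proof.
have /andP[h1 h2] := carg_bounds st.
by rewrite -mulNr !ltr_pM2r ?invr_gt0// h1.
Qed.

Lemma principal_root_neq0 : w != 0.
Proof. by rewrite wE mulf_neq0 ?cis_neq0// fmorph_eq0 gt_eqF. Qed.

Let wX : w ^+ gamma = t.
Proof. by rewrite principal_rootX// ltnW. Qed.

Let eta j := psi + j.*2.+1%:R * theta - pi.

Let eta_bounds j : (j < gamma)%N -> - pi < eta j < pi.
Proof.
move=> jg; have /andP[h1 h2] := psi_bounds; have /andP[t0 t1] := theta_bounds R gamma_gt1.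
have hp : pi = gamma%:R * theta :> R by rewrite mulrCA divff// mulr1.
have e : (gamma.*2%:R : R) = gamma%:R + gamma%:R by rewrite -addnn natrD.
have b1 : 1 * theta <= j.*2.+1%:R * theta by rewrite ler_pM2r// ler1n.
have b2 : j.*2.+1%:R * theta <= (gamma.*2%:R - 1) * theta.
  by rewrite ler_pM2r// lerBrDr natr1 ler_nat; lia.
have e2 : (gamma.*2%:R - 1) * theta = pi + pi - theta.
  by rewrite e; move: (gamma%:R : R) gamma_neq0 (pi : R) => g g0 p; field.
rewrite e2 in b2; rewrite mul1r in b1.
rewrite /eta; move: (j.*2.+1%:R * theta) b1 b2 h1 h2 t0 t1.
move: theta (pi : R) {hp e2} => th p a b1 b2 h1 h2 t0 t1.
by apply/andP; split; lra.
Qed.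

Let neg_rootE j : - neg_root gamma w j = rho%:C * cis (eta j).
Proof.
rewrite /neg_root wE /eta cisD cisN cispi cisD invrN1 mulrN1 mulrN.
by rewrite -mulrA.
Qed.

Let slit_neg_root j : (j < gamma)%N -> slit (- neg_root gamma w j).
Proof. by move=> jg; rewrite neg_rootE; apply: slit_polar => //; exact: eta_bounds. Qed.

Let theta_pi : - pi < theta < pi.
Proof.
by case/andP: (theta_bounds R gamma_gt1) => t0 ->; rewrite (lt_trans _ t0)// oppr_lt0 pi_gt0.
Qed.

Let Ntheta_pi : - pi < - theta < pi.
Proof. by case/andP: theta_pi => h1 h2; rewrite ltrN2 h2/= ltrNl. Qed.

Let slit_cis (a : R) : - pi < a < pi -> slit (cis a).
Proof. by move=> ab; have := slit_polar ltr01 ab; rewrite mul1r. Qed.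

Definition cauchy_primitive (v : R) : R[i] := (2 * pi%:C * 'i)^-1 *
  \sum_(0 <= j < gamma)
    (cis_frac gamma w j.+1 * (clog (cis (- theta)) v - clog (- neg_root gamma w j) v) -
     cis_frac gamma w j * (clog (cis theta) v - clog (- neg_root gamma w j) v)).

(** At [v = 0] all the logarithms are purely imaginary up to [ln rho], and the
    arguments of consecutive roots differ by [2 * theta], so that the sum
    telescopes. The two extreme terms have the same coefficient [w / (w + 1)],
    and their arguments differ by [2 * pi]. *)
Lemma cauchy_primitive0 : cauchy_primitive 0 = - (w / (w + 1)).
Proof.
have i0 : 'i != 0 :> R[i] by rewrite neq0Ci.
have p0 : (pi%:C : R[i]) != 0 by rewrite fmorph_eq0 gt_eqF// pi_gt0.
have iE (a b : R) : a +i* b = a%:C + 'i * b%:C.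
  by apply/eqP; rewrite eq_complex/=; apply/andP; split; apply/eqP; ring.
have c1 (a : R) : - pi < a < pi -> clog (cis a) 0 = 'i * a%:C.
  by move=> ab; have := clog0 ltr01 ab; rewrite mul1r ln1 iE add0r.
pose c j := cis_frac gamma w j * ((ln rho)%:C + 'i * (psi + j.*2%:R * theta - pi)%:C).
have fg : cis_frac gamma w gamma = cis_frac gamma w 0.
  rewrite /cis_frac mul0r oppr0 cis0; congr (_ / (_ + _)).
  have -> : gamma.*2%:R * theta = pi *+ 2.
    by rewrite -muln2 natrM; move: (gamma%:R : R) gamma_neq0 (pi : R) => g g0 p; field.
  by rewrite cisN; have := cis2pi R 1; rewrite mul1r => ->; rewrite invr1.
rewrite /cauchy_primitive.
rewrite (@eq_big_nat _ _ _ _ _ _ (fun j => - c j.+1 - - c j)); last first.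
  move=> j /andP[_ jg].
  rewrite c1// c1// neg_rootE (clog0 rho_gt0 (eta_bounds jg)) iE /c /eta.
  have -> : psi + j.+1.*2%:R * theta - pi = psi + j.*2.+1%:R * theta - pi + theta.
    by rewrite doubleS -(natr1 j.*2.+1); move: theta (pi : R) => th p; ring.
  have -> : psi + j.*2%:R * theta - pi = psi + j.*2.+1%:R * theta - pi - theta.
    by rewrite -(natr1 j.*2); move: theta (pi : R) => th p; ring.
  move: theta => th; move: (psi + j.*2.+1%:R * th - pi) => A.
  rewrite (rmorphD (real_complex R) A) (rmorphB (real_complex R) A) (rmorphN (real_complex R)) /=.
  by move: A%:C th%:C (ln rho)%:C => a th' L; ring.
rewrite (telescope_sumr (fun j => - c j)) ?leq0n// /c fg.
rewrite /cis_frac mul0r oppr0 cis0 addr0.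
have -> : gamma.*2%:R * theta = pi + pi.
  by rewrite -muln2 natrM; move: (gamma%:R : R) gamma_neq0 (pi : R) => g g0 p; field.
rewrite addrA addrK.
have w1 : w + 1 != 0.
  have -> : w + 1 = 1%:C + w by rewrite addrC.
  apply/slit_neq0/slit_addl => //; rewrite wE; apply: slit_polar => //.
  have /andP[h1 h2] := psi_bounds; have /andP[h3 h4] := theta_pi.
  by rewrite (lt_trans _ h1) ?(lt_trans h2)//; have /andP[] := Ntheta_pi.
have pR : (pi : R) != 0 by rewrite gt_eqF// pi_gt0.
move: (pi : R) pR {p0} => p; rewrite -(fmorph_eq0 (real_complex R)) /= => p0.
rewrite (rmorphD (real_complex R) psi) (rmorphD (real_complex R) psi) (rmorphN (real_complex R)) /=.
move: (ln rho)%:C psi%:C p%:C p0 w1 => L ps P p0; move: w => W w1.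
by move: 'i i0 => I i0; field; nz.
Qed.

(** Each difference of logarithms tends to [0]. *)
Lemma ccvg_cauchy_primitive_infty : ccvg (fun n => cauchy_primitive n.+2%:R) 0.
Proof.
rewrite -[X in ccvg _ X](mulr0 (2 * pi%:C * 'i)^-1).
apply: ccvgMl; apply: ccvg_sum0 => j jg.
rewrite -[X in ccvg _ X](_ : cis_frac gamma w j.+1 * 0 - cis_frac gamma w j * 0 = 0); last first.
  by rewrite !mulr0 subrr.
by apply: ccvgB; apply: ccvgMl; apply: ccvg_clogB; rewrite ?slit_neg_root//; exact: slit_cis.
Qed.

Lemma neg_root_neq_real (v : R) j : 0 <= v -> (j < gamma)%N -> v%:C != neg_root gamma w j.
Proof.
move=> v0 jg; have := slit_neq0 (slit_addl (slit_neg_root jg) v0).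
by rewrite subr_eq0.
Qed.

Lemma slit_addX_neq0 (v : R) : 0 <= v -> v%:C ^+ gamma + w ^+ gamma != 0.
Proof.
move=> v0; rewrite wX -rmorphXn; apply: slit_neq0; apply: slit_addl => //.
by rewrite exprn_ge0.
Qed.

(** A vanishing denominator would give [t = (-1) ^+ gamma], while [- 1] lies on
    the cut. *)
Lemma cis_frac_denom_neq0 n : t != 1 -> w + cis (- (n.*2%:R * theta)) != 0.
Proof.
apply: contra; rewrite addr_eq0 => /eqP we.
have e1 : w ^+ gamma = (-1) ^+ gamma.
  rewrite we [LHS]exprNn cisX mulrN mulrCA.
  have -> : n.*2%:R * (gamma%:R * theta) = n%:R * (pi *+ 2).
    by rewrite -muln2 natrM; move: (gamma%:R : R) gamma_neq0 (pi : R) => g g0 p; field.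
  by rewrite cisN cis2pi invr1 mulr1.
rewrite -wX e1; case: (boolP (odd gamma)) => og; last by rewrite -signr_odd (negbTE og).
suff : slit (-1 : R[i]).
  have -> : (-1 : R[i]) = (-1) +i* 0 by apply/eqP; rewrite eq_complex/= oppr0 !eqxx.
  by rewrite slitE eqxx ltr0N1.
by have := st; rewrite -wX e1 -signr_odd og.
Qed.

Lemma is_cderive_cauchy_primitive (v : R) : t != 1 -> 0 <= v ->
  is_cderive cauchy_primitive v ((kern v)%:C * (t / (t + v%:C ^+ gamma))).
Proof.
move=> t1 v0; rewrite -[in X in is_cderive _ _ X]wX -partial_fractions//; last 4 first.
- exact: principal_root_neq0.
- exact: slit_addX_neq0.
- by move=> j; exact: neg_root_neq_real.
- by move=> n; exact: cis_frac_denom_neq0.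
apply: is_cderiveMl; apply: is_cderive_sum => j jg.
apply: is_cderiveB; apply: is_cderiveMl; apply: is_cderiveB; apply: is_cderive_clog => //.
- exact: slit_cis.
- exact: slit_neg_root.
- exact: slit_cis.
- exact: slit_neg_root.
Qed.

End fixed_t.
End cauchy_transform.

Section cauchy_transform_integral.
Variables (R : realType) (gamma : nat).
Hypothesis gamma_gt1 : (1 < gamma)%N.
Local Notation lambda := (@lebesgue_measure R).
Local Notation D := (`]-oo, (0 : R)[%classic).
Variable P : probability (measurableTypeR R) R.
Hypothesis PE : forall A, measurable A ->
  P A = (\int[lambda]_(x in A `&` D) (density_B gamma x)%:E)%E.

Lemma continuous_normc_sub_sqr (t : R[i]) (x : R) :
  {for x, continuous (fun y : R => normc (t - y%:C) ^+ 2)}.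
Proof.
rewrite (_ : (fun y => _) = (fun y => (complex.Re t - y) * (complex.Re t - y) + complex.Im t ^+ 2)).
  have h : (fun y => complex.Re t - y) y @[y --> x] --> complex.Re t - x.
    by apply: cvgB; [exact: cvg_cst|exact: cvg_id].
  by apply: cvgD; [exact: cvgM|exact: cvg_cst].
by apply/funext => y; rewrite normc_sub_sqr expr2.
Qed.

Lemma continuous_cauchy_kernel (t : R[i]) (x : R) : slit t -> x < 0 ->
  {for x, continuous (fun y : R => complex.Re (t - y%:C)^-1)} /\
  {for x, continuous (fun y : R => complex.Im (t - y%:C)^-1)}.
Proof.
move=> st x0; have n0 := normc_gt0 (slit_neq0 (slit_subl st (ltW x0))).
have cn : (fun y => (normc (t - y%:C) ^+ 2)^-1) y @[y --> x] --> (normc (t - x%:C) ^+ 2)^-1.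
  by apply: cvgV; [rewrite expf_neq0// gt_eqF|exact: continuous_normc_sub_sqr].
split.
  rewrite (_ : (fun y => _) = (fun y => (complex.Re t - y) * (normc (t - y%:C) ^+ 2)^-1)).
    by apply: cvgM => //; apply: cvgB; [exact: cvg_cst|exact: cvg_id].
  by apply/funext => y; rewrite Re_inv raddfB.
rewrite (_ : (fun y => _) = (fun y => (- complex.Im t) * (normc (t - y%:C) ^+ 2)^-1)).
  by apply: cvgM => //; exact: cvg_cst.
by apply/funext => y; rewrite Im_inv raddfB/= subr0.
Qed.

Lemma cauchy_kernel_bounded (t : R[i]) : slit t ->
  exists C : R, forall x : R, x < 0 ->
    `|complex.Re (t - x%:C)^-1| <= C /\ `|complex.Im (t - x%:C)^-1| <= C.
Proof.
move=> st; have [c c0 hc] := slit_dist st; exists c^-1 => x x0.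
have h : (normc (t - x%:C))^-1 <= c^-1.
  have := hc (- x); rewrite oppr_ge0 ltW// rmorphN/= => /(_ isT) h.
  have cx : c <= normc (t - x%:C).
    by apply: le_trans h; rewrite ler_peMr ?(ltW c0)// lerBrDl gerDr ltW.
  by rewrite lef_pV2 ?posrE// (lt_le_trans c0).
by split; apply: le_trans h; [exact: Re_inv_le|exact: Im_inv_le].
Qed.

Local Notation w t := (principal_root gamma t).

(** The integral of the Cauchy kernel is the increment of [cauchy_primitive / t]
    between [0] and infinity. *)
Lemma cauchy_transform_neq1 (t : R[i]) : slit t -> t != 1 ->
  cintegrable P D (fun z => (t - z%:C)^-1) /\
  cintegral P D (fun z => (t - z%:C)^-1) = (t * ((w t)^-1 + 1))^-1.
Proof.
move=> st t1; have [C hC] := cauchy_kernel_bounded st.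
have t0 := slit_neq0 st; have w0 := principal_root_neq0 gamma st.
have E (k u : R) : t^-1 * (k%:C * (t / (t + u%:C))) = k%:C * (t - (- u)%:C)^-1.
  by rewrite mulrCA [t^-1 * _]mulrA mulVf// mul1r rmorphN opprK.
have dcp v : 0 <= v -> is_cderive (fun v => t^-1 * cauchy_primitive gamma t v) v
    ((kern gamma v)%:C * (t - (- v ^+ gamma)%:C)^-1).
  move=> v0; rewrite -E rmorphXn; apply: is_cderiveMl.
  exact: is_cderive_cauchy_primitive.
have [ooR ooI] := ccvgMl t^-1 (ccvg_cauchy_primitive_infty gamma_gt1 st).
have [c0R c0I] := cvg_is_cderive0 (dcp 0 (lexx 0)).
rewrite cauchy_primitive0// in c0R c0I.
rewrite mulr0 /= in ooR ooI.
have dR (v : R) : 0 < v -> is_derive v 1 (fun v => complex.Re (t^-1 * cauchy_primitive gamma t v))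
    (kern gamma v * complex.Re (t - (- v ^+ gamma)%:C)^-1).
  by move=> /ltW/dcp[+ _]; rewrite complex_ReM/= mul0r subr0.
have dI (v : R) : 0 < v -> is_derive v 1 (fun v => complex.Im (t^-1 * cauchy_primitive gamma t v))
    (kern gamma v * complex.Im (t - (- v ^+ gamma)%:C)^-1).
  by move=> /ltW/dcp[_]; rewrite complex_ImM/= mul0r addr0.
have [iR IR] := integral_root_probability gamma_gt1 PE (fun x x0 => (hC x x0).1)
  (fun x x0 => (continuous_cauchy_kernel st x0).1) dR ooR c0R.
have [iI II] := integral_root_probability gamma_gt1 PE (fun x x0 => (hC x x0).2)
  (fun x x0 => (continuous_cauchy_kernel st x0).2) dI ooI c0I.
split; first by split.
have w1 : w t + 1 != 0.
  by have := cis_frac_denom_neq0 gamma_gt1 st 0 t1; rewrite mul0r oppr0 cis0.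
have -> : (t * ((w t)^-1 + 1))^-1 = - (t^-1 * - (w t / (w t + 1))).
  move: (w t) w0 w1 => W w0 w1; field; nz.
by rewrite /cintegral IR II !sub0r; case: (t^-1 * _).
Qed.

Lemma integrable_real_cauchy (t : R) : 0 < t ->
  P.-integrable D (fun x => ((t - x)^-1)%:E).
Proof.
move=> t0; apply: measurable_bounded_integrable.
- exact: measurable_itv.
- exact: (le_lt_trans (probability_le1 P (measurable_itv _)) (ltry 1)).
- apply: open_continuous_measurable_fun => // x; rewrite inE/= in_itv/= => x0.
  apply: cvgV; first by rewrite gt_eqF// subr_gt0 (lt_trans x0).
  by apply: cvgB; [exact: cvg_cst|exact: cvg_id].
- exists t^-1; split; rewrite ?num_real// => M tM x /=; rewrite in_itv/= => x0.
  have xt : 0 < t - x by rewrite subr_gt0 (lt_trans x0).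
  rewrite ger0_norm ?invr_ge0 ?(ltW xt)// (le_trans _ (ltW tM))// lef_pV2 ?posrE//.
  by rewrite lerBrDl gerDr ltW.
Qed.

(** At [t = 1] a denominator of the partial fractions can vanish; the value is
    obtained from neighbouring [t], both sides being continuous. *)
Lemma real_cauchy_transform (t : R) : 0 < t ->
  \int[P]_(x in D) (t - x)^-1 = (t * ((t `^ gamma%:R^-1)^-1 + 1))^-1.
Proof.
have ne1 (u : R) : 0 < u -> u != 1 ->
    \int[P]_(x in D) (u - x)^-1 = (u * ((u `^ gamma%:R^-1)^-1 + 1))^-1.
  move=> u0 u1.
  have uC1 : u%:C != 1 by rewrite -(rmorph1 (real_complex R)) (inj_eq (fmorph_inj (real_complex R))).
  have [_] := cauchy_transform_neq1 (slit_real u0) uC1.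
  rewrite principal_root_pos// -(rmorph1 (real_complex R)) -fmorphV -rmorphD -rmorphM -fmorphV.
  rewrite /cintegral => -[+ _] => <-; apply: eq_Rintegral => x _.
  rewrite /= subrr expr0n/= addr0; have [->|h] := eqVneq (u - x) 0.
    by rewrite invr0 mul0r.
  by field.
move=> t0; have [t1|] := eqVneq t 1; last exact: ne1.
rewrite {t}t1 in t0 *.
pose u (n : nat) : R := 1 + n.+2%:R^-1.
have u0 n : 0 < u n by rewrite addr_gt0// invr_gt0.
have u1 n : u n != 1 by rewrite /u -subr_eq0 addrC addKr invr_eq0 pnatr_eq0.
have uc : u n @[n --> \oo] --> (1 : R).
  rewrite -[X in _ --> X](addr0 1); apply: cvgD; [exact: cvg_cst|exact: cvg_inv_nat].
have l1 : \int[P]_(x in D) (u n - x)^-1 @[n --> \oo] --> \int[P]_(x in D) (1 - x)^-1.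
  apply/cvgrPdist_le => e e0; near=> n.
  apply: (@le_trans _ _ n.+2%:R^-1); last first.
    near: n; have := @cvg_inv_nat R => /cvgrPdist_le /(_ e e0); apply: filterS => n.
    by rewrite sub0r normrN ger0_norm.
  have i1 := integrable_real_cauchy t0; have i2 := integrable_real_cauchy (u0 n).
  have mD : measurable (D : set (measurableTypeR R)) by exact: measurable_itv.
  rewrite -RintegralB//.
  have ic : P.-integrable D (EFin \o (fun=> n.+2%:R^-1)).
    apply: finite_measure_integrable_cst => //.
  have icu : fine (P D) <= 1.
    rewrite -lee_fin fineK ?fin_num_measure//; exact: probability_le1.
  rewrite ger0_norm.
    apply: (@le_trans _ _ (\int[P]_(x in D) n.+2%:R^-1)).
      have ib := integrableB mD i1 i2.
      apply: le_Rintegral => //.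
      move=> x /=; rewrite in_itv/= => x0.
      have x1 : 1 <= 1 - x by rewrite lerBrDl gerDr ltW.
      have x2 : 1 <= u n - x.
        by rewrite (le_trans x1)// lerD2r lerDl invr_ge0.
      have -> : (1 - x)^-1 - (u n - x)^-1 = n.+2%:R^-1 * ((1 - x)^-1 * (u n - x)^-1).
        rewrite (_ : n.+2%:R^-1 = (u n - x) - (1 - x)); last by rewrite /u; ring.
        by field; rewrite !gt_eqF ?(lt_le_trans ltr01).
      rewrite ler_piMr ?invr_ge0// mulr_ile1 ?invr_ge0 ?(le_trans ler01)// invf_le1 ?(lt_le_trans ltr01)//.
    by rewrite Rintegral_cst// ler_piMr ?invr_ge0.
  apply: Rintegral_ge0 => // x /=; rewrite in_itv/= => x0.
  have x1 : 1 <= 1 - x by rewrite lerBrDl gerDr ltW.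
  rewrite subr_ge0 lef_pV2 ?posrE ?(lt_le_trans ltr01)// ?lerD2r ?lerDl ?invr_ge0//.
  by rewrite (le_trans x1)// lerD2r lerDl invr_ge0.
have l2 : \int[P]_(x in D) (u n - x)^-1 @[n --> \oo] --> (1 * ((1 `^ gamma%:R^-1)^-1 + 1))^-1.
  rewrite (_ : (fun n => _) = (fun n => (u n * ((u n `^ gamma%:R^-1)^-1 + 1))^-1)); last first.
    by apply/funext => n; rewrite ne1.
  have p1 : (1 `^ gamma%:R^-1 : R) = 1 by rewrite powR1.
  apply: cvgV; first by rewrite mul1r p1 invr1 gt_eqF.
  apply: cvgM => //; apply: cvgD; last exact: cvg_cst.
  apply: cvgV; first by rewrite p1 oner_neq0.
  apply: (@continuous_cvg _ _ _ _ _ _ (fun x => x `^ gamma%:R^-1)) => //.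
  apply/differentiable_continuous/derivable1_diffP.
  by have [] := is_derive1_powR gamma%:R^-1 (@ltr01 R).
exact: (cvg_unique _ l1 l2).
Unshelve. all: by end_near. Qed.

Lemma cauchy_transform (t : R[i]) : slit t ->
  cintegrable P D (fun z => (t - z%:C)^-1) /\
  cintegral P D (fun z => (t - z%:C)^-1) = (t * ((w t)^-1 + 1))^-1.
Proof.
move=> st; have [t1|] := eqVneq t 1; last exact: cauchy_transform_neq1.
rewrite t1; have E (x : R) : (1 - x%:C)^-1 = ((1 - x)^-1)%:C.
  by rewrite fmorphV rmorphB rmorph1.
have i1 := integrable_real_cauchy (@ltr01 R).
split.
  split.
    rewrite (_ : (fun x => _) = (fun x => ((1 - x)^-1)%:E))//.
    by apply/funext => x; rewrite E.
  rewrite (_ : (fun x => _) = cst 0%E); first exact: integrable0.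
  by apply/funext => x; rewrite E.
have := principal_root_pos gamma (@ltr01 R); rewrite rmorph1 => ->.
rewrite -fmorphV -[X in X * (_ + X)](rmorph1 (real_complex R)) -rmorphD -rmorphM -fmorphV.
rewrite -real_cauchy_transform// /cintegral; congr (_ +i* _).
  by apply: eq_Rintegral => x _; rewrite E.
transitivity (\int[P]_(x in D) (0 : R)); last by rewrite Rintegral_cst ?mul0r//; exact: measurable_itv.
by apply: eq_Rintegral => x _; rewrite E.
Qed.

End cauchy_transform_integral.

(** * Bernstein polynomials *)

Section bernstein.
Variable R : realType.

Definition bern (n k : nat) (x : R) : R := 'C(n, k)%:R * x ^+ k * (1 - x) ^+ (n - k).

Lemma bern_ge0 n k x : 0 <= x <= 1 -> 0 <= bern n k x.
Proof.
by move=> /andP[x0 x1]; rewrite /bern !mulr_ge0// exprn_ge0// subr_ge0.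
Qed.

Lemma sum_bern n x : \sum_(0 <= k < n.+1) bern n k x = 1.
Proof.
transitivity ((1 - x + x) ^+ n); last by rewrite subrK expr1n.
rewrite exprDn big_mkord; apply: eq_bigr => k _.
by rewrite /bern -mulr_natl; ring.
Qed.

Lemma sum_bern_shift n (f : nat -> R) x :
  \sum_(0 <= k < n.+2) k%:R * f k * bern n.+1 k x =
  n.+1%:R * x * \sum_(0 <= k < n.+1) f k.+1 * bern n k x.
Proof.
rewrite big_nat_recl// !mul0r add0r mulr_sumr; apply: eq_big_nat => k _.
have h : k.+1%:R * 'C(n.+1, k.+1)%:R = n.+1%:R * 'C(n, k)%:R :> R.
  by rewrite -!natrM mul_bin_diag.
rewrite /bern subSS exprS.
transitivity (k.+1%:R * 'C(n.+1, k.+1)%:R * (f k.+1 * x * x ^+ k * (1 - x) ^+ (n - k))).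
  by ring.
by rewrite h; ring.
Qed.

Lemma bern_variance n x :
  \sum_(0 <= k < n.+2) bern n.+1 k x * (k%:R / n.+1%:R - x) ^+ 2 = x * (1 - x) / n.+1%:R.
Proof.
have e1 : \sum_(0 <= k < n.+2) k%:R * 1 * bern n.+1 k x = n.+1%:R * x.
  rewrite (sum_bern_shift _ (fun=> 1)).
  by under eq_bigr do rewrite mul1r; rewrite sum_bern mulr1.
have e2 : \sum_(0 <= k < n.+2) k%:R * k%:R * bern n.+1 k x = n.+1%:R * x * (n%:R * x + 1).
  rewrite (sum_bern_shift _ (fun k => k%:R)); congr (_ * _).
  under eq_bigr do rewrite -natr1 mulrDl mul1r.
  rewrite big_split/= sum_bern; congr (_ + _).
  case: n {e1} => [|n]; first by rewrite big_nat1 mul0r mul0r.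
  rewrite (eq_bigr (fun k => k%:R * 1 * bern n.+1 k x)); last by move=> k _; rewrite mulr1.
  rewrite (sum_bern_shift _ (fun=> 1)).
  by under eq_bigr do rewrite mul1r; rewrite sum_bern mulr1.
have n0 : n.+1%:R != 0 :> R by [].
transitivity (\sum_(0 <= k < n.+2) (n.+1%:R ^- 2 * (k%:R * k%:R * bern n.+1 k x) -
   2 * x / n.+1%:R * (k%:R * 1 * bern n.+1 k x) + x ^+ 2 * bern n.+1 k x)).
  by apply: eq_bigr => k _; field.
rewrite big_split/= sumrB -!mulr_sumr e1 e2 sum_bern -(natr1 n).
by field; rewrite natr1.
Qed.

Definition bern_poly (f : R -> R) n : {poly R} :=
  \sum_(0 <= k < n.+1) (f (k%:R / n%:R) * 'C(n, k)%:R) *: ('X^k * (1 - 'X) ^+ (n - k)).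

Lemma horner_bern_poly f n x :
  (bern_poly f n).[x] = \sum_(0 <= k < n.+1) f (k%:R / n%:R) * bern n k x.
Proof.
rewrite horner_sum; apply: eq_bigr => k _.
by rewrite hornerZ hornerM hornerXn horner_exp !hornerE /bern; ring.
Qed.

(** The variance of the binomial law makes the estimate locally uniform, hence
    uniform on [[0, 1]] by compactness. *)
Lemma bernstein (f : R -> R) (M e : R) : continuous f -> (forall x, `|f x| <= M) -> 0 < e ->
  exists p : {poly R}, forall x, 0 <= x <= 1 -> `|p.[x] - f x| <= e.
Proof.
move=> cf fM e0.
have M0 : 0 <= M by rewrite (le_trans _ (fM 0)).
have cov : near_covering_within `[(0 : R), 1]%classic.
  by apply/near_covering_withinP/compact_near_coveringP; exact: segment_compact.
have := cov nat \oo (fun n x => `|(bern_poly f n.+1).[x] - f x| <= e) _.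
suff h : forall x : R, `[(0 : R), 1]%classic x -> \forall x' \near x & n \near \oo,
    `[(0 : R), 1]%classic x' -> `|(bern_poly f n.+1).[x'] - f x'| <= e.
  move=> /(_ _ h) [n _ hn]; exists (bern_poly f n.+1) => x x01.
  by apply: (hn n) => /=; rewrite ?in_itv.
move=> x0 _.
have e4 : 0 < e / 4 by rewrite divr_gt0.
have /cvgrPdist_le/(_ _ e4)[d /= d0 hd] := cf x0.
have d2 : 0 < d / 2 by rewrite divr_gt0.
(* [N] makes the contribution of the points farther than [d / 2] at most [e / 4] *)
pose N := (8 * M / (d / 2) ^+ 2 / e).
exists ([set x | `|x0 - x| < d / 2], [set n : nat | N <= n%:R]).
  split => /=; first by exists (d / 2).
  by apply: nbhs_infty_ger.
move=> [x n] [/= hx hn] x01; rewrite in_itv/= in x01.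
have fE : f x = \sum_(0 <= k < n.+2) f x * bern n.+1 k x.
  by rewrite -mulr_sumr sum_bern mulr1.
rewrite horner_bern_poly [X in _ - X]fE -sumrB.
apply: (le_trans (ler_norm_sum _ _ _)).
apply: (@le_trans _ _ (\sum_(0 <= k < n.+2) (e / 2 * bern n.+1 k x +
    2 * M / (d / 2) ^+ 2 * (bern n.+1 k x * (k%:R / n.+1%:R - x) ^+ 2)))).
  apply: ler_sum => k _; have b0 := bern_ge0 n.+1 k x01.
  rewrite -mulrBl normrM (ger0_norm b0) mulrC; set y := _ / _; set c := 2 * M / _.
  have -> : e / 2 * bern n.+1 k x + c * (bern n.+1 k x * (y - x) ^+ 2) =
    bern n.+1 k x * (e / 2 + c * (y - x) ^+ 2) by ring.
  apply: ler_wpM2l => //; rewrite {}/c.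
  have [yx|yx] := ltP `|y - x| (d / 2).
    apply: (@le_trans _ _ (e / 2)); last first.
      by rewrite lerDl mulr_ge0 ?sqr_ge0// divr_ge0 ?sqr_ge0// mulr_ge0.
    have y0 : `|x0 - y| < d.
      rewrite (_ : x0 - y = (x0 - x) - (y - x)); last by ring.
      by apply: (le_lt_trans (ler_normB _ _)); lra.
    have x0' : `|x0 - x| < d by lra.
    have := hd y y0; have := hd x x0' => /= h1 h2.
    rewrite (_ : f y - f x = (f x0 - f x) - (f x0 - f y)); last by ring.
    by apply: (le_trans (ler_normB _ _)); lra.
  apply: (@le_trans _ _ (2 * M)).
    by apply: (le_trans (ler_normB _ _)); have := fM x; have := fM y; lra.
  apply: (@le_trans _ _ (2 * M / (d / 2) ^+ 2 * (y - x) ^+ 2)); last first.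
    by rewrite lerDr divr_ge0// ltW.
  rewrite mulrAC ler_pdivlMr ?exprn_gt0//; apply: ler_wpM2l; first by rewrite mulr_ge0.
  by rewrite -[leRHS]real_normK ?num_real// lerXn2r ?nnegrE ?(ltW d2).
rewrite big_split/= -!mulr_sumr sum_bern bern_variance mulr1.
have n0 : 0 < n.+1%:R :> R by [].
have hN : N <= n.+1%:R by rewrite (le_trans hn)// ler_nat.
have {hN} hN : 8 * M / (d / 2) ^+ 2 <= e * n.+1%:R.
  by move: hN; rewrite /N ler_pdivrMr// [e * _]mulrC.
have A0 : 0 <= 2 * M / (d / 2) ^+ 2.
  by rewrite divr_ge0 ?sqr_ge0// mulr_ge0.
have x1 : x * (1 - x) <= 1 by move/andP: x01 => [? ?]; nra.
apply: (@le_trans _ _ (e / 2 + 2 * M / (d / 2) ^+ 2 * (1 / n.+1%:R))).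
  by rewrite lerD2l; apply: ler_wpM2l => //; rewrite ler_pM2r ?invr_gt0.
rewrite mul1r -lerBrDl ler_pdivrMr//.
have -> : 2 * M / (d / 2) ^+ 2 = (8 * M / (d / 2) ^+ 2) / 4 by field; rewrite gt_eqF.
by move: (_ / _ ^+ 2) hN => A; move: (_%:R) n0 => m; nra.
Qed.

End bernstein.

(** * Weak convergence from Stieltjes means *)

Section stieltjes_means.
Variable R : realType.
Local Notation D := (`]-oo, (0 : R)[%classic).
Variable P : probability (measurableTypeR R) R.
Hypothesis PD : P D = 1%E.
Variable s : nat -> seq R.
Hypothesis size_s : forall n, (0 < n)%N -> size (s n) = n.
Hypothesis s_ge0 : forall n x, (0 < n)%N -> x \in s n -> 0 <= x.
Hypothesis stieltjes : forall t, 0 < t ->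
  mean n (s n) (fun x => (t + x)^-1) @[n --> \oo] --> \int[P]_(x in D) (t - x)^-1.

Let mD : measurable (D : set (measurableTypeR R)).
Proof. exact: measurable_itv. Qed.

(** Weak convergence tested on one function, which is read at the opposites of
    the zeros. *)
Definition mean_cvg (g : R -> R) :=
  P.-integrable D (fun x => (g (- x))%:E) /\
  mean n (s n) g @[n --> \oo] --> \int[P]_(x in D) g (- x).

Lemma mean_cvg_ext g h : (forall x, 0 <= x -> g x = h x) -> mean_cvg g -> mean_cvg h.
Proof.
move=> gh [ig cg]; have ghN x : D x -> g (- x) = h (- x).
  by rewrite /= in_itv/= => x0; rewrite gh// oppr_ge0 ltW.
split.
  by apply: eq_integrable ig => // x; rewrite inE => /ghN ->.
rewrite (_ : \int[P]_(x in D) h (- x) = \int[P]_(x in D) g (- x)); last first.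
  by apply: eq_Rintegral => x; rewrite inE => /ghN ->.
apply: cvg_trans cg; apply: near_eq_cvg; near=> n; rewrite /mean; congr (_ / _).
apply: eq_big_seq => x xs; apply: gh; apply: s_ge0 xs.
by near: n; exact: nbhs_infty_gt.
Unshelve. all: by end_near. Qed.

Lemma mean_cvg_cst c : mean_cvg (fun=> c).
Proof.
split; first exact: finite_measure_integrable_cst.
have -> : \int[P]_(x in D) c = c * fine (P D) by exact: Rintegral_cst.
rewrite PD mulr1.
apply: (@cvg_trans _ ((fun=> c) @ \oo)); last exact: cvg_cst.
apply: near_eq_cvg; near=> n.
have n0 : (0 < n)%N by near: n; exact: nbhs_infty_gt.
rewrite /mean big_const_seq count_predT iter_addr_0 size_s//.
by rewrite -[c *+ n]mulr_natr mulfK// pnatr_eq0 -lt0n.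
Unshelve. all: by end_near. Qed.

Lemma mean_cvgD g h : mean_cvg g -> mean_cvg h -> mean_cvg (fun x => g x + h x).
Proof.
move=> [ig cg] [ih ch]; split; first exact: (integrableD mD ig ih).
rewrite RintegralD// (_ : (fun n => _) = (fun n => mean n (s n) g + mean n (s n) h)).
  exact: cvgD.
by apply/funext => n; rewrite /mean big_split/= mulrDl.
Qed.

Lemma mean_cvgZ c g : mean_cvg g -> mean_cvg (fun x => c * g x).
Proof.
move=> [ig cg]; split; first exact: (integrableZl mD c ig).
rewrite RintegralZl// (_ : (fun n => _) = (fun n => c * mean n (s n) g)).
  by apply: cvgM => //; exact: cvg_cst.
by apply/funext => n; rewrite /mean -mulr_sumr mulrA.
Qed.

Lemma mean_cvg_sum m (g : nat -> R -> R) :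
  (forall k, mean_cvg (g k)) -> mean_cvg (fun x => \sum_(0 <= k < m) g k x).
Proof.
move=> hg; elim: m => [|m IH].
  by apply: mean_cvg_ext (mean_cvg_cst 0) => x _; rewrite big_nil.
apply: mean_cvg_ext (mean_cvgD IH (hg m)) => x _.
by rewrite big_nat_recr.
Qed.

Lemma mean_cvg_unif g : P.-integrable D (fun x => (g (- x))%:E) ->
  (forall e, 0 < e -> exists2 h, mean_cvg h & forall x, 0 <= x -> `|g x - h x| <= e) ->
  mean_cvg g.
Proof.
move=> ig gh; split => //; apply/cvgrPdist_le => e e0.
have e3 : 0 < e / 3 by rewrite divr_gt0.
have [h [ih ch] hgh] := gh _ e3.
have bI : `|\int[P]_(x in D) g (- x) - \int[P]_(x in D) h (- x)| <= e / 3.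
  rewrite -RintegralB//.
  have iB := integrableB mD ig ih.
  apply: (le_trans (le_normr_Rintegral mD iB)).
  apply: (@le_trans _ _ (\int[P]_(x in D) (e / 3))).
    apply: le_Rintegral => //.
    - exact: (integrable_norm iB).
    - exact: finite_measure_integrable_cst.
    - by move=> x /=; rewrite in_itv/= => x0; apply: hgh; rewrite oppr_ge0 ltW.
  have -> : \int[P]_(x in D) (e / 3) = e / 3 * fine (P D) by exact: Rintegral_cst.
  by rewrite PD mulr1.
near=> n.
have n0 : (0 < n)%N by near: n; exact: nbhs_infty_gt.
have bE : `|mean n (s n) g - mean n (s n) h| <= e / 3.
  rewrite /mean -mulrBl -sumrB normrM normfV normr_nat ler_pdivrMr ?ltr0n//.
  apply: (le_trans (ler_norm_sum _ _ _)).
  apply: (@le_trans _ _ (\sum_(x <- s n) e / 3)).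
    rewrite !big_seq; apply: ler_sum => x xs; apply: hgh; exact: s_ge0 xs.
  by rewrite big_const_seq count_predT iter_addr_0 size_s// mulr_natr.
have bh : `|\int[P]_(x in D) h (- x) - mean n (s n) h| <= e / 3.
  by near: n; move/cvgrPdist_le : ch; exact.
rewrite (_ : _ - _ = (\int[P]_(x in D) g (- x) - \int[P]_(x in D) h (- x)) +
  (\int[P]_(x in D) h (- x) - mean n (s n) h) - (mean n (s n) g - mean n (s n) h)); last by ring.
apply: (le_trans (ler_normB _ _)).
have := ler_normD (\int[P]_(x in D) g (- x) - \int[P]_(x in D) h (- x))
  (\int[P]_(x in D) h (- x) - mean n (s n) h).
by lra.
Unshelve. all: by end_near. Qed.

Lemma integrable_bounded_continuous (g : R -> R) (M : R) :
  (forall x, 0 <= x -> `|g x| <= M) -> (forall x, 0 < x -> {for x, continuous g}) ->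
  P.-integrable D (fun x => (g (- x))%:E).
Proof.
move=> gM cg; apply: measurable_bounded_integrable => //.
- exact: (le_lt_trans (probability_le1 P mD) (ltry 1)).
- apply: open_continuous_measurable_fun => // x; rewrite inE/= in_itv/= => x0.
  apply: (@continuous_cvg _ _ _ _ _ _ g); first by apply: cg; rewrite oppr_gt0.
  by apply: cvgN; exact: cvg_id.
- exists M; split; rewrite ?num_real// => N MN x /=; rewrite in_itv/= => x0.
  by rewrite (le_trans _ (ltW MN))// gM// oppr_ge0 ltW.
Qed.

Lemma continuous_inv_shift (t x : R) k : 0 < t -> 0 <= x ->
  {for x, continuous (fun x => ((t + x)^-1) ^+ k)}.
Proof.
move=> t0 x0; apply: (@continuous_cvg _ _ _ _ _ _ (fun x : R => x ^+ k)).
  exact: exprn_continuous.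
apply: cvgV; first by rewrite gt_eqF// ltr_pwDl.
by apply: cvgD; [exact: cvg_cst|exact: cvg_id].
Qed.

(** The difference quotients in [t] of the [k]-th power converge, uniformly in
    [x >= 0], to a multiple of the next power. *)
Lemma mean_cvg_exp t k : 0 < t -> mean_cvg (fun x => ((t + x)^-1) ^+ k).
Proof.
case: k => [|k] t0.
  by apply: mean_cvg_ext (mean_cvg_cst 1) => x _; rewrite expr0.
have ibd u j : 0 < u -> P.-integrable D (fun x => (((u + - x)^-1) ^+ j)%:E).
  move=> u0; apply: (@integrable_bounded_continuous (fun x => ((u + x)^-1) ^+ j) (u^-1 ^+ j)).
    move=> x x0; have ux : 0 < u + x by rewrite ltr_pwDl.
    rewrite ger0_norm ?exprn_ge0 ?invr_ge0 ?(ltW ux)// lerXn2r ?nnegrE ?invr_ge0 ?(ltW ux) ?(ltW u0)//.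
    by rewrite lef_pV2 ?posrE// lerDl.
  by move=> x x0; apply: continuous_inv_shift => //; exact: ltW.
elim: k t t0 => [|k IH] t t0.
  split; first exact: ibd.
  have := stieltjes t0; rewrite /mean.
  under eq_fun do under eq_bigr do rewrite -[_^-1]expr1.
  by rewrite (_ : \int[P]_(x in D) (t - x)^-1 = \int[P]_(x in D) (t - x)^-1 ^+ 1).
apply: mean_cvg_unif => [|e e0]; first exact: ibd.
(* [K] bounds the Lipschitz constant in [t] of the power of exponent [k.+2] *)
pose K := k.+2%:R * t^-1 ^+ k.+3 : R.
have K0 : 0 < K by rewrite mulr_gt0// exprn_gt0// invr_gt0.
have [d d0 dK] : exists2 d, 0 < d & d * K = e.
  by exists (e / K); rewrite ?divr_gt0// divfK// gt_eqF.
have td : 0 < t + d by rewrite addr_gt0.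
exists (fun x => (k.+1%:R * d)^-1 * ((t + x)^-1 ^+ k.+1 + -1 * (t + d + x)^-1 ^+ k.+1)).
  apply: mean_cvgZ; apply: mean_cvgD; first exact: IH.
  by apply: mean_cvgZ; exact: IH.
move=> x x0.
have tx : 0 < t + x by rewrite ltr_pwDl.
have tdx : 0 < t + d + x by rewrite ltr_pwDl.
set a := (t + x)^-1; set b := (t + d + x)^-1.
have a0 : 0 < a by rewrite invr_gt0.
have b0 : 0 < b by rewrite invr_gt0.
have ab : a - b = d * (a * b).
  by rewrite /a /b; field; rewrite !gt_eqF.
have ba : b <= a by rewrite -subr_ge0 ab !mulr_ge0 ?(ltW a0) ?(ltW b0) ?(ltW d0).
have at1 : a <= t^-1 by rewrite lef_pV2 ?posrE// lerDl.
have -> : (k.+1%:R * d)^-1 * (a ^+ k.+1 + -1 * b ^+ k.+1) =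
    k.+1%:R^-1 * \sum_(i < k.+1) a * b * (a ^+ (k - i) * b ^+ i).
  have cancel (p q X S : R) : p != 0 -> q != 0 -> (p * q)^-1 * (q * X * S) = p^-1 * (X * S).
    by move=> p0 q0; field; rewrite p0 q0.
  by rewrite mulN1r subrXX ab -mulr_sumr cancel// gt_eqF.
have k0 : 0 < k.+1%:R :> R by [].
have up : k.+1%:R^-1 * \sum_(i < k.+1) a * b * (a ^+ (k - i) * b ^+ i) <= a ^+ k.+2.
  rewrite ler_pdivrMl//.
  apply: (@le_trans _ _ (\sum_(i < k.+1) a ^+ k.+2)).
    apply: ler_sum => i _.
    have -> : a ^+ k.+2 = a * a * (a ^+ (k - i) * a ^+ i).
      by rewrite -exprD subnK ?leq_ord// 2!exprS mulrA.
    apply: ler_pM; rewrite ?mulr_ge0 ?exprn_ge0 ?(ltW a0) ?(ltW b0)//.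
      by apply: ler_pM; rewrite ?(ltW a0) ?(ltW b0).
    by apply: ler_pM; rewrite ?exprn_ge0 ?(ltW a0) ?(ltW b0)// lerXn2r ?nnegrE ?(ltW a0) ?(ltW b0).
  by rewrite sumr_const card_ord mulr_natl.
have lo : b ^+ k.+2 <= k.+1%:R^-1 * \sum_(i < k.+1) a * b * (a ^+ (k - i) * b ^+ i).
  rewrite ler_pdivlMl//.
  apply: (@le_trans _ _ (\sum_(i < k.+1) b ^+ k.+2)).
    by rewrite sumr_const card_ord mulr_natl.
  apply: ler_sum => i _.
  have -> : b ^+ k.+2 = b * b * (b ^+ (k - i) * b ^+ i).
    by rewrite -exprD subnK ?leq_ord// 2!exprS mulrA.
  apply: ler_pM; rewrite ?mulr_ge0 ?exprn_ge0 ?(ltW a0) ?(ltW b0)//.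
    by apply: ler_pM; rewrite ?(ltW a0) ?(ltW b0).
  by apply: ler_pM; rewrite ?exprn_ge0 ?(ltW a0) ?(ltW b0)// lerXn2r ?nnegrE ?(ltW a0) ?(ltW b0).
rewrite ger0_norm ?subr_ge0//.
apply: (@le_trans _ _ (a ^+ k.+2 - b ^+ k.+2)); first by rewrite lerD2l lerN2.
rewrite subrXX ab.
apply: (@le_trans _ _ (d * (t^-1 * t^-1) * (k.+2%:R * t^-1 ^+ k.+1))).
  have ti : 0 <= t^-1 by rewrite invr_ge0 ltW.
  have bt : b <= t^-1 by rewrite (le_trans ba).
  apply: ler_pM.
  - by rewrite !mulr_ge0 ?(ltW a0) ?(ltW b0) ?(ltW d0).
  - by apply: sumr_ge0 => i _; rewrite mulr_ge0// exprn_ge0// ltW.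
  - by rewrite ler_pM2l//; apply: ler_pM => //; exact: ltW.
  - apply: (@le_trans _ _ (\sum_(i < k.+2) t^-1 ^+ k.+1)).
      apply: ler_sum => i _.
      have -> : t^-1 ^+ k.+1 = t^-1 ^+ (k.+1 - i) * t^-1 ^+ i.
        by rewrite -exprD subnK// -ltnS.
      by apply: ler_pM; rewrite ?exprn_ge0 ?(ltW a0) ?(ltW b0)// lerXn2r ?nnegrE ?(ltW a0) ?(ltW b0).
    by rewrite sumr_const card_ord mulr_natl.
have -> : d * (t^-1 * t^-1) * (k.+2%:R * t^-1 ^+ k.+1) = d * K.
  by rewrite /K !exprS; ring.
by rewrite dK.
Qed.

Lemma mean_cvg_poly (p : {poly R}) : mean_cvg (fun x => p.[(1 + x)^-1]).
Proof.
have h := @mean_cvg_sum (size p) (fun k x => p`_k * ((1 + x)^-1) ^+ k).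
apply: (mean_cvg_ext _ (h _)) => [x _|k]; first by rewrite horner_coef big_mkord.
by apply: mean_cvgZ; exact: mean_cvg_exp.
Qed.

(** [(1 + x)^-1] stays in [[0, 1]], where polynomials are uniformly dense. *)
Lemma mean_cvg_continuous (f : R -> R) (M : R) : continuous f ->
  (forall x, `|f x| <= M) -> mean_cvg (fun x => f (1 + x)^-1).
Proof.
move=> cf fM; apply: mean_cvg_unif => [|e e0].
  apply: (@integrable_bounded_continuous (fun x => f (1 + x)^-1) M) => // x x0.
  apply: (@continuous_cvg _ _ _ _ _ _ f); first exact: cf.
  apply: cvgV; first by rewrite gt_eqF// ltr_pwDl// ltW.
  by apply: cvgD; [exact: cvg_cst|exact: cvg_id].
have [p hp] := bernstein cf fM e0.
exists (fun x => p.[(1 + x)^-1]); first exact: mean_cvg_poly.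
move=> x x0; rewrite distrC; apply: hp.
by rewrite invr_ge0 addr_ge0//= invf_le1 ?lerDl// ltr_pwDl.
Qed.

End stieltjes_means.

(** * Test functions on the sphere *)

Section sphere.
Variable R : realType.
Local Notation D := (`]-oo, (0 : R)[%classic).

Lemma continuous_Re : continuous (fun z : R[i]^o => complex.Re (z : R[i])).
Proof.
move=> z; apply/(@cvgrPdist_lt _ _ _ _ (nbhs_filter (z : R[i]^o))) => e e0.
have eC : (0 : R[i]) < e%:C by rewrite ltcR.
near=> y.
have : `|(z : R[i]^o) - y| < e%:C by near: y; exact: (@cvgr_dist_lt _ _ _ (nbhs z) _ id z).
rewrite normc_def ltcR; apply: le_lt_trans; rewrite -sqrtr_sqr ler_sqrt; last first.
  by rewrite addr_ge0 ?sqr_ge0.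
by case: (z) (y) => a b [c d] /=; rewrite lerDl sqr_ge0.
Unshelve. all: by end_near. Qed.

(** The test function on the negative half-line closed at infinity, in the
    coordinate [u = (1 - x)^-1]; the point at infinity is [u = 0], and the
    constant extension to [u < 0] keeps it continuous on the line. *)
Definition sphere_coord (f : sphere R -> R) (u : R) : R :=
  if u <= 0 then f None else f (Some ((1 - u^-1)%:C : R[i]^o)).

Lemma sphere_coordE (f : sphere R -> R) (x : R) : 0 <= x ->
  sphere_coord f (1 + x)^-1 = f (Some ((- x)%:C : R[i]^o)).
Proof.
move=> x0; rewrite /sphere_coord leNgt invr_gt0 ltr_pwDl//= invrK.
by congr (f (Some _%:C)); ring.
Qed.

Lemma continuous_sphere_coord (f : sphere R -> R) : continuous f ->
  continuous (sphere_coord f).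
Proof.
move=> cf u; rewrite /continuous_at; have [u0|u0|->] := ltgtP u 0.
- rewrite {2}/sphere_coord ifT ?ltW//; apply: cvg_near_cst; near=> y.
  by rewrite /sphere_coord ifT//; apply: ltW; near: y; exact: lt_nbhsl.
- have h : (fun y : R => f (Some ((1 - y^-1)%:C : R[i]^o))) y @[y --> u] -->
      f (Some ((1 - u^-1)%:C : R[i]^o)).
    apply: (@continuous_cvg _ _ _ _ _ _ f); first exact: cf.
    apply: (@continuous_cvg _ _ _ _ _ _ (Some : R[i]^o -> sphere R)).
      exact: one_point_compactification_some_continuous.
    apply: (@continuous_cvg _ _ _ _ _ _ (fun x : R => x%:C : R[i]^o)).
      exact: continuous_real_complex.
    by apply: cvgB; [exact: cvg_cst|apply: cvgV; [rewrite gt_eqF|exact: cvg_id]].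
  rewrite {2}/sphere_coord ifF; last by rewrite leNgt u0.
  apply: cvg_trans h; apply: near_eq_cvg; near=> y; rewrite /sphere_coord ifF//.
  by apply/negbTE; rewrite -ltNge; near: y; exact: lt_nbhsr.
- rewrite {2}/sphere_coord lexx; apply/cvgrPdist_lt => e e0.
  have /cvgrPdist_lt/(_ _ e0) := cf None.
  case=> K [cK _] hK.
  have /compact_near_coveringP cov := cK.
  (* the compact set [K] lies in a half-plane [Re z >= - N] *)
  have [|N _ hN] := cov nat \oo (fun n z => - n%:R <= complex.Re z) _.
    move=> z Kz.
    exists ([set y | `|complex.Re z - complex.Re y| < 1], [set n : nat | 1 - complex.Re z <= n%:R]).
      split => /=; last exact: nbhs_infty_ger.
      by have /cvgrPdist_lt/(_ _ ltr01) := @continuous_Re z.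
    move=> [y n] [/= + hn]; rewrite ltr_norml => /andP[_ hy]; lra.
  near=> y; rewrite /sphere_coord; case: ifPn => [_|]; first by rewrite subrr normr0.
  rewrite -ltNge => y0; apply: hK; left; exists ((1 - y^-1)%:C) => //= Kz.
  have /= := hN N (leqnn N) _ Kz.
  rewrite lerBrDr addrC lerBlDr; apply/negP; rewrite -ltNge.
  rewrite -[ltLHS]invrK ltf_pV2 ?posrE//.
  near: y; apply: lt_nbhsl; by rewrite invr_gt0 ltr_pwDl.
Unshelve. all: by end_near. Qed.

Lemma measurable_sphere (f : sphere R -> R) : continuous f ->
  measurable_fun [set: borel (sphere R)] (f : borel (sphere R) -> R).
Proof.
move=> cf; apply: (measurability _ (RGenOpens.measurableE R)) => //.
move=> _ [_ [a [b ->]] <-]; rewrite setTI.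
by apply: sub_sigma_algebra; apply: open_comp => //; exact: interval_open.
Qed.

(** The linearity of the integral in the measure holds for nonnegative
    functions, whence the detour through [f + M]. *)
Lemma integral_empirical (n : nat) (p : {poly R[i]}) (f : borel (sphere R) -> R) (M : R) :
  (0 < n)%N -> (size p).-1 = n -> measurable_fun setT f -> (forall x, `|f x| <= M) ->
  \int[empirical n p]_x f x = (\sum_(z <- zeros p) f (Some z)) / n%:R.
Proof.
move=> n0 sp mf fM.
have M0 : 0 <= M by rewrite (le_trans _ (fM None)).
have p0 : p != 0 by apply: contraTneq n0 => p0; rewrite -sp p0 size_poly0.
have sz : size (zeros p) = n.
  rewrite -sp [in RHS](zerosE p) size_scale ?lead_coef_eq0// size_prod_XsubC//.
have eT : empirical n p setT = 1%E.
  by apply: empirical_setT => //; case: (size p) sp => // m /= ->.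
have bi (g : borel (sphere R) -> R) c : measurable_fun setT g -> (forall x, `|g x| <= c) ->
    (empirical n p).-integrable setT (EFin \o g).
  move=> mg gc; apply: measurable_bounded_integrable => //; first by rewrite eT ltry.
  exists c; split; rewrite ?num_real// => N cN x _ /=.
  by rewrite (le_trans (gc x))// ltW.
pose g x := f x + M.
have g0 x : 0 <= g x by have := fM x; rewrite ler_norml /g -lerBlDr sub0r => /andP[].
have mg : measurable_fun setT g by apply: measurable_funD.
have mgE : measurable_fun setT (EFin \o g) by exact/measurable_EFinP.
have Ig : \int[empirical n p]_x g x = (\sum_(z <- zeros p) g (Some z)) / n%:R.
  rewrite /Rintegral /empirical ge0_integral_measure_add//; last by move=> x _; rewrite lee_fin.
  rewrite !ge0_integral_mscale//=; last 2 first.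
  - by move=> x _; rewrite lee_fin.
  - by move=> x _; rewrite lee_fin.
  rewrite ge0_integral_measure_sum//; last by move=> x _; rewrite lee_fin.
  rewrite (eq_bigr (fun i : 'I_(size (zeros p)) => (g (Some (zeros p)`_i))%:E)); last first.
    by move=> i _; rewrite integral_dirac// diracT mul1e.
  rewrite sumEFin integral_dirac// diracT mul1e sp subnn mul0r mul0e adde0 /=.
  rewrite mulrC; congr (_ / _).
  by rewrite (big_nth 0) big_mkord.
have : \int[empirical n p]_x g x = \int[empirical n p]_x f x + M.
  rewrite /g RintegralD//; [|exact: bi fM|].
    by congr (_ + _); transitivity (M * fine (empirical n p setT));
      [exact: Rintegral_cst|rewrite eT mulr1].
  by apply: (bi (cst M) `|M|).
rewrite Ig /g big_split/= mulrDl => h; apply: (addIr M); rewrite -h; congr (_ + _).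
by rewrite big_const_seq count_predT iter_addr_0 sz -[M *+ n]mulr_natr mulfK// pnatr_eq0 -lt0n.
Qed.

(** All the measures involved live on the negative half-line, where a test
    function on the sphere is a continuous function of [(1 - x)^-1]. *)
Lemma weak_cvg_stieltjes (P : probability (measurableTypeR R) R)
    (p : nat -> {poly R[i]}) (F : R -> R) :
  P D = 1%E -> stieltjes_cvg p F ->
  (forall t, 0 < t -> \int[P]_(x in D) (t - x)^-1 = F t / t) ->
  weak_cvg (fun n => empirical n (p n)) (distribution P (@real_to_sphere R)).
Proof.
move=> PD [s [hs sF]] PF f cf [M fM].
have size_s n : (0 < n)%N -> size (s n) = n.
  move=> n0; have [h1 h2 _] := hs n n0.
  have p0 : p n != 0 by apply: contraTneq n0 => p0; rewrite -h2 p0 size_poly0.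
  rewrite -(size_map (fun x => (- x)%:C : R[i])) -h1 -[RHS]h2.
  by rewrite [in RHS](zerosE (p n)) size_scale ?lead_coef_eq0// size_prod_XsubC.
have s_ge0 n x : (0 < n)%N -> x \in s n -> 0 <= x.
  by move=> n0; have [_ _] := hs n n0; apply.
have st t : 0 < t ->
    mean n (s n) (fun x => (t + x)^-1) @[n --> \oo] --> \int[P]_(x in D) (t - x)^-1.
  move=> t0; rewrite PF//.
  rewrite (_ : (fun n => _) = (fun n => mean n (s n) (fun x => t / (t + x)) / t)).
    by apply: cvgM; [exact: sF|exact: cvg_cst].
  apply/funext => n; rewrite /mean -mulr_sumr mulrAC [t * _]mulrC mulfK ?gt_eqF//.
have fM' u : `|sphere_coord f u| <= M by rewrite /sphere_coord; case: ifP.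
have [ig cg] := mean_cvg_continuous PD size_s s_ge0 st (continuous_sphere_coord cf) fM'.
have mD : measurable (D : set (measurableTypeR R)) by exact: measurable_itv.
have mf := measurable_sphere cf.
have mfr : measurable_fun setT (f \o @real_to_sphere R : measurableTypeR R -> R).
  by apply: measurableT_comp => //; exact: measurable_real_to_sphere.
have ifr : P.-integrable setT (EFin \o (f \o @real_to_sphere R)).
  apply: measurable_bounded_integrable => //.
    exact: (le_lt_trans (probability_le1 P measurableT) (ltry 1)).
  exists M; split; rewrite ?num_real// => N MN x _ /=.
  by rewrite (le_trans (fM _))// ltW.
have -> : \int[distribution P (@real_to_sphere R)]_x f x =
    \int[P]_(x in D) sphere_coord f (1 - x)^-1.
  rewrite /Rintegral integral_distribution//; last exact/measurable_EFinP.
  have DC : P (~` D) = 0%E by rewrite probability_setC// PD subee.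
  rewrite (negligible_integral (measurableC mD) measurableT ifr DC).
  rewrite setTD setCK; congr fine; apply: eq_integral => x.
  rewrite inE/= in_itv/= => x0.
  by rewrite sphere_coordE ?oppr_ge0 ?(ltW x0)// opprK.
apply: cvg_trans cg; apply: near_eq_cvg; near=> n.
have n0 : (0 < n)%N by near: n; exact: nbhs_infty_gt.
have [h1 h2 h3] := hs n n0.
rewrite (integral_empirical n0 h2 mf fM) /mean h1 big_map; congr (_ / _).
by apply: eq_big_seq => x /h3 x0; rewrite sphere_coordE.
Unshelve. all: by end_near. Qed.

End sphere.

(** * The logarithmic potential *)

Section log_potential.
Variables (R : realType) (gamma : nat).
Hypothesis gamma_gt1 : (1 < gamma)%N.
Local Notation lambda := (@lebesgue_measure R).
Local Notation D := (`]-oo, (0 : R)[%classic).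
Local Notation U := (`[(0 : R), 1]%classic).
Variable P : probability (measurableTypeR R) R.
Hypothesis PE : forall A, measurable A ->
  P A = (\int[lambda]_(x in A `&` D) (density_B gamma x)%:E)%E.

(** [u |-> ln |A u + i b|] is a primitive of [A' A / (A ^ 2 + b ^ 2)]. *)
Lemma integral_dln_normc (A dA : R -> R) (b : R) :
  (forall u : R, is_derive u 1 A (dA u)) -> continuous dA ->
  (forall u : R, 0 <= u -> 0 < A u ^+ 2 + b ^+ 2) ->
  lambda.-integrable U (fun u => (dA u * A u / (A u ^+ 2 + b ^+ 2))%:E) /\
  (\int[lambda]_(u in U) (dA u * A u / (A u ^+ 2 + b ^+ 2))%:E =
   (ln (normc (A 1 +i* b)) - ln (normc (A 0 +i* b)))%:E)%E.
Proof.
move=> dAE cdA q0.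
have cA : continuous A.
  by move=> u; apply/differentiable_continuous/derivable1_diffP; case: (dAE u).
have lnE u : 0 <= u -> ln (normc (A u +i* b)) = 2^-1 * ln (A u ^+ 2 + b ^+ 2).
  move=> u0; rewrite -[A u ^+ 2 + b ^+ 2](normc_sqr (A u +i* b)) lnXn; last first.
    by apply: normc_gt0; apply: contraTneq (q0 u u0) => -[-> ->]; rewrite expr0n addr0 ltxx.
  by rewrite -[X in _ = _ * X]mulr_natl mulrA mulVf ?mul1r ?pnatr_eq0.
pose L (u : R) := 2^-1 * ln (A u ^+ 2 + b ^+ 2).
have dL (u : R) : 0 <= u -> is_derive u 1 L (dA u * A u / (A u ^+ 2 + b ^+ 2)).
  move=> u0; have h := dAE u.
  have hl := is_derive1_ln (q0 u u0).
  have hc := @is_derive1_comp _ (@ln R) (fun v => A v ^+ 2 + b ^+ 2) u _ _ hl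
    (is_deriveD (is_deriveX 2 h) (is_derive_cst (b ^+ 2) u 1)).
  have := is_deriveZ (2^-1 : R) hc.
  move=> h2; apply: (@is_derive_eq _ _ _ _ _ _ _ _ h2).
  rewrite /GRing.scale/=; move: (gt_eqF (q0 u u0)) => /negbT; move: (A u) (dA u) => a d q.
  by field.
have cL (u : R) : 0 <= u -> {for u, continuous L}.
  by move=> u0; apply/differentiable_continuous/derivable1_diffP; case: (dL u u0).
have cq : {within U, continuous (fun u : R => dA u * A u / (A u ^+ 2 + b ^+ 2))}.
  apply: continuous_in_subspaceT => u; rewrite inE/= in_itv/= => /andP[u0 _].
  apply: cvgM; first by apply: cvgM; [exact: cdA|exact: cA].
  apply: cvgV; first by rewrite gt_eqF// q0.
  by apply: cvgD; [apply: cvgM; exact: cA|exact: cvg_cst].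
split; first by apply: continuous_compact_integrable => //; exact: segment_compact.
rewrite (continuous_FTC2 ltr01 cq (F := L)).
- by rewrite !lnE// -EFinB.
- split.
  + by move=> u; rewrite in_itv/= => /andP[u0 _]; case: (dL u (ltW u0)).
  + by apply: cvg_at_right_filter; exact: cL.
  + by apply: cvg_at_left_filter; exact: cL.
- by move=> u; rewrite in_itv/= => /andP[u0 _]; rewrite derive1E; case: (dL u (ltW u0)).
Qed.

Lemma slit_principal_root (t : R[i]) : slit t -> slit (principal_root gamma t).
Proof.
move=> st; apply: slit_polar; first by rewrite powR_gt0// normc_gt0// slit_neq0.
have g0 : 1 < gamma%:R :> R by rewrite ltr1n.
have g1 := lt_trans ltr01 g0.
have /andP[h1 h2] := carg_bounds st; have p0 := pi_gt0 R.
rewrite ltr_pdivlMr// ltr_pdivrMr//; apply/andP; split.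
  by apply: le_lt_trans h1; rewrite mulNr lerN2 ler_peMr// ltW.
by apply: lt_le_trans h2 _; rewrite ler_peMr// ltW.
Qed.

(** [log_kernel t s] is the derivative of [u |-> ln |t + u ^ gamma s|]. *)
Definition log_kernel (t : R[i]) (s u : R) : R :=
  gamma%:R * u ^+ gamma.-1 * s * (complex.Re t + u ^+ gamma * s) /
  ((complex.Re t + u ^+ gamma * s) ^+ 2 + complex.Im t ^+ 2).

Lemma integral_log_kernel (t : R[i]) (s : R) : slit t -> 0 <= s ->
  (\int[lambda]_(u in U) (log_kernel t s u)%:E =
   (ln (normc (t + s%:C)) - ln (normc t))%:E)%E.
Proof.
move=> st s0.
have dA (u : R) : is_derive u 1 (fun u : R => complex.Re t + u ^+ gamma * s)
    (gamma%:R * u ^+ gamma.-1 * s).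
  have h := is_deriveX gamma (is_derive_id u (1 : R)).
  rewrite exprfctE in h.
  have h2 := is_deriveD (is_derive_cst (complex.Re t) u 1) (is_deriveM h (is_derive_cst s u 1)).
  apply: (@is_derive_eq _ _ _ _ _ _ _ _ h2).
  by rewrite /GRing.scale/= mulr0 !add0r mulr1 -mulr_natl; ring.
have cdA : continuous (fun u : R => gamma%:R * u ^+ gamma.-1 * s).
  move=> u; apply: cvgM; last exact: cvg_cst.
  by apply: cvgM; [exact: cvg_cst|exact: exprn_continuous].
have q0 (u : R) : 0 <= u -> 0 < (complex.Re t + u ^+ gamma * s) ^+ 2 + complex.Im t ^+ 2.
  by move=> u0; apply: slit_normc_sqr_gt0 => //; rewrite mulr_ge0 ?exprn_ge0.
have [_ ->] := integral_dln_normc dA cdA q0.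
rewrite expr1n mul1r expr0n gtn_eqF ?(ltnW gamma_gt1)// mul0r addr0.
by case: (t) => a b; rewrite /= addr0.
Qed.

Lemma log_kernelE (t : R[i]) (s u : R) :
  log_kernel t s u =
  gamma%:R * u ^+ gamma.-1 * s * complex.Re (t + (u ^+ gamma * s)%:C)^-1.
Proof.
rewrite Re_inv normc_sqr !raddfD/= addr0 /log_kernel; ring.
Qed.

Lemma principal_root_scale (t : R[i]) (u : R) : 0 < u -> t != 0 ->
  principal_root gamma ((u ^+ gamma)%:C * t) = u%:C * principal_root gamma t.
Proof.
move=> u0 t0; have r0 : 0 < u ^+ gamma by rewrite exprn_gt0.
rewrite /principal_root normcM normc_real gtr0_norm// powRM ?normc_ge0 ?(ltW r0)//.
rewrite -powR_mulrn ?(ltW u0)// -powRrM divff ?pnatr_eq0 ?gtn_eqF ?(ltnW gamma_gt1)//.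
rewrite powRr1 ?(ltW u0)// rmorphM mulrA; congr (_ * _ * _).
rewrite /carg normcM normc_real powR_mulrn ?(ltW u0)// gtr0_norm//.
rewrite complex_ReM complex_ImM /= !mul0r subr0 addr0 pmulr_rge0//.
by rewrite -mulf_div divff ?mul1r ?gt_eqF.
Qed.

Lemma scale_cauchy_kernel (t : R[i]) (x r : R) : slit t -> x < 0 -> 0 < r ->
  (- x)%:C * (t + (r * - x)%:C)^-1 =
  r^-1%:C * (1 - (r^-1%:C * t) * (r^-1%:C * t - x%:C)^-1).
Proof.
move=> st x0 r0; have rC : r%:C != 0 by rewrite fmorph_eq0 gt_eqF.
have h : t - r%:C * x%:C != 0.
  rewrite -rmorphM slit_neq0// slit_subl// -[r * x]opprK -mulrN oppr_le0.
  by rewrite mulr_ge0 ?oppr_ge0// ltW.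
have -> : (r * - x)%:C = - (r%:C * x%:C) by rewrite mulrN rmorphN rmorphM.
have -> : (- x)%:C = - x%:C by rewrite rmorphN.
have -> : r^-1%:C = r%:C^-1 by rewrite fmorphV.
move: h rC; move: x%:C r%:C => X Z h Z0.
by field; rewrite Z0 mulNr mulrC h.
Qed.

(** Dividing [t] by [u ^+ gamma] turns the kernel into the Cauchy kernel at a
    point whose principal root is that of [t] divided by [u]. *)
Lemma integral_log_kernel_probability (t : R[i]) (u : R) : slit t -> 0 < u ->
  P.-integrable D (fun x => (log_kernel t (- x) u)%:E) /\
  \int[P]_(x in D) log_kernel t (- x) u =
  gamma%:R * complex.Re (u%:C + principal_root gamma t)^-1.
Proof.
move=> st u0.
have [w wE] : {w | w = principal_root gamma t} by exists (principal_root gamma t).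
rewrite -wE.
have r0 : 0 < u ^+ gamma by rewrite exprn_gt0.
set r := u ^+ gamma; pose T := r^-1%:C * t.
have [c cE] : {c : R | c = gamma%:R / u} by exists (gamma%:R / u).
have sT : slit T by apply: slit_scale; rewrite ?invr_gt0.
have uC : u%:C != 0 :> R[i] by rewrite fmorph_eq0 gt_eqF.
have wT : principal_root gamma T = u^-1%:C * w.
  by rewrite /T /r -exprVn principal_root_scale ?invr_gt0// ?slit_neq0// wE.
have [[iRe iIm] cT] := cauchy_transform gamma_gt1 PE sT.
set f := fun x : R => (T - x%:C)^-1 in iRe iIm cT.
have kE (x : R) : x < 0 -> log_kernel t (- x) u =
    c - c * complex.Re T * complex.Re (f x) + c * complex.Im T * complex.Im (f x).
  move=> x0; rewrite log_kernelE -2!mulrA -/r.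
  have -> : u ^+ gamma.-1 * (- x * complex.Re (t + (r * - x)%:C)^-1) =
      u^-1 * complex.Re (1 - T * f x).
    rewrite -[X in u ^+ _ * X](_ : complex.Re ((- x)%:C * (t + (r * - x)%:C)^-1) = _); last first.
      by rewrite complex_ReM /= mul0r subr0.
    rewrite scale_cauchy_kernel// complex_ReM [complex.Im _%:C]/= mul0r subr0 mulrA.
    congr (_ * _); rewrite [complex.Re _%:C]/= /r -[in u ^+ gamma](prednK (ltnW gamma_gt1)) exprS invfM.
    by rewrite mulrCA mulfV ?mulr1// gt_eqF// exprn_gt0.
  rewrite (_ : complex.Re (1 - T * f x) = 1 - complex.Re (T * f x)); last by case: (T * f x).
  rewrite complex_ReM cE.
  by move: (complex.Re T) (complex.Im T) (complex.Re (f x)) (complex.Im (f x)) => a b c' d; ring.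
have mD : measurable (D : set (measurableTypeR R)) by exact: measurable_itv.
have PD : P D = 1%E by rewrite PE// setIid integral_density_B.
have ic : P.-integrable D (EFin \o cst c).
  by apply: finite_measure_integrable_cst.
have i1 : P.-integrable D (EFin \o (fun x : R => c * complex.Re T * complex.Re (f x))).
  exact: (integrableZl mD (c * complex.Re T) iRe).
have i2 : P.-integrable D (EFin \o (fun x : R => c * complex.Im T * complex.Im (f x))).
  exact: (integrableZl mD (c * complex.Im T) iIm).
have i3 : P.-integrable D (EFin \o (fun x : R => c - c * complex.Re T * complex.Re (f x))).
  exact: (integrableB mD ic i1).
split.
  apply: eq_integrable (integrableD mD i3 i2) => // x; rewrite inE/= in_itv/= => x0.
  by rewrite kE.
transitivity (\int[P]_(x in D)
    (c - c * complex.Re T * complex.Re (f x) + c * complex.Im T * complex.Im (f x))).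
  by apply: eq_Rintegral => x; rewrite inE/= in_itv/= => x0; rewrite kE.
rewrite RintegralD// RintegralB// !RintegralZl//.
have -> : \int[P]_(x in D) c = c.
  transitivity (c * fine (P D)); first exact: Rintegral_cst.
  by rewrite PD mulr1.
have := congr1 (fun z => complex.Re (T * z)) cT.
rewrite /= complex_ReM [complex.Re (cintegral _ _ _)]/= [complex.Im (cintegral _ _ _)]/=.
have w0 : w != 0 by rewrite wE principal_root_neq0.
have uw0 : u%:C + w != 0 by rewrite slit_neq0// slit_addl ?(ltW u0)// wE slit_principal_root.
have -> : T * (T * ((principal_root gamma T)^-1 + 1))^-1 = 1 - u%:C * (u%:C + w)^-1.
  rewrite wT invfM mulrA mulfV ?slit_neq0// mul1r.
  have -> : u^-1%:C = u%:C^-1 by rewrite fmorphV.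
  rewrite invfM invrK -[X in _ + X](divff w0) -mulrDl invfM invrK.
  by rewrite -[X in X - _](divff uw0) -mulrBl [_ + w - _]addrAC subrr add0r mulrC.
rewrite (_ : complex.Re (1 - _) = 1 - complex.Re (u%:C / (u%:C + w))); last by case: (_ / _).
rewrite complex_ReM [complex.Re _%:C]/= [complex.Im _%:C]/= mul0r subr0 => h.
rewrite -!mulrA -addrA -mulrN -mulrDr addrC.
have -> (a b : R) : - a + b = - (a - b) by rewrite opprB addrC.
rewrite h [complex.Re u%:C]/= cE.
by move: (complex.Re _) => q; field; rewrite gt_eqF.
Qed.

Lemma measurable_log_kernel (t : R[i]) :
  measurable_fun setT (fun z : measurableTypeR R * measurableTypeR R => log_kernel t (- z.1) z.2).
Proof.
have m1 : measurable_fun setT (fun z : measurableTypeR R * measurableTypeR R => - z.1).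
  by apply: measurable_funN; exact: measurable_fst.
have mq : measurable_fun setT (fun z : measurableTypeR R * measurableTypeR R =>
    complex.Re t + z.2 ^+ gamma * - z.1).
  apply: measurable_funD; first exact: measurable_cst.
  by apply: measurable_funM => //; apply: measurable_funX; exact: measurable_snd.
apply: measurable_funM.
  do 2!apply: measurable_funM => //; apply: measurable_funM; first exact: measurable_cst.
  by apply: measurable_funX; exact: measurable_snd.
have mq2 : measurable_fun setT (fun z : measurableTypeR R * measurableTypeR R =>
    (complex.Re t + z.2 ^+ gamma * - z.1) ^+ 2 + complex.Im t ^+ 2).
  by apply: measurable_funD; [apply: measurable_funX|exact: measurable_cst].
(* the inverse is a real power, hence measurable *)
have -> : (fun z : measurableTypeR R * measurableTypeR R =>
    ((complex.Re t + z.2 ^+ gamma * - z.1) ^+ 2 + complex.Im t ^+ 2)^-1) =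
  (fun z => ((complex.Re t + z.2 ^+ gamma * - z.1) ^+ 2 + complex.Im t ^+ 2) `^ (-1)).
  by apply/funext => z; rewrite powR_inv1// addr_ge0 ?sqr_ge0.
exact: measurableT_comp (measurable_powR (-1)) mq2.
Qed.

(** By [slit_dist], [|t + y|] is at least a multiple of [1 + y]; the kernel at [1]
    is positive and its integral is known. *)
Lemma log_kernel_bound (t : R[i]) : slit t ->
  exists2 C : R, 0 <= C & forall s u : R, 0 <= s -> 0 <= u ->
    `|log_kernel t s u| <= C * log_kernel 1 s u.
Proof.
move=> st; have [c c0 hc] := slit_dist st; exists c^-1; first by rewrite invr_ge0 ltW.
move=> s u s0 u0; have us0 : 0 <= u ^+ gamma * s by rewrite mulr_ge0 ?exprn_ge0.
have p0 : 0 <= gamma%:R * u ^+ gamma.-1 * s by rewrite !mulr_ge0 ?exprn_ge0.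
have h1 : 0 < 1 + u ^+ gamma * s by rewrite ltr_pwDl.
have hq := hc _ us0; have q0 : 0 < c * (1 + u ^+ gamma * s) by rewrite mulr_gt0.
rewrite !log_kernelE normrM ger0_norm// mulrCA ler_wpM2l//.
apply: (le_trans (Re_inv_le _)).
have -> : complex.Re ((1 : R[i]) + (u ^+ gamma * s)%:C)^-1 = (1 + u ^+ gamma * s)^-1.
  by rewrite -[1 in LHS](rmorph1 (real_complex R)) -rmorphD -fmorphV.
by rewrite -invfM lef_pV2 ?posrE// (lt_le_trans q0).
Qed.

(** [ln |t - x| - ln |t|] is the integral over [u] of [log_kernel]. Exchanging
    the integrals leaves the one of the derivative of [gamma * ln |u + w|],
    where [w] is the principal root of [t], and [ln |t| = gamma * ln |w|]. *)
Lemma log_potential (t : R[i]) : slit t ->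
  P.-integrable D (fun x => (ln (normc (t - x%:C)))%:E) /\
  \int[P]_(x in D) ln (normc (t - x%:C)) =
  gamma%:R * ln (normc (1 + principal_root gamma t)).
Proof.
move=> st; have sw := slit_principal_root st; set w := principal_root gamma t.
have mD : measurable (D : set (measurableTypeR R)) by exact: measurable_itv.
have PD : P D = 1%E by rewrite PE// setIid integral_density_B.
have [C C0 hC] := log_kernel_bound st.
(* the endpoint [u = 0] is left out, as the inner integral is only known for [u > 0] *)
pose A : set (measurableTypeR R) := `]0, 1]%classic.
have mA : measurable A by exact: measurable_itv.
have lA : (lambda A < +oo)%E.
  by rewrite /A lebesgue_measure_itv/= lte01 oppr0 adde0 ltry.
have w1 : principal_root gamma 1 = 1 :> R[i].
  by have := principal_root_pos gamma (@ltr01 R); rewrite powR1.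
have s1 : slit (1 : R[i]) by exact: slit_real ltr01.
have bound (u : R) : A u -> (\int[P]_(x in D) `|log_kernel t (- x) u|%:E <= (C * gamma%:R)%:E)%E.
  rewrite /A/= in_itv/= => /andP[u0 _].
  have [i1 I1] := integral_log_kernel_probability s1 u0.
  have [it It] := integral_log_kernel_probability st u0.
  apply: (@le_trans _ _ (\int[P]_(x in D) (C * log_kernel 1 (- x) u)%:E)%E).
    apply: le_integral => //.
    - exact: (integrable_norm it).
    - exact: (integrableZl mD C i1).
    - move=> x; rewrite inE/= in_itv/= => x0; rewrite lee_fin.
      by apply: hC; rewrite ?oppr_ge0 ltW.
  have -> : (\int[P]_(x in D) (C * log_kernel 1 (- x) u)%:E =
      C%:E * \int[P]_(x in D) (log_kernel 1 (- x) u)%:E)%E.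
    by rewrite -integralZl.
  rewrite -[X in (_ * X)%E]fineK ?integrable_fin_num// -EFinM lee_fin.
  rewrite ler_wpM2l// [leLHS]I1 w1 ler_piMr//.
  have -> : complex.Re (u%:C + 1)^-1 = (u + 1)^-1.
    by rewrite -[1 in LHS](rmorph1 (real_complex R)) -rmorphD -fmorphV.
  by rewrite invf_le1 ?ltr_wpDl ?(ltW u0)// lerDr ltW.
have CG0 : 0 <= C * gamma%:R by rewrite mulr_ge0.
have [ig E] := fubini_bounded mA mD (measurable_log_kernel t) lA CG0 bound.
have clE (x : R) : x < 0 -> (\int[lambda]_(u in A) (log_kernel t (- x) u)%:E =
    (ln (normc (t - x%:C)) - ln (normc t))%:E)%E.
  move=> x0; rewrite /A integral_itv_obnd_cbnd.
    rewrite integral_log_kernel// ?oppr_ge0 ?(ltW x0)//.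
    by rewrite rmorphN.
  apply/measurable_EFinP; apply: (@measurable_funS _ _ _ _ setT) => //.
  exact: measurableT_comp (measurable_log_kernel t) (pair1_measurable (x : measurableTypeR R)).
have ig' : P.-integrable D (EFin \o (fun x : R => ln (normc (t - x%:C)) - ln (normc t))).
  by apply: eq_integrable ig => // x; rewrite inE/= in_itv/= => x0; rewrite clE.
have ic : P.-integrable D (EFin \o cst (ln (normc t))) by apply: finite_measure_integrable_cst.
have il : P.-integrable D (fun x => (ln (normc (t - x%:C)))%:E).
  apply: eq_integrable (integrableD mD ig' ic) => // x _.
  by rewrite /= -EFinD subrK.
split=> //.
have dRe (u : R) : is_derive u 1 (fun u : R => u + complex.Re w) 1.
  by have h := is_deriveD (is_derive_id u 1) (is_derive_cst (complex.Re w) u 1);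
    apply: (@is_derive_eq _ _ _ _ _ _ _ _ h); rewrite addr0.
have qw (u : R) : 0 <= u -> 0 < (u + complex.Re w) ^+ 2 + complex.Im w ^+ 2.
  by move=> u0; rewrite addrC [u + _]addrC addrC; exact: slit_normc_sqr_gt0.
have [iw Iw] := integral_dln_normc dRe (fun u => @cvg_cst _ _ _ _ _) qw.
have kw (u : R) : 1 * (u + complex.Re w) / ((u + complex.Re w) ^+ 2 + complex.Im w ^+ 2) =
    complex.Re (u%:C + w)^-1.
  by rewrite Re_inv normc_sqr !raddfD/= add0r mul1r.
have E1 : (\int[P]_(x in D) \int[lambda]_(u in A) (log_kernel t (- x) u)%:E =
    (\int[P]_(x in D) ln (normc (t - x%:C)) - ln (normc t))%:E)%E.
  transitivity (\int[P]_(x in D) (ln (normc (t - x%:C)) - ln (normc t))%:E)%E.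
    by apply: eq_integral => x; rewrite inE/= in_itv/= => x0; rewrite clE.
  rewrite -[LHS]fineK ?integrable_fin_num//; congr (_%:E).
  rewrite [LHS](RintegralB mD il ic); congr (_ - _).
  transitivity (ln (normc t) * fine (P D)); first exact: Rintegral_cst.
  by rewrite PD mulr1.
have E2 : (\int[lambda]_(u in A) \int[P]_(x in D) (log_kernel t (- x) u)%:E =
    (gamma%:R * (ln (normc (1 + w)) - ln (normc w)))%:E)%E.
  transitivity (\int[lambda]_(u in A) (gamma%:R%:E * (complex.Re (u%:C + w)^-1)%:E))%E.
    apply: eq_integral => u; rewrite inE /A/= in_itv/= => /andP[u0 _].
    have [it It] := integral_log_kernel_probability st u0.
    by rewrite -[LHS]fineK ?integrable_fin_num// -EFinM -It.
  have iw' : lambda.-integrable U (fun u : R => (complex.Re (u%:C + w)^-1)%:E).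
    by apply: eq_integrable iw => // u _; rewrite kw.
  rewrite integral_itv_obnd_cbnd; last first.
    apply: (@measurable_funS _ _ _ _ U) => //; first exact: subset_itv_oc_cc.
    by apply: measurable_int (integrableZl _ _ iw'); exact: measurable_itv.
  rewrite integralZl//.
  rewrite EFinM; congr (_ * _)%E.
  under eq_integral do rewrite -kw.
  rewrite Iw; congr (_ - _)%:E; congr (ln (normc _)).
    by apply/eqP; rewrite eq_complex !raddfD/= add0r !eqxx.
  by apply/eqP; rewrite eq_complex/= add0r !eqxx.
have Ln : \int[P]_(x in D) ln (normc (t - x%:C)) - ln (normc t) =
    gamma%:R * (ln (normc (1 + w)) - ln (normc w)).
  by apply: EFin_inj; rewrite -E1 -E2; exact: E.
have Lt : ln (normc t) = gamma%:R * ln (normc w).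
  rewrite -{1}(principal_rootX t (ltnW gamma_gt1)) -/w.
  have -> : normc (w ^+ gamma) = normc w ^+ gamma.
    by elim: gamma => [|m IH]; rewrite ?expr0 ?normc1// !exprS normcM IH.
  by rewrite lnXn ?normc_gt0 ?slit_neq0// mulr_natl.
move/eqP: Ln; rewrite subr_eq => /eqP ->; rewrite Lt; ring.
Qed.

End log_potential.

(** * The limit of the zero distributions *)

Lemma exists_density_B (R : realType) (gamma : nat) : (1 < gamma)%N ->
  exists P : probability (measurableTypeR R) R, forall A, measurable A ->
    P A = (\int[@lebesgue_measure R]_(x in A `&` `]-oo, 0%R[%classic)
      (density_B gamma x)%:E)%E.
Proof.
move=> g1; apply: density_probability.
- exact: measurable_itv.
- exact: measurable_density_B.
- by move=> x; rewrite /= in_itv/= => x0; exact: density_B_ge0.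
- exact: integral_density_B.
Qed.

Section limit.
Variables (R : realType) (gamma : nat).
Hypothesis gamma_gt1 : (1 < gamma)%N.
Local Notation D := (`]-oo, (0 : R)[%classic).
Variable P : probability (measurableTypeR R) R.
Hypothesis PE : forall A, measurable A ->
  P A = (\int[@lebesgue_measure R]_(x in A `&` D) (density_B gamma x)%:E)%E.

Lemma density_B_support : P D = 1%E.
Proof. by rewrite PE ?setIid ?integral_density_B//; exact: measurable_itv. Qed.

Lemma weak_cvg_density_B (p : nat -> {poly R[i]}) :
  stieltjes_cvg p (fun t => t `^ gamma%:R^-1 / (1 + t `^ gamma%:R^-1)) ->
  weak_cvg (fun n => empirical n (p n)) (distribution P (@real_to_sphere R)).
Proof.
move=> pF; apply: (weak_cvg_stieltjes density_B_support pF) => t t0.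
rewrite (real_cauchy_transform gamma_gt1 PE)//.
have w0 : 0 < t `^ gamma%:R^-1 by rewrite powR_gt0.
move: (t `^ _) w0 => w w0; have w1 : 0 < 1 + w by rewrite ltr_pwDl// ltW.
by field; nz.
Qed.

End limit.

Theorem theorem4p7 (R : realType) :
  exists mu : nat -> probability (measurableTypeR R) R,
    (forall gamma : nat, (2 <= gamma)%N ->
      [/\ mu gamma `]-oo, 0[%classic = 1%E,
          weak_cvg (fun n => empirical n (Bpoly R n gamma))
            (distribution (mu gamma) (@real_to_sphere R)),
          (forall t : R[i], slit_plane t ->
            cintegrable (mu gamma) `]-oo, 0[%classic (fun z => (t - z%:C)^-1) /\
            cintegral (mu gamma) `]-oo, 0[%classic (fun z => (t - z%:C)^-1) =
              (t * ((principal_root gamma t)^-1 + 1))^-1),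
          (forall A : set (measurableTypeR R), measurable A ->
            mu gamma A =
              (\int[@lebesgue_measure R]_(x in A `&` `]-oo, 0%R[%classic)
                 (density_B gamma x)%:E)%E) &
          (forall t : R[i], slit_plane t ->
            (mu gamma).-integrable `]-oo, 0[%classic
              (fun z => (ln (normc (t - z%:C)))%:E) /\
            \int[mu gamma]_(z in `]-oo, 0[%classic) ln (normc (t - z%:C)) =
              gamma%:R * ln (normc (1 + principal_root gamma t)))]) /\
    weak_cvg (fun n => empirical n (narayana_poly R n))
      (distribution (mu 2%N) (@real_to_sphere R)).
Proof.
have density_at (gamma : nat) : exists P : probability (measurableTypeR R) R,
    (2 <= gamma)%N -> forall A, measurable A ->
    P A = (\int[@lebesgue_measure R]_(x in A `&` `]-oo, 0%R[%classic)
      (density_B gamma x)%:E)%E.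
  have [g2|g2] := leqP 2 gamma; first by have [P PE] := exists_density_B R g2; exists P.
  (* the measure of index [2] serves as default value *)
  by have [P _] := exists_density_B R (leqnn 2); exists P.
have [mu muE] := choice density_at; exists mu; split; last first.
  apply: (weak_cvg_density_B (leqnn 2) (muE 2%N (leqnn 2))); exact: stieltjes_cvg_narayana.
move=> gamma g2; have PE := muE gamma g2; split.
- by have := density_B_support g2 PE.
- apply: (weak_cvg_density_B g2 PE).
  by rewrite -(prednK (ltnW g2)); exact: stieltjes_cvg_Bpoly.
- by move=> t /slit_planeP st; exact: cauchy_transform.
- exact: PE.
- by move=> t /slit_planeP st; exact: log_potential.
Qed.
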